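(* Let $n\ge1$, $i\ge0$, $k\ge1$ and $l$ be integers, $0<\alpha\le1$, $l+\alpha\ge0$, let $Y$ be a Banach space, $T\in\mathscr D'(\mathbf R^n,Y)$, and $a\in\mathbf R^n$. Then the following four statements hold. (1) If $l\ge0$ and, for $o\in\boldsymbol\Xi(n,k)$, the distribution $\mathrm D^oT$ is $\boldsymbol\nu_{\mathbf B(0,1)}^i$ pointwise differentiable of order $l$ at $a$, then, for $m=0,\dots,k-1$ and $\xi\in\boldsymbol\Xi(n,m)$, the distribution $\mathrm D^\xi T$ is $\boldsymbol\nu_{\mathbf B(0,1)}^i$ pointwise differentiable of order $k+l-m$ at $a$. (2) If, for $o\in\boldsymbol\Xi(n,k)$, the distribution $\mathrm D^oT$ is $\boldsymbol\nu_{\mathbf B(0,1)}^i$ pointwise differentiable of order $(l,\alpha)$ at $a$, then, for $m=0,\dots,k-1$ and $\xi\in\boldsymbol\Xi(n,m)$, the distribution $\mathrm D^\xi T$ is $\boldsymbol\nu_{\mathbf B(0,1)}^i$ pointwise differentiable of order $(k+l-m,\alpha)$ at $a$. (3) If $l\ge0$ and, for $o\in\boldsymbol\Xi(n,k)$, the distribution $\mathrm D^oT$ is pointwise differentiable of order $l$ at $a$, then, for $m=0,\dots,k-1$ and $\xi\in\boldsymbol\Xi(n,m)$, the distribution $\mathrm D^\xi T$ is pointwise differentiable of order $k+l-m$ at $a$. (4) If, for $o\in\boldsymbol\Xi(n,k)$, the distribution $\mathrm D^oT$ is pointwise differentiable of order $(l,\alpha)$ at $a$, then, for $m=0,\dots,k-1$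 and $\xi\in\boldsymbol\Xi(n,m)$, the distribution $\mathrm D^\xi T$ is pointwise differentiable of order $(k+l-m,\alpha)$ at $a$. Moreover, under the hypotheses of any of these statements, there holds $$e^{o-\xi}\mathop{\lrcorner}\operatorname{pt}\mathrm D^{k-m+\mu}(\mathrm D^\xi T)(a)=\operatorname{pt}\mathrm D^\mu(\mathrm D^oT)(a)$$ whenever $m=0,\dots,k-1$, $\xi\in\boldsymbol\Xi(n,m)$, $\mu=0,\dots,l$, $o\in\boldsymbol\Xi(n,k)$, and $\xi\le o$ (componentwise).
   Context: All vector spaces are real. $Y^\ast$ is the Banach space of continuous linear functionals on $Y$, and $\langle y,\upsilon\rangle=\upsilon(y)$ (also applied pointwise to functions). $\mathscr L^n$ is Lebesgue measure; $\mathbf B(a,r)$ is the closed ball. $\mathscr D(\mathbf R^n,Y)$ is the space of compactly supported $C^\infty$ functions $\mathbf R^n\to Y$ with its usual locally convex (inductive limit) topology, $\mathscr D'(\mathbf R^n,Y)$ is the space of continuous linear maps $T:\mathscr D(\mathbf R^n,Y)\to\mathbf R$, and $\mathscr D_K(\mathbf R^n,Y)=\{\phi\in\mathscr D(\mathbf R^n,Y):\operatorname{spt}\phi\subset K\}$. One writes $T_x(\phi(x))$ for $T(\phi)$. $\boldsymbol\Xi(n,m)$ is the set of multi-indices $\xi=(\xi_1,\dots,\xi_n)$ of nonnegative integers with sum $m$, and $(\mathrm D^\xi T)(\phi)=(-1)^mT(\mathrm D^\xi\phi)$. Derivatives $\mathrm D^mf(a)$ are symmetric $m$-linear maps on $(\mathbf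 R^n)^m$ with norm $\|\psi\|=\sup\{|\psi(v_1,\dots,v_m)|:|v_j|\le1\}$. For compact $K$, $\boldsymbol\nu_K^i(\phi)=\sup\{\|\mathrm D^m\phi(x)\|:x\in K,\ m=0,\dots,i\}$. A polynomial function of degree at most $-1$ is the zero function. With $e_1,\dots,e_n$ the standard basis of $\mathbf R^n$, for a multi-index $\pi\in\boldsymbol\Xi(n,p)$ and a symmetric $(p+\mu)$-linear map $\psi$ on $(\mathbf R^n)^{p+\mu}$, $e^\pi\mathop{\lrcorner}\psi$ is the symmetric $\mu$-linear map sending $(v_1,\dots,v_\mu)$ to $\psi(v_1,\dots,v_\mu,e_1,\dots,e_1,\dots,e_n,\dots,e_n)$ with each $e_j$ repeated $\pi_j$ times. Definitions. Let $R\in\mathscr D'(\mathbf R^n,Y)$, $a\in\mathbf R^n$, let $P$ denote a polynomial function $\mathbf R^n\to Y^\ast$ and put $S(\phi)=\int\langle\phi,P\rangle\,d\mathscr L^n$. Write $\nu=\boldsymbol\nu_{\mathbf B(0,1)}^i$. - For an integer $q\ge0$: $R$ is pointwise differentiable of order $q$ at $a$ iff for some $P$ of degree at most $q$, $\lim_{r\to0+}r^{-q-n}(R-S)_x(\phi(r^{-1}(x-a)))=0$ for all $\phi\in\mathscr D(\mathbf R^n,Y)$; such $P$ is unique, and $\operatorname{pt}\mathrm D^qR(a)=\mathrm D^qP(a)$ (then also $\operatorname{pt}\mathrm D^pR(a)=\mathrm D^pP(a)$ for $p=0,\dots,q$). - For an integer $q\ge0$: $R$ is $\nu$ pointwise differentiable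 of order $q$ at $a$ iff for some $P$ of degree at most $q$, $\lim_{r\to0+}\sup\{r^{-q-n}(R-S)_x(\phi(r^{-1}(x-a))):\phi\in\mathscr D_{\mathbf B(0,1)}(\mathbf R^n,Y),\ \nu(\phi)\le1\}=0$. - For an integer $q$ and $0<\alpha\le1$ with $q+\alpha\ge0$: $R$ is pointwise differentiable of order $(q,\alpha)$ at $a$ iff for some $P$ of degree at most $q$, $\limsup_{r\to0+}r^{-q-\alpha-n}(R-S)_x(\phi(r^{-1}(x-a)))<\infty$ for all $\phi\in\mathscr D(\mathbf R^n,Y)$; and $\nu$ pointwise differentiable of order $(q,\alpha)$ at $a$ iff for some $P$ of degree at most $q$, $\limsup_{r\to0+}\sup\{r^{-q-\alpha-n}(R-S)_x(\phi(r^{-1}(x-a))):\phi\in\mathscr D_{\mathbf B(0,1)}(\mathbf R^n,Y),\ \nu(\phi)\le1\}<\infty$. Each of the last two types of condition implies pointwise differentiability of order $q$ with the same polynomial $P$. *)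

(* Defs.v *)
From HB Require Import structures.
From mathcomp Require Import all_boot all_order all_algebra.
From mathcomp Require Import all_classical all_reals all_analysis.

Set Implicit Arguments.
Unset Strict Implicit.
Unset Printing Implicit Defensive.

Import Order.TTheory GRing.Theory Num.Theory.
Import numFieldNormedType.Exports.

Local Open Scope classical_set_scope.
Local Open Scope ring_scope.

(* [dual Y] is the space Y^* of continuous linear functionals on Y, normed by
   the operator norm; this norm is what gives meaning below to derivatives of
   functions with values in Y^*. *)
Section Dual.
Context {R : realType} (Y : normedModType R).

Definition dual_pred : {pred (Y -> R^o)} :=
  fun f => `[< linear f /\ continuous f >].

Lemma dual_submod_closed : submod_closed dual_pred.
Proof.
split.
  apply/asboolP; split; first by move=> c x y /=; rewrite scaler0 addr0.
  exact: cst_continuous.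
move=> c f g /asboolP [lf cf] /asboolP [lg cg]; apply/asboolP; split.
  move=> d x y.
  have E z : (c *: f + g) z = c *: f z + g z by [].
  by rewrite !E lf lg !scalerDr !scalerA addrACA [d * c]mulrC.
by move=> x; apply: cvgD; [apply: cvgZl_tmp; exact: cf | exact: cg].
Qed.

HB.instance Definition _ := GRing.isSubmodClosed.Build R (Y -> R^o) dual_pred
  dual_submod_closed.

Record dual := Dual { dual_val : Y -> R^o; _ : dual_pred dual_val }.
HB.instance Definition _ := [isSub for dual_val].
HB.instance Definition _ := [Choice of dual by <:].
HB.instance Definition _ := [SubChoice_isSubLmodule of dual by <:].
End Dual.

Section DualNorm.
Context {R : realType} {Y : normedModType R}.
Implicit Types f g : dual Y.

Definition pairing (y : Y) (f : dual Y) : R := dual_val f y.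

Definition dual_norm f : R :=
  sup [set `|pairing y f| | y in [set y : Y | `|y| <= 1]].

Lemma pairing_linear f : linear (fun y => pairing y f : R^o).
Proof. by case: f => f /= /asboolP[]. Qed.

Lemma pairing_continuous f : continuous (fun y => pairing y f : R^o).
Proof. by case: f => f /= /asboolP[]. Qed.

Lemma pairing0r f : pairing 0 f = 0.
Proof.
have := pairing_linear f 1 0 0; rewrite scaler0 addr0 scale1r.
by move=> /(congr1 (fun z => z - pairing 0 f)); rewrite subrr addrK.
Qed.

Lemma pairingZr c y f : pairing (c *: y) f = c * pairing y f.
Proof. by have := pairing_linear f c y 0; rewrite addr0 pairing0r addr0. Qed.

Lemma pairingZ c y f : pairing y (c *: f) = c * pairing y f.
Proof. by []. Qed.

Lemma pairingD y f g : pairing y (f + g) = pairing y f + pairing y g.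
Proof. by []. Qed.

Lemma dual_norm_has_sup f :
  has_sup [set `|pairing y f| | y in [set y : Y | `|y| <= 1]].
Proof.
split.
  by exists `|pairing 0 f|, 0 => //=; rewrite normr0.
have [d d0 hd] : exists2 d : R, 0 < d &
    forall y : Y, `|y| < d -> `|pairing y f| < 1.
  have /cvgrPdist_lt/(_ 1 ltr01) := @pairing_continuous f 0.
  move=> /nbhs_norm0P [d /= d0 hd]; exists d => // y yd.
  by have := hd y yd; rewrite /= pairing0r sub0r normrN.
exists (2 / d) => _ [y /= y1 <-].
have d2 : 0 < d / 2 by rewrite divr_gt0.
have dy : `|pairing (d / 2 *: y) f| < 1.
  apply: hd; rewrite normrZ gtr0_norm//.
  rewrite (@le_lt_trans _ _ (d / 2))//; first by rewrite ler_piMr// ltW.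
  by rewrite ltr_pdivrMr// ltr_pMr// ltr1n.
have -> : y = (2 / d) *: (d / 2 *: y).
  by rewrite scalerA mulrA divfK ?gt_eqF// divff ?scale1r// pnatr_eq0.
rewrite pairingZr normrM gtr0_norm ?divr_gt0//.
by rewrite ler_piMr ?ltW// divr_gt0.
Qed.

Lemma dual_norm_ub f y : `|y| <= 1 -> `|pairing y f| <= dual_norm f.
Proof.
by move=> y1; apply: ub_le_sup; [case: (dual_norm_has_sup f) | exists y].
Qed.

Lemma dual_norm_le f (c : R) :
  (forall y : Y, `|y| <= 1 -> `|pairing y f| <= c) -> dual_norm f <= c.
Proof.
move=> h; apply: ge_sup; first by case: (dual_norm_has_sup f).
by move=> _ [y /= y1 <-]; exact: h.
Qed.

Lemma dual_normD f g : dual_norm (f + g) <= dual_norm f + dual_norm g.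
Proof.
apply: dual_norm_le => y y1; rewrite pairingD (le_trans (ler_normD _ _))//.
by rewrite lerD ?dual_norm_ub.
Qed.

Lemma dual_normZ c f : dual_norm (c *: f) = `|c| * dual_norm f.
Proof.
have le e g : dual_norm (e *: g) <= `|e| * dual_norm g.
  apply: dual_norm_le => y y1.
  by rewrite pairingZ normrM ler_wpM2l// dual_norm_ub.
apply/eqP; rewrite eq_le le/=; have [->|c0] := eqVneq c 0.
  rewrite normr0 mul0r (le_trans _ (@dual_norm_ub _ 0 _)) ?normr0//.
rewrite -ler_pdivlMl ?normr_gt0// -normfV (le_trans _ (le _ _))//.
by rewrite scalerA mulVf// scale1r.
Qed.

Lemma dual_norm0_eq0 f : dual_norm f = 0 -> f = 0.
Proof.
move=> f0; apply/val_inj/funext => y /=.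
suff : pairing y f = 0 by [].
have [->|y0] := eqVneq y 0; first by rewrite pairing0r.
have := @dual_norm_ub f (`|y|^-1 *: y).
rewrite f0 normrZ normfV normr_id mulVf ?normr_eq0// => /(_ (lexx _)).
by rewrite pairingZr normr_le0 mulf_eq0 invr_eq0 normr_eq0 (negbTE y0) => /eqP.
Qed.

HB.instance Definition _ :=
  Lmodule_isNormed.Build R (dual Y) dual_normD dual_normZ dual_norm0_eq0.
End DualNorm.

Section LebesgueStep.
Context {R : realType} (n : nat).
Variable mu :
  {sigma_finite_measure set (n.-tuple (measurableTypeR R)) -> \bar R}.

(* Lebesgue measure on R^(n+1) as the product of Lebesgue measure on R and the
   given measure on R^n, transported from R x R^n to (n+1)-tuples. *)
Definition tuple_cons (p : measurableTypeR R * n.-tuple (measurableTypeR R)) :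
  n.+1.-tuple (measurableTypeR R) := [tuple of p.1 :: p.2].

Lemma measurable_tuple_cons : measurable_fun setT tuple_cons.
Proof. exact: measurable_cons. Qed.

Definition lebesgue_step : set (n.+1.-tuple (measurableTypeR R)) -> \bar R :=
  pushforward (lebesgue_measure \x mu)%E tuple_cons.

Let mpre (A : set (n.+1.-tuple (measurableTypeR R))) :
  measurable A -> measurable (tuple_cons @^-1` A).
Proof.
by move=> mA; rewrite -[X in measurable X]setTI; exact: measurable_tuple_cons.
Qed.

Let lebesgue_step0 : lebesgue_step set0 = 0%E.
Proof. by rewrite /lebesgue_step /pushforward preimage_set0 measure0. Qed.

Let lebesgue_step_ge0 A : (0 <= lebesgue_step A)%E.
Proof. by apply: integral_ge0 => x _; exact: measure_ge0. Qed.

Let lebesgue_step_sigma_additive : semi_sigma_additive lebesgue_step.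
Proof.
move=> F mF tF mUF; rewrite /lebesgue_step /pushforward preimage_bigcup.
apply: measure_semi_sigma_additive.
- by move=> k; exact: mpre.
- apply/trivIsetP => /= i j _ _ ij; rewrite -preimage_setI.
  by move/trivIsetP : tF => /(_ _ _ _ _ ij) ->//; rewrite preimage_set0.
- by rewrite -preimage_bigcup; exact: mpre.
Qed.

HB.instance Definition _ := isMeasure.Build _ _ _ lebesgue_step
  lebesgue_step0 lebesgue_step_ge0 lebesgue_step_sigma_additive.

Let lebesgue_step_sigma_finite : sigma_finite setT lebesgue_step.
Proof.
have /sigma_finiteP[A [AT ndA Aoo]] := sigma_finiteT (@lebesgue_measure R).
have /sigma_finiteP[B [BT ndB Boo]] := sigma_finiteT mu.
have [F FT Ff] : sigma_finite setT (lebesgue_measure \x mu)%E.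
  exists (fun k => A k `*` B k).
    rewrite -setXTT AT BT predeqE => -[x y]; split.
      move=> [/= [p _ Ax] [q _ By]]; exists (maxn p q) => //; split.
      - by move: x Ax; exact/subsetPset/ndA/leq_maxl.
      - by move: y By; exact/subsetPset/ndB/leq_maxr.
    by move=> [p _ []/= ? ?]; split; exists p.
  move=> k; have [? ?] := Aoo k; have [? ?] := Boo k.
  split; first exact: measurableX.
  by rewrite product_measure1E// lte_mul_pinfty// ge0_fin_numE.
pose g (t : n.+1.-tuple (measurableTypeR R)) := (thead t, [tuple of behead t]).
have Kg p : g (tuple_cons p) = p.
  by case: p => x t; rewrite /g /tuple_cons /=; congr pair; apply/val_inj.
exists (fun k => g @^-1` F k).
  by rewrite -preimage_bigcup -FT preimage_setT.
move=> k; have [mF Foo] := Ff k; split.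
  rewrite -[X in measurable X]setTI; suff : measurable_fun setT g by exact.
  apply/measurable_fun_pairP; split; first exact: measurable_tnth.
  exact: measurable_behead.
rewrite /lebesgue_step /pushforward.
by rewrite (_ : _ @^-1` _ = F k)//; apply/seteqP; split => p /=; rewrite Kg.
Qed.

HB.instance Definition _ := Measure_isSigmaFinite.Build _ _ _ lebesgue_step
  lebesgue_step_sigma_finite.
End LebesgueStep.

Fixpoint lebesgue_tuple (R : realType) (n : nat) :
    {sigma_finite_measure set (n.-tuple (measurableTypeR R)) -> \bar R} :=
  match n with
  | 0 => dirac ([tuple] : 0.-tuple (measurableTypeR R))
  | n'.+1 => lebesgue_step (lebesgue_tuple R n')
  end.

Section Derivatives.
Context {R : realType} {n : nat} {W : normedModType R}.
Local Notation V := 'rV[R]_n.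

(* 'rV[R]_n is topologized by the sup norm, which induces the usual topology;
   balls and norms of multilinear maps refer to the Euclidean norm. *)
Definition enorm (v : V) : R := Num.sqrt (\sum_(j < n) v ord0 j ^+ 2).

Definition eball (a : V) (r : R) : set V := [set x | enorm (x - a) <= r].

(* iter_derive [:: v_1; ...; v_m] f a is D^m f(a)(v_1, ..., v_m). *)
Fixpoint iter_derive (vs : seq V) (f : V -> W) : V -> W :=
  if vs is v :: vs' then fun x => 'D_v (iter_derive vs' f) x else f.

(* Class C^oo: every iterated directional derivative is Frechet differentiable
   everywhere, hence in particular continuous. *)
Definition smooth (f : V -> W) :=
  forall (vs : seq V) (x : V), differentiable (iter_derive vs f) x.

Definition Dn (m : nat) (f : V -> W) (a : V) : m.-tuple V -> W :=
  fun v => iter_derive v f a.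

(* An m-linear map on R^n is represented as a function on m-tuples. *)
Definition mlin_norm (m : nat) (psi : m.-tuple V -> W) : \bar R :=
  ereal_sup [set `|psi v|%:E | v in [set v | forall j, enorm (tnth v j) <= 1]].

Definition nu (K : set V) (i : nat) (f : V -> W) : \bar R :=
  ereal_sup [set mlin_norm (@Dn xm.2 f xm.1) |
             xm in [set xm : V * nat | K xm.1 /\ (xm.2 <= i)%N]].

Definition spt (f : V -> W) : set V := closure [set x | f x != 0].

Lemma iter_derive_cat vs ws f :
  iter_derive (vs ++ ws) f = iter_derive vs (iter_derive ws f).
Proof. by elim: vs => //= v vs ->. Qed.

Lemma iter_deriveZD c f g vs : smooth f -> smooth g ->
  iter_derive vs (c *: f + g) = c *: iter_derive vs f + iter_derive vs g.
Proof.
move=> sf sg; elim: vs => //= v vs ->; apply/funext => x.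
have df : derivable (iter_derive vs f) x v by exact/diff_derivable/sf.
have dg : derivable (iter_derive vs g) x v by exact/diff_derivable/sg.
by rewrite deriveD ?deriveZ//; exact: derivableZ.
Qed.

Lemma smooth0 : smooth (0 : V -> W).
Proof.
have d0 vs : iter_derive vs (0 : V -> W) = 0.
  by elim: vs => //= v vs ->; apply/funext => x; rewrite derive_cst.
by move=> vs x; rewrite d0; exact: differentiable_cst.
Qed.

Lemma smoothZD c f g : smooth f -> smooth g -> smooth (c *: f + g).
Proof.
move=> sf sg vs x; rewrite iter_deriveZD//.
by apply: differentiableD; [apply: differentiableZ; exact: sf|exact: sg].
Qed.

Lemma smooth_iter_derive vs f : smooth f -> smooth (iter_derive vs f).
Proof. by move=> sf ws x; rewrite -iter_derive_cat; exact: sf. Qed.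

Lemma spt_iter_derive vs f : spt (iter_derive vs f) `<=` spt f.
Proof.
elim: vs => // v vs; apply: subset_trans.
have closed_spt : closed (spt (iter_derive vs f)) by exact: closed_closure.
rewrite [X in _ `<=` X](closure_id _).1//.
apply: closureS => x /=; apply: contraNP => nx; apply/eqP.
have : \forall y \near x, iter_derive vs f y = 0.
  have : open (~` spt (iter_derive vs f)) by exact: closed_openC.
  rewrite openE => /(_ x nx); apply: filterS => y ny.
  by apply/eqP/negPn/negP => fy; apply: ny; exact: subset_closure.
move=> h; rewrite -(derive_cst (0 : W) x v).
by apply: near_eq_derive.
Qed.
End Derivatives.
Arguments Dn {R n W} m f a v : rename.

Section TestFunctions.
Context {R : realType} (n : nat) (Y : normedModType R).
Local Notation V := 'rV[R]_n.

Definition testfun_pred : {pred (V -> Y)} :=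
  fun f => `[< smooth f /\ compact (spt f) >].

Lemma testfun_submod_closed : submod_closed testfun_pred.
Proof.
split.
  apply/asboolP; split; first exact: smooth0.
  rewrite /spt (_ : [set x | _] = set0).
    by rewrite closure0; exact: compact0.
  by apply/seteqP; split => x //=; rewrite eqxx.
move=> c f g /asboolP[sf cf] /asboolP[sg cg]; apply/asboolP; split.
  exact: smoothZD.
apply: (@subclosed_compact _ _ (spt f `|` spt g)).
- exact: closed_closure.
- exact: compactU.
rewrite /spt -closureU; apply: closureS => x /= fg.
have [f0|f0] := eqVneq (f x) 0; last by left.
right; apply: contraNneq fg => g0.
by rewrite /GRing.add/= /GRing.scale/= f0 g0 scaler0 addr0.
Qed.

HB.instance Definition _ := GRing.isSubmodClosed.Build R (V -> Y) testfun_pred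
  testfun_submod_closed.

Record testfun := TestFun {
  testfun_val :> V -> Y; _ : testfun_pred testfun_val }.
HB.instance Definition _ := [isSub for testfun_val].
HB.instance Definition _ := [Choice of testfun by <:].
HB.instance Definition _ := [SubChoice_isSubLmodule of testfun by <:].

Definition testfun_in (K : set V) : set testfun :=
  [set phi : testfun | spt phi `<=` K].

(* The usual (inductive limit) topology on D(R^n, Y) is the finest locally
   convex one making all the inclusions D_K(R^n, Y) -> D(R^n, Y) continuous,
   where D_K carries the topology of the seminorms nu K i.  Since nu K i
   increases with i, its neighborhoods of 0 are the convex sets below (and the
   sets containing one of them). *)
Definition lf_nbhs0 (U : set testfun) :=
  convex_set U /\
  forall K : set V, compact K -> exists i (e : R),
    0 < e /\ forall phi, testfun_in K phi -> (nu K i phi < e%:E)%E -> U phi.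

Definition lf_open (W : set testfun) :=
  forall phi, W phi ->
    exists2 U, lf_nbhs0 U & forall psi, U psi -> W (phi + psi).

Lemma nuS K i j (f : V -> Y) : (i <= j)%N -> (nu K i f <= nu K j f)%E.
Proof.
move=> ij; apply: le_ereal_sup => _ [xm [Kx mi] <-]; exists xm => //=.
by split => //; exact: leq_trans ij.
Qed.

Let lf_openT : lf_open setT.
Proof.
move=> phi _; exists setT => //; split; first by move=> x y l _ _; rewrite inE.
by move=> K cK; exists 0%N, 1; split.
Qed.

Let lf_openI : setI_closed lf_open.
Proof.
move=> A B oA oB phi [/oA[U [cU hU] UA] /oB[U' [cU' hU'] UB]].
exists (U `&` U'); last by move=> psi [? ?]; split; [exact: UA|exact: UB].
split.
  move=> x y l; rewrite !inE => -[Ux U'x] [Uy U'y]; split; apply/set_mem.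
    by apply: cU; rewrite inE.
  by apply: cU'; rewrite inE.
move=> K cK; have [i [e [e0 hi]]] := hU K cK; have [j [d [d0 hj]]] := hU' K cK.
exists (maxn i j), (Num.min e d); split; first by rewrite lt_min e0.
move=> psi Kpsi h; split; [apply: hi => //|apply: hj => //].
  rewrite (le_lt_trans (nuS _ _ (leq_maxl i j)))// (lt_le_trans h)//.
  by rewrite lee_fin ge_min lexx.
rewrite (le_lt_trans (nuS _ _ (leq_maxr i j)))// (lt_le_trans h)//.
by rewrite lee_fin ge_min lexx orbT.
Qed.

Let lf_open_bigU (I : Type) (F : I -> set testfun) :
  (forall i, lf_open (F i)) -> lf_open (\bigcup_i F i).
Proof.
move=> oF phi [k _ /(oF k)[U nU UF]]; exists U => // psi Upsi.
by exists k => //; exact: UF.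
Qed.

HB.instance Definition _ :=
  isOpenTopological.Build testfun lf_openT lf_openI lf_open_bigU.

End TestFunctions.
Arguments testfun_in {R n Y} K.

Record sdistribution (R : realType) (n : nat) (Y : normedModType R) :=
  SDistribution {
    sdistribution_val :> {linear testfun n Y -> R^o};
    sdistribution_continuous : continuous sdistribution_val }.

Section MultiIndices.
Variable n : nat.
Definition multiindex := {ffun 'I_n -> nat}.
Implicit Types xi o : multiindex.
Definition mdeg xi : nat := (\sum_j xi j)%N.
Definition Xi (m : nat) : set multiindex := [set xi | mdeg xi = m].
Definition mle xi o := forall j, (xi j <= o j)%N.
Definition msub o xi : multiindex := [ffun j => (o j - xi j)%N].
End MultiIndices.
Arguments Xi : clear implicits.

Section DistributionDerivative.
Context {R : realType} {n : nat}.
Local Notation V := 'rV[R]_n.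

(* The list e_1, ..., e_1, ..., e_n, ..., e_n with each e_j repeated xi_j
   times. *)
Definition basis_dirs (xi : multiindex n) : seq V :=
  flatten [seq nseq (xi j) (delta_mx ord0 j : V) | j <- enum 'I_n].

Definition partial {W : normedModType R} (xi : multiindex n) (f : V -> W) :
  V -> W := iter_derive (basis_dirs xi) f.

Lemma size_basis_dirs xi : size (basis_dirs xi) = mdeg xi.
Proof.
rewrite size_flatten /shape -map_comp sumnE big_map /mdeg.
by rewrite big_enum; apply: eq_bigr => j _ /=; rewrite size_nseq.
Qed.

Lemma enorm_basis_dirs xi v : v \in basis_dirs xi -> enorm v = 1.
Proof.
case/flattenP => s /mapP[j _ ->] /nseqP[-> _].
rewrite /enorm (bigD1 j)//= mxE !eqxx expr1n big1 ?addr0 ?sqrtr1// => k kj.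
by rewrite mxE (negbTE kj) andbF expr0n.
Qed.

Context {Y : normedModType R}.

Lemma testfunP (phi : testfun n Y) : smooth phi /\ compact (spt phi).
Proof. by case: phi => f /= /asboolP. Qed.

Lemma partial_testfun_subproof xi (phi : testfun n Y) :
  testfun_pred (partial xi phi).
Proof.
have [sphi cphi] := testfunP phi; apply/asboolP; split.
  exact: smooth_iter_derive.
apply: subclosed_compact cphi _; first exact: closed_closure.
exact: spt_iter_derive.
Qed.

Definition partial_testfun xi (phi : testfun n Y) : testfun n Y :=
  TestFun (partial_testfun_subproof xi phi).

Lemma partial_testfun_linear xi : linear (partial_testfun xi).
Proof.
move=> c f g; apply/val_inj => /=.
by rewrite -iter_deriveZD//; [have [] := testfunP f|have [] := testfunP g].
Qed.

HB.instance Definition _ xi := GRing.isLinear.Build R (testfun n Y)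
  (testfun n Y) _ (partial_testfun xi) (partial_testfun_linear xi).

Lemma nu_partial K i xi (f : V -> Y) :
  (nu K i (partial xi f) <= nu K (i + mdeg xi) f)%E.
Proof.
apply: ge_ereal_sup => _ [[x m] /= [Kx mi] <-].
apply: ge_ereal_sup => _ [v /= v1 <-].
have sz : size (v ++ basis_dirs xi) == (m + mdeg xi)%N.
  by rewrite size_cat size_tuple size_basis_dirs.
apply: le_trans (ereal_sup_ubound _) => /=; last first.
  by exists (x, (m + mdeg xi)%N) => //=; split => //; rewrite leq_add2r.
apply: ereal_sup_ubound => /=; exists (Tuple sz).
  move=> j; rewrite (tnth_nth 0)/=.
  have := mem_nth 0 (_ : (j < size (v ++ basis_dirs xi))%N).
  rewrite (eqP sz) => /(_ (ltn_ord j)); rewrite mem_cat => /orP[|].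
    by case/tnthP => k ->; exact: v1.
  by move=> /enorm_basis_dirs ->.
by rewrite /Dn /= iter_derive_cat.
Qed.

Lemma partial_testfun_continuous xi : continuous (partial_testfun xi).
Proof.
move=> phi A [B [oB Bphi BA]].
exists (partial_testfun xi @^-1` B); split => //; last first.
  by move=> psi /= /BA.
move=> psi /= /oB[U [cU hU] UB].
exists (partial_testfun xi @^-1` U); last first.
  by move=> rho /= /UB; rewrite linearD.
split.
  move=> x y l; rewrite !inE /= => Ux Uy; apply/set_mem.
  have := cU (partial_testfun xi x) (partial_testfun xi y) l.
  rewrite !inE => /(_ Ux Uy).
  suff -> : partial_testfun xi (conv l x y) =
    conv l (partial_testfun xi x : convex_lmodType (testfun n Y))
           (partial_testfun xi y : convex_lmodType (testfun n Y)) by [].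
  by rewrite [LHS](@linearD _ _ _ _ (partial_testfun xi)) !linearZ.
move=> K cK; have [i [e [e0 hi]]] := hU K cK.
exists (i + mdeg xi)%N, e; split => // rho Krho h; apply: hi.
  by apply: subset_trans Krho; exact: spt_iter_derive.
by apply: le_lt_trans h; exact: nu_partial.
Qed.

Definition dist_derive_fun xi (T : sdistribution n Y) (phi : testfun n Y) :
    R^o :=
  (- 1) ^+ mdeg xi *: T (partial_testfun xi phi).

Lemma dist_derive_linear xi T : linear (dist_derive_fun xi T).
Proof.
move=> c f g; rewrite /dist_derive_fun (linearP (partial_testfun xi)).
rewrite (linearP T) scalerDr !scalerA.
by rewrite [c * _]mulrC.
Qed.

HB.instance Definition _ xi T := GRing.isLinear.Build R (testfun n Y) R^o _
  (dist_derive_fun xi T) (dist_derive_linear xi T).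

Lemma dist_derive_continuous xi T : continuous (dist_derive_fun xi T).
Proof.
move=> phi.
have cT : continuous_at phi (T \o partial_testfun xi).
  apply: (@continuous_comp _ _ _ (partial_testfun xi) T phi).
    exact: partial_testfun_continuous.
  exact: sdistribution_continuous.
exact: (@cvgZl_tmp R R^o _ (nbhs phi) (nbhs_filter phi) _ _ _ cT).
Qed.

Definition dist_derive xi (T : sdistribution n Y) : sdistribution n Y :=
  @SDistribution R n Y (dist_derive_fun xi T) (@dist_derive_continuous xi T).

End DistributionDerivative.

Section Rescale.
Context {R : realType} {n : nat} {Y : normedModType R}.
Local Notation V := 'rV[R]_n.

(* x |-> phi (r^-1 (x - a)); by rescaleE below the default value 0 of insubd
   is only used for r = 0, which plays no role in limits as r -> 0+. *)
Definition rescale (a : V) (r : R) (phi : testfun n Y) : testfun n Y :=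
  insubd (0 : testfun n Y) (fun x => phi (r^-1 *: (x - a))).

Lemma iter_derive_rescale (a : V) (r : R) (f : V -> Y) vs :
  iter_derive vs (fun x => f (r^-1 *: (x - a))) =
  (fun x => iter_derive [seq r^-1 *: v | v <- vs] f (r^-1 *: (x - a))).
Proof.
elim: vs => //= v vs ->; apply/funext => x; rewrite /derive /=.
set F := (X in lim (X @ _) = _); set G := (X in _ = lim (X @ _)).
suff -> : F = G by [].
apply/funext => h; rewrite /F /G /=.
congr (_ *: (iter_derive _ _ _ - _)).
by rewrite -addrA scalerDr (scalerA r^-1) (mulrC r^-1) -scalerA.
Qed.

Lemma rescaleE (a : V) (r : R) (phi : testfun n Y) : r != 0 ->
  rescale a r phi = (fun x => phi (r^-1 *: (x - a))) :> (V -> Y).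
Proof.
move=> r0; rewrite [LHS](@insubdK _ _ _ (0 : testfun n Y))//.
have [sphi cphi] := testfunP phi; apply/asboolP; split.
  move=> vs x; rewrite iter_derive_rescale.
  apply: (@differentiable_comp _ _ _ _ (fun x => r^-1 *: (x - a))).
    by apply: differentiableZ; exact: differentiableB.
  exact: sphi.
pose B (y : V) : V := r *: y + a.
have cB : compact (B @` spt phi).
  apply: continuous_compact cphi; apply: continuous_subspaceT => y.
  apply: (@cvgD _ _ _ (nbhs y) _ (fun z : V => r *: z) (fun=> a));
    last exact: cvg_cst.
  exact: (@cvgZl_tmp R V _ (nbhs y) _ r id y).
have clB : closed (B @` spt phi).
  by apply: compact_closed cB; exact: norm_hausdorff.
apply: subclosed_compact cB _; first exact: closed_closure.
rewrite [X in _ `<=` X](closure_id _).1//.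
apply: closureS => x /= fx; exists (r^-1 *: (x - a)).
  exact: subset_closure.
by rewrite /B scalerA divff// scale1r subrK.
Qed.
End Rescale.

Section PointwiseDifferentiability.
Context {R : realType} {n : nat} {Y : normedModType R}.
Local Notation V := 'rV[R]_n.
Implicit Types (T : sdistribution n Y) (P : V -> dual Y) (a : V).

(* Polynomial functions R^n -> Y^* of degree at most q; only 0 if q < 0. *)
Definition polynomial_le (q : int) P : Prop :=
  if q is Posz d then
    exists c : {ffun 'I_n -> 'I_d.+1} -> dual Y, forall x : V,
      P x = \sum_(e : {ffun 'I_n -> 'I_d.+1} | (\sum_j e j <= d)%N)
              (\prod_j x ord0 j ^+ e j) *: c e
  else forall x : V, P x = 0.

(* The integral over R^n of <phi, P>; the points of R^n are n-tuples on the
   measure-theoretic side and row vectors on the differential side. *)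
Definition poly_dist P (phi : testfun n Y) : R :=
  \int[lebesgue_tuple R n]_t
    pairing (phi (\row_j tnth t j)) (P (\row_j tnth t j)).

(* r^(-s-n) (T - S)_x (phi (r^-1 (x - a))), where S is given by P. *)
Definition scaled_defect (s : R) T P a (phi : testfun n Y) (r : R) : R :=
  r `^ (- s - n%:R) * (T (rescale a r phi) - poly_dist P (rescale a r phi)).

Definition nu_unit_ball (i : nat) : set (testfun n Y) :=
  [set phi | testfun_in (eball 0 1) phi /\ (nu (eball 0 1) i phi <= 1)%E].

Definition sup_defect (i : nat) (s : R) T P a (r : R) : \bar R :=
  ereal_sup [set (scaled_defect s T P a phi r)%:E | phi in nu_unit_ball i].

Definition pt_poly (q : int) T a P : Prop :=
  polynomial_le q P /\
  forall phi, scaled_defect q%:~R T P a phi r @[r --> 0^'+] --> 0.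

Definition pt_diff (q : int) T a : Prop := exists P, pt_poly q T a P.

Definition nu_pt_diff (i : nat) (q : int) T a : Prop :=
  exists2 P, polynomial_le q P &
    sup_defect i q%:~R T P a r @[r --> 0^'+] --> 0%E.

Definition pt_diff_holder (q : int) (alpha : R) T a : Prop :=
  exists2 P, polynomial_le q P &
    forall phi,
      (limf_esup (fun r => (scaled_defect (q%:~R + alpha) T P a phi r)%:E)
                 (0 : R)^'+ < +oo)%E.

Definition nu_pt_diff_holder (i : nat) (q : int) (alpha : R) T a : Prop :=
  exists2 P, polynomial_le q P &
    (limf_esup (sup_defect i (q%:~R + alpha) T P a) (0 : R)^'+ < +oo)%E.

(* The polynomial is unique when it exists; the default 0 is used only if T is
   not pointwise differentiable of order q at a. *)
Definition ptD (q : nat) T a : q.-tuple V -> dual Y :=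
  Dn q (xget (0 : V -> dual Y) [set P | pt_poly q T a P]) a.

End PointwiseDifferentiability.
Arguments ptD {R n Y} q T a _ : rename.

(* For xi of degree p the list v ++ basis_dirs xi has exactly p + mu entries, so
   the default value of nth is not used. *)
Definition contract_basis {R : realType} {n : nat} {W : Type} (p mu : nat)
    (xi : multiindex n) (psi : (p + mu).-tuple 'rV[R]_n -> W) :
    mu.-tuple 'rV[R]_n -> W :=
  fun v => psi [tuple nth 0 (v ++ basis_dirs xi) j | j < p + mu].

(* Main.v *)
(* By induction on k it is enough to pass from the first partial derivatives
   of T, known up to order l at a, to T itself, up to order l + 1.  The
   polynomials P_j approximating the derivatives D_j T are unique, so that
   D_i P_j = D_j P_i because D_i D_j T = D_j D_i T; hence they are the
   gradient of a polynomial P, and U = T - P is a distribution all of whose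
   derivatives are small at a.

   It remains to find the constant term of U.  A test function phi supported
   in the unit cube is a divergence plus a bump of fixed shape times the
   integral of phi, with C^i bounds of the potentials by those of phi:
   integrate in one coordinate direction after the other.  On a rescaled
   divergence U is small of the required order, so only the values of U on
   rescaled bumps matter.  A bump dilated by 2 differs from a multiple of the
   bump by a divergence; these values, divided by r^n, thus form a geometric
   sequence along r 2^-k, whose limit is the constant term.

   The formula for the derivatives of the polynomials follows from their
   uniqueness, because integration by parts turns a polynomial approximating
   T into one approximating D_j T. *)
Require Import Defs.
From HB Require Import structures.
From mathcomp Require Import all_boot all_order all_algebra.
From mathcomp Require Import all_classical all_reals all_analysis.
From mathcomp Require Import ring lra.

Set Implicit Arguments.
Unset Strict Implicit.
Unset Printing Implicit Defensive.

Import Order.TTheory GRing.Theory Num.Theory.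
Import numFieldNormedType.Exports.

Local Open Scope classical_set_scope.
Local Open Scope ring_scope.

(** * Differential calculus of smooth maps *)

(** The order [s] of the remainder is kept apart from the degree bound: s = l for little-o and s = l
    + alpha for big-O estimates, so that one induction step serves all four notions. It raises s >=
    0 to s + 1 >= 1, and exponent at least 1 makes the increments of the normalised bump values
    along r 2^-k decay at least like 2^-k. If l = -1, the polynomials of the derivatives vanish and
    a constant term is all that is gained.

    Supports are measured in the sup norm because integration in a coordinate direction preserves
    cubes; Euclidean balls return only when estimates over bounded families are compared with the
    seminorms of the statement. The potentials have values in Y and are built from limits of Riemann
    sums in Y, which is where completeness enters. The bump is a product of derivatives of smooth
    steps: its iterated integrals, also after a dilation, are differences of values of the step and
    hence explicit, while the nonvanishing of its mass is drawn from the decomposition itself. *)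

(** A mixed second difference is symmetric in its two middle terms, so two vectors that both
    approximate it are close to each other. *)
Lemma normr_sub_exchange (R : realType) (W : normedModType R)
    (a b c d u v : W) (e : R) :
  `|a - b - (c - d) - u| + `|a - c - (b - d) - v| <= e -> `|u - v| <= e.
Proof.
apply: le_trans; rewrite -[leLHS]normrN.
have -> : - (u - v) = (a - b - (c - d) - u) - (a - c - (b - d) - v).
  rewrite !opprD !opprK.
  rewrite [RHS](AC (2*2*1*(2*2*1))%AC (5*10*(1*6)*(2*8)*(3*7)*(4*9))%AC)/=.
  by rewrite !addNr !subrr !addr0.
exact: ler_normB.
Qed.

Section Differentials.
Context {R : realType} {V W : normedModType R}.
Implicit Types (f : V -> W) (x v : V).

(** The way in which differentials are produced by hand below: the linear bound makes the candidate
    continuous, and uniqueness of the differential then identifies all directional derivatives at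
    once. *)
Lemma differentiable_intro f x (df : V -> W) : linear df ->
  (exists k, forall h, `|df h| <= k * `|h|) ->
  (forall e : R, 0 < e -> exists2 d : R, 0 < d & forall h, `|h| < d ->
     `|f (x + h) - f x - df h| <= e * `|h|) ->
  differentiable f x /\ forall v, 'D_v f x = df v.
Proof.
move=> ldf [k hk] hf.
pose dfM := GRing.isLinear.Build _ _ _ _ _ ldf.
pose dfL : {linear _ -> _} := HB.pack df dfM.
have cdf : continuous dfL.
  apply: bounded_linear_continuous.
  apply/linear_boundedP; exists k; split; first exact: num_real.
  by move=> l kl h; rewrite (le_trans (hk h))// ler_wpM2r// ltW.
have E : f \o shift x = cst (f x) + dfL +o_ 0 id.
  apply/eqaddoP => e e0; have [d d0 hd] := hf e e0.
  apply/nbhs_norm0P; exists d => //= h hd'.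
  have := hd h hd'; rewrite [x + h]addrC !fctE /=.
  by rewrite opprD addrA.
have dE := diff_unique cdf E.
have df' : differentiable f x.
  by apply/diff_locallyP; rewrite dE.
by split=> // v; rewrite deriveE// dE.
Qed.

Lemma differentiable_elim f x : differentiable f x ->
  forall e : R, 0 < e -> exists2 d : R, 0 < d & forall h, `|h| < d ->
     `|f (x + h) - f x - 'D_h f x| <= e * `|h|.
Proof.
move=> df e e0; have /diff_locally/eqaddoP/(_ e e0) := df.
move=> /nbhs_norm0P[d /= d0 hd]; exists d => // h hd'.
have := hd h hd'; rewrite !fctE /= deriveE// [h + x]addrC.
by rewrite opprD addrA.
Qed.

Lemma derive_linear f x : differentiable f x -> linear (fun v => 'D_v f x).
Proof. by move=> df a u v; rewrite !deriveE// linearP. Qed.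

Lemma derive_sumv f x (I : Type) (s : seq I) (F : I -> V) :
  differentiable f x -> 'D_(\sum_(i <- s) F i) f x = \sum_(i <- s) 'D_(F i) f x.
Proof.
by move=> df; rewrite deriveE// linear_sum; apply: eq_bigr => i _; rewrite deriveE.
Qed.

Lemma deriveZv f x c v : differentiable f x -> 'D_(c *: v) f x = c *: 'D_v f x.
Proof. by move=> df; rewrite !deriveE// linearZ. Qed.

Lemma derive_bounded f x :
  differentiable f x -> exists2 k : R, 0 < k & forall h, `|'D_h f x| <= k * `|h|.
Proof.
move=> df; have [k k0 hk] := linear_lipschitz (diff_continuous df).
by exists k => // h; rewrite deriveE.
Qed.

Lemma derive_scale (t : V -> R) f x v : differentiable t x -> differentiable f x ->
  differentiable (fun y => t y *: f y) x /\
  'D_v (fun y => t y *: f y) x = 'D_v t x *: f x + t x *: 'D_v f x.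
Proof.
move=> dt df.
have [k k0 hk] : exists2 k : R, 0 < k & forall h, `|'D_h t x| <= k * `|h|.
  have [k k0 hk] := linear_lipschitz (diff_continuous dt).
  by exists k => // h; rewrite deriveE.
have [l l0 hl] := derive_bounded df.
have [|||d E] := @differentiable_intro (fun y => t y *: f y) x
  (fun h => 'D_h t x *: f x + t x *: 'D_h f x); last by split.
- move=> c a b; rewrite !deriveE//.
  have -> : 'd t x (c *: a + b) = c * 'd t x a + 'd t x b by exact: linearP.
  rewrite linearP scalerDl !scalerDr -!scalerA addrACA.
  by congr (_ + _ + _); rewrite !scalerA mulrC.
- exists (k * `|f x| + `|t x| * l) => h.
  rewrite (le_trans (ler_normD _ _))// !normrZ mulrDl lerD//.
    by rewrite mulrAC ler_wpM2r.
  by rewrite -mulrA ler_wpM2l.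
move=> e e0.
(* One summand for each of the four terms into which the remainder of the product is split, each of
   them being a multiple of [e1] times the norm of [h]. *)
pose A := `|t x| + `|f x| + 1 + k.
have A0 : 0 < A by rewrite addr_gt0// ltr_wpDl// addr_ge0.
pose e1 := Num.min 1 (e / A).
have e10 : 0 < e1 by rewrite lt_min ltr01 divr_gt0.
have [d1 d10 h1] : exists2 d : R, 0 < d & forall h, `|h| < d ->
     `|t (x + h) - t x - 'D_h t x| <= e1 * `|h|.
  have /diff_locally/eqaddoP/(_ _ e10) := dt.
  move=> /nbhs_norm0P[d /= d0 hd]; exists d => // h hd'.
  have := hd h hd'; rewrite !fctE /= deriveE// [h + x]addrC.
  by rewrite opprD addrA.
have [d2 d20 h2] := differentiable_elim df e10.
(* Chosen so that the increment of [f] is at most [e1], which is at most 1. *)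
pose d3 := e1 / (l + 1).
have d30 : 0 < d3 by rewrite divr_gt0// addr_gt0.
exists (Num.min d1 (Num.min d2 d3)); first by rewrite !lt_min d10 d20.
move=> h; rewrite !lt_min => /and3P[/h1 H1 /h2 H2 H3].
have f1 : `|f (x + h) - f x| <= e1.
  rewrite -[f (x + h) - f x](subrK ('D_h f x)) (le_trans (ler_normD _ _))//.
  rewrite (le_trans (lerD H2 (hl h)))// -mulrDl.
  rewrite (@le_trans _ _ ((1 + l) * `|h|))//.
    by rewrite ler_wpM2r// lerD2r ge_min lexx.
  by move: H3; rewrite /d3 ltr_pdivlMr ?addr_gt0// => /ltW; rewrite mulrC addrC.
have -> : t (x + h) *: f (x + h) - t x *: f x -
    ('D_h t x *: f x + t x *: 'D_h f x) =
  t x *: (f (x + h) - f x - 'D_h f x) + (t (x + h) - t x - 'D_h t x) *: f x +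
  ((t (x + h) - t x - 'D_h t x) *: (f (x + h) - f x) + 'D_h t x *: (f (x + h) - f x)).
  rewrite -scalerDl subrK.
  rewrite -{1}(subrK (f x) (f (x + h))) -{1}(subrK (t x) (t (x + h))).
  set D := f (x + h) - _; set E := t (x + h) - _; clearbody D E.
  rewrite scalerDl !scalerDr !scalerN scalerBl opprD.
  rewrite [LHS](AC (2*2*1*2)%AC ((4*5)*(3*7)*(2*6)*1)%AC)/=.
  by rewrite subrr add0r.
rewrite (le_trans (ler_normD _ _))// (le_trans (lerD (ler_normD _ _) (ler_normD _ _)))//.
rewrite !normrZ (@le_trans _ _ (e1 * `|h| * A))//; last first.
  by rewrite mulrAC ler_wpM2r// -ler_pdivlMr// ge_min lexx orbT.
rewrite /A mulrDr mulrDr mulrDr mulr1 -!addrA lerD//.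
  by rewrite mulrC ler_wpM2r// addrA.
apply: lerD; first by rewrite addrA ler_wpM2r.
apply: lerD.
  rewrite addrA.
  rewrite -[leRHS]mulr1 ler_pM// (le_trans f1)// ge_min lexx//.
by rewrite mulrAC [e1 * k]mulrC -mulrAC ler_pM.
Qed.

End Differentials.

Lemma is_derive_line {R : realType} {V W : normedModType R} (f : V -> W) x v
    (t : R) : differentiable f (x + t *: v) ->
  is_derive t (1 : R) (fun s : R => f (x + s *: v)) ('D_v f (x + t *: v)).
Proof.
move=> df.
have [||e e0|d dE] := @differentiable_intro R R W (fun s : R => f (x + s *: v)) t
  (fun h => h *: 'D_v f (x + t *: v)).
- by move=> c a b; rewrite scalerDl scalerA.
- by exists `|'D_v f (x + t *: v)| => h; rewrite normrZ mulrC.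
- have v1 : 0 < `|v| + 1 by rewrite ltr_pwDr.
  have e1 : 0 < e / (`|v| + 1) by rewrite divr_gt0.
  have [d d0 hd] := differentiable_elim df e1.
  exists (d / (`|v| + 1)); first by rewrite divr_gt0.
  move=> h hh; have := hd (h *: v); rewrite deriveZv// scalerDl addrA => H.
  apply: (le_trans (H _)).
    rewrite normrZ; move: hh; rewrite ltr_pdivlMr//; apply: le_lt_trans.
    by rewrite ler_wpM2l// lerDl.
  rewrite normrZ mulrAC ler_pdivrMr// -!mulrA ler_pM2l// ler_wpM2l//.
  by rewrite lerDl.
by split; [exact: diff_derivable|rewrite dE scale1r].
Qed.

(** * Mean value inequalities for vector-valued maps *)

Section MeanValue.
Context {R : realType} {W : normedModType R}.

(** Continuous induction with the slope C + e: the supremum of the times up to which the bound holds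
    satisfies it too, and differentiability there carries the bound a little further unless the time
    is 1. *)
Lemma mean_value_path (g dg : R -> W) (C : R) :
  (forall t : R, 0 <= t <= 1 -> is_derive t (1 : R) g (dg t)) ->
  (forall t : R, 0 <= t <= 1 -> `|dg t| <= C) -> `|g 1 - g 0| <= C.
Proof.
move=> Hg HC.
apply/ler_addgt0Pr => e e0.
have C0 : 0 <= C by apply: le_trans (HC 0 _); rewrite // lexx ler01.
pose ok (s : R) := `|g s - g 0| <= (C + e) * s.
have Hd (s : R) : 0 <= s <= 1 -> exists2 d : R, 0 < d & forall h, `|h| < d ->
    `|g (s + h) - g s| <= (C + e) * `|h|.
  move=> s01; have dg' := Hg s s01.
  have dfs : differentiable g s by apply/derivable1_diffP.
  have [d d0 hd] := differentiable_elim dfs e0.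
  exists d => // h hh; have := hd h hh.
  have -> : 'D_h g s = h *: dg s.
    rewrite -[X in 'D_X _ _](mulr1 h) -[h * 1]/(h *: (1 : R^o)).
    by rewrite deriveZv// (@derive_val _ _ _ _ _ _ _ dg').
  move=> Hh; rewrite -[g (s + h) - g s](subrK (h *: dg s)).
  rewrite (le_trans (ler_normD _ _))// mulrDl addrC lerD// normrZ mulrC.
  by rewrite ler_wpM2r// HC.
pose A : set R := [set t | 0 <= t <= 1 /\ forall s, 0 <= s <= t -> ok s].
have A0 : A 0.
  split; first by rewrite lexx ler01.
  by move=> s; rewrite -eq_le => /eqP <-; rewrite /ok subrr normr0 mulr0.
have hA : has_sup A by split; [exists 0|exists 1 => t [/andP[]]].
pose s0 := sup A.
have ubA t : A t -> t <= s0 by move=> At; apply: ub_le_sup => //; case: hA.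
have s00 : 0 <= s0 by exact: ubA.
have s01 : s0 <= 1 by apply: ge_sup; [exists 0|move=> t [/andP[]]].
have s0in : 0 <= s0 <= 1 by rewrite s00.
have [d d0 hd] := Hd s0 s0in.
have ltok s : 0 <= s -> s < s0 -> ok s.
  move=> s0' ss; have [|t [_ At] st] := @sup_adherent R A (s0 - s) _ hA.
    by rewrite subr_gt0.
  by apply: At; rewrite s0' ltW//; move: st; rewrite /s0 subKr.
have oks0 : ok s0.
  have [|t At st] := @sup_adherent R A d _ hA; first by [].
  have ts := ubA _ At; case: At => /andP[t0 _] At.
  have okt : ok t by apply: At; rewrite t0 lexx.
  have := hd (t - s0); rewrite [s0 + _]addrC subrK [X in X < d]distrC ger0_norm ?subr_ge0//.
  rewrite [`|t - _|]distrC ger0_norm ?subr_ge0// ltrBlDr -ltrBlDl => /(_ st) H.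
  rewrite /ok -(subrK (g t) (g s0)) -addrA (le_trans (ler_normD _ _))//.
  by rewrite -{2}(subrK t s0) mulrDr lerD// distrC.
have [s0E|s0N] := eqVneq s0 1; first by move: oks0; rewrite /ok s0E mulr1.
have s0lt : s0 < 1 by rewrite lt_neqAle s0N.
pose h := Num.min (d / 2) (1 - s0).
have h0 : 0 < h by rewrite lt_min divr_gt0//= subr_gt0.
have : A (s0 + h).
  split.
    by rewrite (addr_ge0 s00 (ltW h0))/= -lerBrDl ge_min lexx orbT.
  move=> s /andP[sge sle]; have [/ltok|ss0] := ltP s s0; first exact.
  have := hd (s - s0); rewrite [s0 + _]addrC subrK ger0_norm ?subr_ge0// => H.
  rewrite /ok -(subrK (g s0) (g s)) -addrA (le_trans (ler_normD _ _))//.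
  rewrite -{2}(subrK s0 s) mulrDr lerD// H//.
  rewrite (@le_lt_trans _ _ h)//; first by rewrite lerBlDl.
  by rewrite gt_min gtr_pMr// invf_lt1 ?ltr1n.
by move=> /ubA; rewrite gerDl leNgt h0.
Qed.

(** Applied to the path t -> f(x + t h) - t w. The free vector [w] makes it usable for first-order
    remainders as well as for plain increments. *)
Lemma mean_value_ineq {V : normedModType R} (f : V -> W) (x h : V) w (C : R) :
  (forall t : R, 0 <= t <= 1 -> differentiable f (x + t *: h)) ->
  (forall t : R, 0 <= t <= 1 -> `|'D_h f (x + t *: h) - w| <= C) ->
  `|f (x + h) - f x - w| <= C.
Proof.
move=> df HC.
pose g (t : R) := f (x + t *: h) - t *: w.
have := @mean_value_path g (fun t => 'D_h f (x + t *: h) - w) C.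
rewrite /g !scale1r !scale0r addr0 subr0 [_ - w - _]addrAC; apply => // t t01.
have dh := is_derive_line (df t t01).
have dw : is_derive t (1 : R) (fun s : R => s *: w) w.
  have lw : linear (fun s : R => s *: w) by move=> a b c; rewrite scalerDl scalerA.
  have [|e e0|ds Es] := @differentiable_intro R R W (fun s : R => s *: w) t _ lw.
  - by exists `|w| => s; rewrite normrZ mulrC.
  - exists 1 => // s _; rewrite scalerDl [X in X - t *: w]addrC addrK subrr normr0.
    by rewrite mulr_ge0// ltW.
  by split; [exact: diff_derivable|rewrite Es scale1r].
exact: is_deriveB.
Qed.

End MeanValue.

(** * Closure properties of smooth maps *)

Section IteratedDerivatives.
Context {R : realType} {n : nat}.
Local Notation V := 'rV[R]_n.
Context {W : normedModType R}.
Implicit Types (f g : V -> W) (v x : V).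

Lemma iter_derive_rcons vs v f :
  iter_derive (rcons vs v) f = iter_derive vs ('D_v f).
Proof. by rewrite -cats1 iter_derive_cat. Qed.

Lemma smooth_differentiable f x : smooth f -> differentiable f x.
Proof. by move=> /(_ [::] x). Qed.

Lemma smooth_derive f v : smooth f -> smooth ('D_v f).
Proof. exact: (@smooth_iter_derive _ _ _ [:: v]). Qed.

Lemma smooth_continuous f : smooth f -> continuous f.
Proof.
by move=> sf x; exact/differentiable_continuous/smooth_differentiable.
Qed.

(** Smoothness is stated with lists of directions, which do not pass through the product rule.
    Stripping off the innermost derivative instead gives an induction on the order, suited to sums,
    products and inverses. *)
Fixpoint Ck (m : nat) f : Prop :=
  (forall x, differentiable f x) /\
  if m is m'.+1 then forall v, Ck m' ('D_v f) else True.

Lemma smoothP f : smooth f <-> forall m, Ck m f.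
Proof.
split.
  move=> sf m; elim: m f sf => [|m IH] f sf /=; split=> //.
  - by move=> x; exact: smooth_differentiable.
  - by move=> x; exact: smooth_differentiable.
  - by move=> v; apply: IH; exact: smooth_derive.
move=> h vs; elim/last_ind: vs f h => [|vs v IH] f h x.
  by have [] := h 0%N.
rewrite iter_derive_rcons; apply: IH => m.
by have [_ /(_ v)] := h m.+1.
Qed.

Lemma CkS m f : Ck m.+1 f -> Ck m f.
Proof.
elim: m f => [|m IH] f [df h]; split => // v; exact: IH.
Qed.

Lemma CkD m f g : Ck m f -> Ck m g -> Ck m (fun x => f x + g x).
Proof.
elim: m f g => [|m IH] f g [df hf] [dg hg]; split => //;
  try by move=> x; apply: differentiableD.
move=> v; rewrite (_ : 'D_v _ = fun x => 'D_v f x + 'D_v g x).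
  exact: IH (hf v) (hg v).
by apply/funext => x; apply: deriveD; exact: diff_derivable.
Qed.

Lemma smoothD f g : smooth f -> smooth g -> smooth (fun x => f x + g x).
Proof. by move=> sf sg; rewrite -[f]scale1r; exact: smoothZD. Qed.

Lemma smoothZ (c : R) f : smooth f -> smooth (fun x => c *: f x).
Proof.
by move=> sf; have := smoothZD c sf smooth0; rewrite addr0.
Qed.

Lemma smooth_cst (w : W) : smooth (fun _ : V => w).
Proof.
apply/smoothP => m; have d x : differentiable (fun _ : V => w) x.
  exact: differentiable_cst.
case: m => [|m]; split=> // v.
rewrite (_ : 'D_v _ = 0); last by apply/funext => x; rewrite derive_cst.
by have /smoothP := @smooth0 R n W.
Qed.

Lemma smooth_sum (I : Type) (s : seq I) (F : I -> V -> W) :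
  (forall i, smooth (F i)) -> smooth (fun x => \sum_(i <- s) F i x).
Proof.
move=> sF; elim: s => [|i s IH].
  by under eq_fun do rewrite big_nil; exact: smooth_cst.
by under eq_fun do rewrite big_cons; exact: smoothD.
Qed.

Lemma iter_derive_sum (I : Type) (s : seq I) (F : I -> V -> W) vs :
  (forall i, smooth (F i)) ->
  iter_derive vs (fun x => \sum_(i <- s) F i x) =
  (fun x => \sum_(i <- s) iter_derive vs (F i) x).
Proof.
move=> sF; elim: s => [|i s IH].
  under eq_fun do rewrite big_nil; under [RHS]eq_fun do rewrite big_nil.
  by elim: vs => //= v vs ->; apply/funext => x; rewrite derive_cst.
under eq_fun do rewrite big_cons; under [RHS]eq_fun do rewrite big_cons.
have := iter_deriveZD 1 vs (sF i) (smooth_sum s sF).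
by rewrite !scale1r IH.
Qed.

Lemma derive_fsum (I : Type) (s : seq I) (F : I -> V -> W) v x :
  (forall i, differentiable (F i) x) ->
  'D_v (fun x => \sum_(i <- s) F i x) x = \sum_(i <- s) 'D_v (F i) x.
Proof.
move=> sF; suff [] : differentiable (fun x => \sum_(i <- s) F i x) x /\
  'D_v (fun x => \sum_(i <- s) F i x) x = \sum_(i <- s) 'D_v (F i) x by [].
elim: s => [|i s [IH1 IH2]].
  under eq_fun do rewrite big_nil; rewrite big_nil derive_cst.
  by split=> //; exact: differentiable_cst.
under eq_fun do rewrite big_cons; rewrite big_cons; split.
  exact: differentiableD.
by rewrite -IH2; apply: deriveD; exact: diff_derivable.
Qed.

End IteratedDerivatives.

Section SmoothAlgebra.
Context {R : realType} {n : nat}.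
Local Notation V := 'rV[R]_n.
Implicit Types (W : normedModType R) (v x : V).

Lemma CkM W (m : nat) (t : V -> R) (f : V -> W) :
  Ck m t -> Ck m f -> Ck m (fun x => t x *: f x).
Proof.
elim: m t f => [|m IH] t f Ht Hf; have [dt ht] := Ht; have [df hf] := Hf.
  by split=> // x; have [] := derive_scale x (dt x) (df x).
split; first by move=> x; have [] := derive_scale x (dt x) (df x).
move=> v; rewrite (_ : 'D_v _ = fun x => 'D_v t x *: f x + t x *: 'D_v f x).
  apply: CkD; first exact: IH (ht v) (CkS Hf).
  exact: IH (CkS Ht) (hf v).
by apply/funext => x; have [] := derive_scale v (dt x) (df x).
Qed.

Lemma smoothM W (t : V -> R) (f : V -> W) :
  smooth t -> smooth f -> smooth (fun x => t x *: f x).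
Proof.
by move=> /smoothP st /smoothP sf; apply/smoothP => m; exact: CkM.
Qed.

Lemma derive_inv (t : V -> R) x v : differentiable t x -> t x != 0 ->
  'D_v (fun y => (t y)^-1) x = (- ((t x)^-1 * (t x)^-1)) * 'D_v t x.
Proof.
move=> dt t0; rewrite deriveV//; last exact: diff_derivable.
by rewrite -exprVn expr2.
Qed.

Lemma CkV (m : nat) (t : V -> R) :
  (forall x, t x != 0) -> Ck m t -> Ck m (fun x => (t x)^-1).
Proof.
move=> t0; elim: m => [|m IH] Ht; have [dt ht] := Ht.
  by split=> // x; apply: differentiableV.
have di x : differentiable (fun y => (t y)^-1) x by apply: differentiableV.
split=> // v.
(* The derivative of 1/t is written as a nested product, so that the product lemma and the induction
   hypothesis apply to its factors. *)
rewrite (_ : 'D_v _ = fun x => (t x)^-1 *: ((t x)^-1 *: ((-1) *: 'D_v t x))).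
  have IHt := IH (CkS Ht).
  apply: (CkM IHt); apply: (CkM IHt); apply: CkM (ht v).
  by have /smoothP := @smooth_cst R n R (-1).
apply/funext => x; rewrite derive_inv// /GRing.scale/=.
by ring.
Qed.

Lemma smoothV (t : V -> R) : (forall x, t x != 0) -> smooth t ->
  smooth (fun x => (t x)^-1).
Proof. by move=> t0 /smoothP st; apply/smoothP => m; exact: CkV. Qed.

Lemma coord_delta v : v = \sum_j v ord0 j *: delta_mx ord0 j.
Proof. exact: row_sum_delta. Qed.

Lemma coord_le_norm v j : `|v ord0 j| <= `|v|.
Proof.
rewrite [leRHS]/Num.Def.normr /= mx_normrE.
exact: (le_bigmax _ (fun i : 'I_1 * 'I_n => `|v i.1 i.2|) (ord0, j)).
Qed.

Lemma derive_coordE j x v : 'D_v (fun x : V => x ord0 j : R) x = v ord0 j.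
Proof.
have [||e e0|_ ->//] := @differentiable_intro R V R (fun x : V => x ord0 j) x
  (fun h => h ord0 j).
- by move=> c a b; rewrite !mxE.
- by exists 1 => h; rewrite mul1r coord_le_norm.
exists 1 => // h _; rewrite mxE [_ + h _ _]addrC addrK subrr normr0.
by rewrite mulr_ge0// ltW.
Qed.

Lemma smooth_coord j : smooth (fun x : V => x ord0 j : R).
Proof.
move=> vs x; case/lastP: vs => [|vs v]; first exact: differentiable_coord.
rewrite iter_derive_rcons (_ : 'D_v _ = fun=> v ord0 j).
  have := @smooth_cst R n R (v ord0 j); exact.
by apply/funext => y; rewrite derive_coordE.
Qed.

Section Affine.
Context {W : normedModType R}.
Implicit Types f : V -> W.

Lemma iter_derive_affine (c : R) (b : V) f vs :
  iter_derive vs (fun x => f (c *: x + b)) =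
  (fun x => iter_derive [seq c *: v | v <- vs] f (c *: x + b)).
Proof.
elim: vs => //= v vs ->; apply/funext => x; rewrite /derive /=.
set F := (X in lim (X @ _) = _); set G := (X in _ = lim (X @ _)).
suff -> : F = G by [].
apply/funext => h; rewrite /F /G /=.
congr (_ *: (iter_derive _ _ _ - _)).
by rewrite scalerDr addrA !scalerA [c * h]mulrC.
Qed.

Lemma iter_derive_mapZ (c : R) f vs : smooth f ->
  iter_derive [seq c *: v | v <- vs] f = (fun x => c ^+ size vs *: iter_derive vs f x).
Proof.
move=> sf; elim: vs => /= [|v vs ->].
  by apply/funext => x; rewrite expr0 scale1r.
apply/funext => x; rewrite deriveZv; last first.
  by apply: differentiableZ; exact: (smooth_differentiable x (smooth_iter_derive vs sf)).
rewrite deriveZ ?scalerA -?exprS//; apply: diff_derivable.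
exact: (smooth_differentiable x (smooth_iter_derive vs sf)).
Qed.

Lemma smooth_affine (c : R) (b : V) f : smooth f -> smooth (fun x => f (c *: x + b)).
Proof.
move=> sf vs x; rewrite iter_derive_affine.
apply: (@differentiable_comp _ _ _ _ (fun x => c *: x + b)); last exact: sf.
by apply: differentiableD; first exact: differentiableZ.
Qed.

(** The increment of [f] in direction t v is a function with derivative t (G(y + t v) - G(y)) in
    direction [u], where G = D_u f. The mean value inequality along t u and differentiability of G
    at [x] alone then give the second difference up to o(t^2). *)
Lemma mixed_difference f (u v x : V) : smooth f -> forall e, 0 < e ->
  exists2 d : R, 0 < d & forall t, 0 < t < d ->
  `|f (x + t *: v + t *: u) - f (x + t *: u) - (f (x + t *: v) - f x)
     - (t * t) *: 'D_v ('D_u f) x| <= e * (t * t).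
Proof.
move=> sf e e0; pose G := 'D_u f.
have sG : smooth G by exact: smooth_derive.
pose k := `|u| + `|v| + 1.
have k0 : 0 < k by rewrite ltr_wpDl// addr_ge0.
(* Both displacements used below have norm at most t k, so the two remainders of G add up to at most
   e t. *)
have e10 : 0 < e / (2 * k) by rewrite divr_gt0// mulr_gt0.
have [d d0 hd] := differentiable_elim (smooth_differentiable x sG) e10.
exists (d / k); first by rewrite divr_gt0.
move=> t /andP[t0 td].
pose g y := f (y + t *: v) - f y.
have dft b y : differentiable (fun z : V => f (z + b)) y.
  apply: (@differentiable_comp _ _ _ _ (fun z => z + b)).
    exact: differentiableD.
  exact: smooth_differentiable.
have dg y : differentiable g y.
  by apply: differentiableB; [exact: dft|exact: smooth_differentiable].
have Dg y : 'D_(t *: u) g y = t *: (G (y + t *: v) - G y).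
  rewrite deriveZv// /g deriveB; last 2 first.
  - exact/diff_derivable/dft.
  - exact/diff_derivable/smooth_differentiable.
  congr (_ *: (_ - _)).
  have E : (fun z : V => f (1 *: z + t *: v)) = (fun z => f (z + t *: v)).
    by apply/funext => z; rewrite scale1r.
  have := congr1 (fun F => F y) (iter_derive_affine 1 (t *: v) f [:: u]).
  by rewrite E /= !scale1r.
have := @mean_value_ineq R W V g x (t *: u) ((t * t) *: 'D_v G x) (e * (t * t)).
rewrite /g ![_ + t *: u + _]addrAC => -> // s /andP[s0 s1].
rewrite Dg -scalerA -scalerBr normrZ gtr0_norm// mulrCA ler_wpM2l ?(ltW t0)//.
set k2 := s *: (t *: u).
have kk (z : R) : 0 <= z <= 1 -> `|k2 + (z * t) *: v| <= t * k.
  move=> /andP[z0 z1].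
  rewrite (le_trans (ler_normD _ _))// !normrZ.
  rewrite !ger0_norm ?mulr_ge0 ?(ltW t0)// mulrA.
  rewrite /k !mulrDr mulr1 -addrA lerD//.
    by rewrite ler_wpM2r// ler_piMl// ltW.
  by rewrite ler_wpDr ?(ltW t0)// ler_wpM2r// ler_piMl// ltW.
have kd (z : R) : 0 <= z <= 1 -> `|k2 + (z * t) *: v| < d.
  by move=> /kk/le_lt_trans; apply; rewrite -ltr_pdivlMr.
have h1 := hd _ (kd 1 _); have h0 := hd _ (kd 0 _).
have I0 (z : R) : z = 0 -> 0 <= z <= 1 by move=> ->; rewrite lexx ler01.
have {}I0 := I0 0 erefl.
have I1 (z : R) : z = 1 -> 0 <= z <= 1 by move=> ->; rewrite lexx ler01.
have {}I1 := I1 1 erefl.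
move: (h1 I1) (h0 I0); rewrite mul1r mul0r scale0r addr0 => {h1 h0}.
move=> /le_trans/(_ (ler_wpM2l (ltW e10) _)) H1.
move=> /le_trans/(_ (ler_wpM2l (ltW e10) _)) H0.
have := kk 1 I1; have := kk 0 I0.
rewrite mul1r mul0r scale0r addr0 => /H0 {}H0 /H1 {}H1.
have -> : G (x + k2 + t *: v) - G (x + k2) - t *: 'D_v G x =
  (G (x + (k2 + t *: v)) - G x - 'D_(k2 + t *: v) G x) -
  (G (x + k2) - G x - 'D_k2 G x).
  have dG := smooth_differentiable x sG.
  have -> : 'D_(k2 + t *: v) G x = 'D_k2 G x + t *: 'D_v G x.
    by rewrite addrC (derive_linear dG t v k2) addrC.
  rewrite addrA; move: (G _) (G x) ('D_k2 G x) (t *: _) (G _) => A B C D E.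
  rewrite !opprD !opprK.
  rewrite [RHS](AC (2*2*(2*1))%AC (1*5*4*(2*6)*(3*7))%AC)/=.
  by rewrite !addNr !addr0.
rewrite (le_trans (ler_normB _ _))// (le_trans (lerD H1 H0))//.
rewrite -mulr2n -mulr_natr le_eqVlt; apply/orP; left; apply/eqP.
by field; rewrite gt_eqF.
Qed.

(** Schwarz's theorem: both iterated derivatives approximate the same second difference divided by
    t^2. *)
Lemma derive_comm f (u v x : V) : smooth f -> 'D_v ('D_u f) x = 'D_u ('D_v f) x.
Proof.
move=> sf; apply/eqP; rewrite -subr_eq0 -normr_le0; apply/ler_addgt0Pr => e e0.
have e2 : 0 < e / 2 by rewrite divr_gt0.
have [d1 d10 h1] := mixed_difference u v x sf e2.
have [d2 d20 h2] := mixed_difference v u x sf e2.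
pose t := Num.min d1 d2 / 2.
have m0 : 0 < Num.min d1 d2 by rewrite lt_min d10.
have t0 : 0 < t by rewrite divr_gt0.
have tm : t < Num.min d1 d2 by rewrite gtr_pMr// invf_lt1 ?ltr1n.
move: (tm); rewrite lt_min => /andP[td1 td2].
have H1 : 0 < t < d1 by rewrite t0.
have H2 : 0 < t < d2 by rewrite t0.
have tt : 0 < t * t by rewrite mulr_gt0.
rewrite add0r -(ler_pM2l tt) -[X in X * `|_|](gtr0_norm tt) -normrZ scalerBr.
have Ea : f (x + t *: u + t *: v) = f (x + t *: v + t *: u) by rewrite addrAC.
have := lerD (h1 _ H1) (h2 _ H2); rewrite -mulrDl -splitr [e * _]mulrC Ea.
exact: normr_sub_exchange.
Qed.

Lemma iter_derive_perm f vs ws : smooth f -> perm_eq vs ws ->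
  iter_derive vs f = iter_derive ws f.
Proof.
move=> sf; elim: vs ws => [|v vs IH] ws.
  by rewrite perm_sym => /perm_nilP ->.
move=> pvw; have /path.splitPr : v \in ws by rewrite -(perm_mem pvw) inE eqxx.
move=> W0; case: W0 pvw => ws1 ws2 pvw.
have {}pvw : perm_eq vs (ws1 ++ ws2).
  by rewrite -(perm_cons v) (perm_trans pvw)// perm_catC /= perm_cons perm_catC.
rewrite /= (IH _ pvw) !iter_derive_cat /=.
set g := iter_derive ws2 f; have sg : smooth g by exact: smooth_iter_derive.
elim: ws1 {IH pvw} => //= w ws1 <-.
apply/funext => x; apply: derive_comm; exact: smooth_iter_derive.
Qed.

End Affine.

End SmoothAlgebra.

(** * Bounds on all derivatives up to a given order *)

Section Bounds.
Context {R : realType} {n : nat}.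
Local Notation V := 'rV[R]_n.
Implicit Types (v x : V).

Lemma sqr_coord_le v j : v ord0 j ^+ 2 <= \sum_k v ord0 k ^+ 2.
Proof. by rewrite (bigD1 j)//= lerDl sumr_ge0// => k _; rewrite sqr_ge0. Qed.

Lemma coord_le_enorm v j : `|v ord0 j| <= enorm v.
Proof. by rewrite -sqrtr_sqr ler_wsqrtr// sqr_coord_le. Qed.

Lemma norm_le_enorm v : `|v| <= enorm v.
Proof.
rewrite [leLHS]/Num.Def.normr /= mx_normrE.
apply/bigmax_leP; split; first exact: sqrtr_ge0.
by move=> [i j] _ /=; rewrite ord1; exact: coord_le_enorm.
Qed.

Lemma enorm_le_norm v : enorm v <= n%:R * `|v|.
Proof.
have n0 : 0 <= n%:R * `|v| by rewrite mulr_ge0.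
rewrite -(ger0_norm n0) -sqrtr_sqr ler_wsqrtr//.
apply: (@le_trans _ _ (\sum_(j < n) `|v| ^+ 2)).
  apply: ler_sum => j _; rewrite -real_normK ?num_real//.
  by rewrite lerXn2r ?nnegrE// coord_le_norm.
rewrite sumr_const card_ord exprMn -[leLHS]mulr_natl ler_wpM2r ?sqr_ge0//.
by rewrite -natrX ler_nat; case: (n) => // m; rewrite -mulnn leq_pmulr.
Qed.

Section Bnd.
Context {W : normedModType R}.
Implicit Types f g : V -> W.

(** The seminorm [nu] at a single point, as an inequality between reals: every derivative of order
    at most [m] has Euclidean operator norm at most [B]. *)
Definition bnd (m : nat) (B : R) f x := forall vs : seq V,
  (size vs <= m)%N -> (forall v, v \in vs -> enorm v <= 1) ->
  `|iter_derive vs f x| <= B.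

Lemma bnd0 m B f x : bnd m B f x -> `|f x| <= B.
Proof. by move=> /(_ [::]); apply. Qed.

Lemma bnd_derive m B f x v : bnd m.+1 B f x -> enorm v <= 1 -> bnd m B ('D_v f) x.
Proof.
move=> h v1 vs sz hvs; rewrite -iter_derive_rcons; apply: h.
  by rewrite size_rcons.
by move=> w; rewrite mem_rcons inE => /predU1P[->//|]; exact: hvs.
Qed.

Lemma bndS m B f x : `|f x| <= B ->
  (forall v, enorm v <= 1 -> bnd m B ('D_v f) x) -> bnd m.+1 B f x.
Proof.
move=> h0 h vs; case/lastP: vs => [|vs v]//.
rewrite size_rcons ltnS => sz hvs; rewrite iter_derive_rcons; apply: h => //.
  by apply: hvs; rewrite mem_rcons inE eqxx.
by move=> w wvs; apply: hvs; rewrite mem_rcons inE wvs orbT.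
Qed.

Lemma bnd_le m k B C f x : (k <= m)%N -> B <= C -> bnd m B f x -> bnd k C f x.
Proof.
move=> km BC h vs sz hvs; apply: le_trans BC; apply: h => //.
exact: leq_trans km.
Qed.

Lemma bndD m A B f g x : smooth f -> smooth g -> bnd m A f x -> bnd m B g x ->
  bnd m (A + B) (fun y => f y + g y) x.
Proof.
move=> sf sg hf hg vs sz hvs.
have -> : (fun y => f y + g y) = 1 *: f + g by rewrite scale1r.
rewrite iter_deriveZD// scale1r (le_trans (ler_normD _ _))// lerD//.
  exact: hf.
exact: hg.
Qed.

Lemma iter_deriveZ (c : R) f vs : smooth f ->
  iter_derive vs (fun y => c *: f y) = (fun y => c *: iter_derive vs f y).
Proof.
move=> sf; elim: vs => //= v vs ->; apply/funext => y.
by rewrite deriveZ//; apply: diff_derivable; exact: (sf vs y).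
Qed.

Lemma bndZ m A (c : R) f x : smooth f -> bnd m A f x ->
  bnd m (`|c| * A) (fun y => c *: f y) x.
Proof.
by move=> sf hf vs sz hvs; rewrite iter_deriveZ// normrZ ler_wpM2l//; exact: hf.
Qed.

Lemma derive_coord f x v : differentiable f x ->
  'D_v f x = \sum_j v ord0 j *: 'D_(delta_mx ord0 j) f x.
Proof.
move=> df; rewrite {1}(coord_delta v) derive_sumv//.
by apply: eq_bigr => j _; rewrite deriveZv.
Qed.

Lemma derive_norm_le f x v A : differentiable f x ->
  (forall j, `|'D_(delta_mx ord0 j) f x| <= A) -> `|'D_v f x| <= n%:R * A * `|v|.
Proof.
move=> df hA; rewrite derive_coord//.
rewrite (le_trans (ler_norm_sum _ _ _))//.
apply: (@le_trans _ _ (\sum_(j < n) A * `|v|)).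
  apply: ler_sum => j _; rewrite normrZ mulrC ler_pM//; exact: coord_le_norm.
by rewrite sumr_const card_ord -mulrA -[leLHS]mulr_natl.
Qed.

End Bnd.

(** Each differentiation of a product doubles the number of terms, whence the factor 2^m. *)
Lemma bndM {W : normedModType R} m A B (t : V -> R) (f : V -> W) x : smooth t -> smooth f ->
  bnd m A t x -> bnd m B f x -> bnd m (2 ^+ m * (A * B)) (fun y => t y *: f y) x.
Proof.
elim: m t f => [|m IH] t f st sf ht hf.
  case=> // _ _; rewrite expr0 mul1r normrZ ler_pM//.
    exact: bnd0 ht.
  exact: bnd0 hf.
have A0 : 0 <= A by apply: le_trans (bnd0 ht).
have B0 : 0 <= B by apply: le_trans (bnd0 hf).
apply: bndS.
  rewrite normrZ -[leLHS]mul1r ler_pM ?mulr_ge0//.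
    by rewrite exprn_ege1// ler1n.
  by rewrite ler_pM//; [exact: bnd0 ht|exact: bnd0 hf].
move=> v v1.
have -> : 'D_v (fun y => t y *: f y) = fun x => 'D_v t x *: f x + t x *: 'D_v f x.
  apply/funext => y; have [] := derive_scale v (smooth_differentiable y st)
    (smooth_differentiable y sf); done.
have stv := smooth_derive v st; have sfv := smooth_derive v sf.
rewrite exprS -mulrA mulr_natl mulr2n; apply: bndD; try exact: smoothM.
  apply: IH => //; first exact: bnd_derive.
  by apply: bnd_le hf.
apply: IH => //; last exact: bnd_derive.
by apply: bnd_le ht.
Qed.

(** A direction of Euclidean norm at most 1 has coordinates of size at most 1, so it is enough to
    add up the bounds for the finitely many coordinate derivatives, order by order. *)
Lemma smooth_bnd_compact {W : normedModType R} (m : nat) (K : set V) (f : V -> W) :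
  compact K -> smooth f -> exists2 B, 0 < B & forall x, K x -> bnd m B f x.
Proof.
move=> cK; elim: m f => [|m IH] f sf.
all: have [B0 B00 HB0] : exists2 B : R, 0 < B & forall x, K x -> `|f x| <= B.
1,3: have : compact (f @` K) by
       apply: continuous_compact cK; apply: continuous_subspaceT;
       exact: smooth_continuous.
1,2: move=> /compact_bounded[M [_ HM]]; exists (`|M| + 1); first by rewrite ltr_wpDl.
1,2: by move=> x Kx; apply: HM; [rewrite (le_lt_trans (ler_norm _))// ltrDl|exists x].
  by exists B0 => // x Kx [|//] _ _; exact: HB0.
have /choice[A HA] : forall j : 'I_n, exists A : R, 0 < A /\
    forall x, K x -> bnd m A ('D_(delta_mx ord0 j) f) x.
  by move=> j; have [A A0 HA] := IH _ (smooth_derive (delta_mx ord0 j) sf); exists A.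
have SA0 : 0 <= \sum_j A j by rewrite sumr_ge0// => j _; case: (HA j) => /ltW.
exists (B0 + \sum_j A j); first by rewrite ltr_pwDl.
move=> x Kx; apply: bndS; first by rewrite ler_wpDr// HB0.
move=> v v1 vs sz hvs.
have -> : 'D_v f = fun y => \sum_j v ord0 j *: 'D_(delta_mx ord0 j) f y.
  apply/funext => y; apply: derive_coord; exact: smooth_differentiable.
rewrite iter_derive_sum; last first.
  by move=> j; apply: smoothZ; exact: smooth_derive.
rewrite (le_trans (ler_norm_sum _ _ _))// ler_wpDl ?(ltW B00)//.
apply: ler_sum => j _.
rewrite iter_deriveZ; last exact: smooth_derive.
rewrite normrZ -[leRHS]mul1r ler_pM//.
  by rewrite (le_trans (coord_le_enorm _ _)).
by case: (HA j) => _ /(_ x Kx); apply.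
Qed.

End Bounds.

(** * Integration along segments *)

Section Geometric.
Context {R : realType} {Y : completeNormedModType R}.

(** Serves twice: for Riemann sums in Y and for the values of a distribution on bumps at dyadic
    scales. The explicit rate at N = 0 bounds the distance from the first term to the limit. *)
Lemma geometric_cvg (x : nat -> Y) (A : R) : 0 <= A ->
  (forall k, `|x k.+1 - x k| <= A * 2^-1 ^+ k) ->
  exists2 l, x k @[k --> \oo] --> l & forall N, `|x N - l| <= 2 * A * 2^-1 ^+ N.
Proof.
move=> A0 hx.
have hd d N : `|x (N + d)%N - x N| <= 2 * A * 2^-1 ^+ N.
  suff : `|x (N + d)%N - x N| <= 2 * A * 2^-1 ^+ N - 2 * A * 2^-1 ^+ (N + d).
    by move/le_trans; apply; rewrite gerBl !mulr_ge0// exprn_ge0.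
  elim: d => [|d IH]; first by rewrite addn0 !subrr normr0.
  rewrite addnS -(subrK (x (N + d)%N) (x _.+1)) -addrA.
  rewrite (le_trans (ler_normD _ _))// (le_trans (lerD (hx _) IH))//.
  rewrite addrC exprS le_eqVlt; apply/orP; left; apply/eqP.
  by field.
have /cauchy_cvgP/cvg_ex[l xl] : cauchy (x k @[k --> \oo]).
  apply: cauchy_exP => e e0.
  have A1 : 0 < 2 * A + 1 by rewrite ltr_pwDr// mulr_ge0.
  have e1 : 0 < e / (2 * A + 1) by rewrite divr_gt0.
  have /cvgrPdist_lt/(_ _ e1) : (2^-1 : R) ^+ k @[k --> \oo] --> 0.
    by apply: cvg_expr; rewrite gtr0_norm ?invr_gt0// invf_lt1// ltr1n.
  case=> N _ /(_ N (leqnn N)); rewrite /= sub0r normrN.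
  rewrite ger0_norm ?exprn_ge0// ltr_pdivlMr// => hN.
  exists (x N); exists N => // m /= Nm.
  rewrite -ball_normE /= distrC -(subnKC Nm) (le_lt_trans (hd _ _))//.
  rewrite (le_lt_trans _ hN)// [leRHS]mulrC ler_wpM2r ?exprn_ge0// lerDl.
  exact: ler01.
exists l => // N; apply/ler_addgt0Pr => e e0.
move/cvgrPdist_le : xl => /(_ _ e0)[M _ hM].
have {hM} := hM _ (leq_addl N M : (M <= N + M)%N).
rewrite distrC => H; rewrite -(subrK (x (N + M)%N) (x N)) -addrA.
by rewrite (le_trans (ler_normD _ _))// lerD// distrC.
Qed.
End Geometric.

Section DyadicIntegral.
Context {R : realType} {Y : completeNormedModType R}.
Implicit Types u : R -> Y.

(** Left Riemann sums on [0,1] with 2^N nodes. For Lipschitz integrands their limit is the integral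
    of a Y-valued function. *)
Definition dyadic_sum u (N : nat) : Y :=
  2^-1 ^+ N *: \sum_(0 <= k < 2 ^ N) u (k%:R * 2^-1 ^+ N).

Definition dyadic_int u : Y := lim (dyadic_sum u N @[N --> \oo]).

Definition lip01 u := exists2 A : R, 0 <= A & forall s t : R,
  0 <= s <= 1 -> 0 <= t <= 1 -> `|u s - u t| <= A * `|s - t|.

Lemma big_nat_double (F : nat -> Y) M :
  \sum_(0 <= k < M.*2) F k = \sum_(0 <= k < M) (F k.*2 + F k.*2.+1).
Proof.
elim: M => [|M IH]; first by rewrite !big_geq.
by rewrite doubleS !big_nat_recr//= IH addrA.
Qed.

Lemma dyadic_in01 N k : (k <= 2 ^ N)%N -> 0 <= (k%:R * 2^-1 ^+ N : R) <= 1.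
Proof.
move=> kN; rewrite mulr_ge0 ?exprn_ge0//= exprVn -natrX ler_pdivrMr.
  by rewrite mul1r ler_nat.
by rewrite ltr0n expn_gt0.
Qed.

Lemma sum_const_pow N (c : R) : \sum_(0 <= k < 2 ^ N) c = 2 ^+ N * c.
Proof. by rewrite big_const_nat subn0 iter_addr_0 -[LHS]mulr_natl natrX. Qed.

Lemma half_pow N : 2^-1 ^+ N * 2 ^+ N = 1 :> R.
Proof. by rewrite -exprMn mulVf// expr1n. Qed.

Lemma dyadic_sum_bound u N B : (forall t : R, 0 <= t <= 1 -> `|u t| <= B) ->
  `|dyadic_sum u N| <= B.
Proof.
move=> hu; rewrite normrZ ger0_norm ?exprn_ge0//.
apply: (@le_trans _ _ (2^-1 ^+ N * (2 ^+ N * B))); last first.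
  by rewrite mulrA half_pow mul1r.
rewrite ler_wpM2l ?exprn_ge0// -sum_const_pow (le_trans (ler_norm_sum _ _ _))//.
apply: ler_sum_nat => k /andP[_ kN]; apply: hu; apply: dyadic_in01.
exact: ltnW.
Qed.

(** Halving the mesh replaces each value by its average with the value at the next new node; by the
    Lipschitz condition the sum changes by at most A 2^-N. *)
Lemma dyadic_cvg u : lip01 u -> dyadic_sum u N @[N --> \oo] --> dyadic_int u.
Proof.
move=> [A A0 hA].
have [N|l ul _] := @geometric_cvg R Y (dyadic_sum u) (A) A0.
  rewrite /dyadic_sum expnS mul2n big_nat_double exprSr -scalerA -scalerBr.
  rewrite normrZ ger0_norm ?exprn_ge0// mulrC.
  rewrite ler_wpM2r ?exprn_ge0// scaler_sumr -sumrB.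
  have -> : A = \sum_(0 <= k < 2 ^ N) A * 2^-1 ^+ N.
    by rewrite sum_const_pow mulrCA [_ * 2^-1 ^+ N]mulrC half_pow mulr1.
  rewrite (le_trans (ler_norm_sum _ _ _))//.
  apply: ler_sum_nat => k /andP[_ kN].
  have kE : k.*2%:R * (2^-1 ^+ N / 2) = k%:R * 2^-1 ^+ N :> R.
    by rewrite -mul2n natrM; field.
  have k0 : 0 <= (k.*2%:R * (2^-1 ^+ N / 2) : R) <= 1.
    by rewrite kE; apply: dyadic_in01; exact: ltnW.
  have k1 : 0 <= (k.*2.+1%:R * (2^-1 ^+ N / 2) : R) <= 1.
    rewrite -exprSr; apply: dyadic_in01; rewrite expnS mul2n.
    by rewrite ltn_double.
  have := hA _ _ k1 k0; rewrite -mulrBl -natrB ?leqnSn// subSnn mul1r.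
  rewrite -kE ger0_norm ?divr_ge0 ?exprn_ge0// => H.
  set a := u _ in H *; set b := u _ in H *.
  have -> : 2^-1 *: (b + a) - b = 2^-1 *: (a - b).
    have bE : b = 2^-1 *: b + 2^-1 *: b.
      by rewrite -scalerDl -[LHS]scale1r; congr (_ *: _); field.
    by rewrite {2}bE scalerDr scalerBr opprD addrACA subrr add0r.
  rewrite normrZ gtr0_norm// (@le_trans _ _ `|a - b|)//.
    by rewrite ler_piMl// invf_le1// ler1n.
  rewrite (le_trans H)// ler_wpM2l// ler_piMr ?exprn_ge0//.
  by rewrite invf_le1// ler1n.
by rewrite /dyadic_int (cvg_lim _ ul).
Qed.

Lemma dyadic_int_bound u B : lip01 u -> (forall t : R, 0 <= t <= 1 -> `|u t| <= B) ->
  `|dyadic_int u| <= B.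
Proof.
move=> /dyadic_cvg cu hu; apply/ler_addgt0Pr => e e0.
move/cvgrPdist_le : cu => /(_ _ e0)[M _ /(_ M (leqnn M)) hM].
rewrite -(subrK (dyadic_sum u M) (dyadic_int u)) (le_trans (ler_normD _ _))//.
by rewrite addrC lerD// dyadic_sum_bound.
Qed.

Lemma dyadic_int_linear (c : R) u v : lip01 u -> lip01 v ->
  dyadic_int (fun t => c *: u t + v t) = c *: dyadic_int u + dyadic_int v.
Proof.
move=> lu lv; apply: cvg_lim; first exact: norm_hausdorff.
have -> : dyadic_sum (fun t => c *: u t + v t) =
    (fun N => c *: dyadic_sum u N + dyadic_sum v N).
  apply/funext => N; rewrite /dyadic_sum scalerA [c * _]mulrC -scalerA -scalerDr.
  by congr (_ *: _); rewrite scaler_sumr -big_split.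
by apply: cvgD; [apply: cvgZl_tmp|]; exact: dyadic_cvg.
Qed.

(** The increment u(1) - u(0) telescopes over the dyadic intervals. On an interval of length h the
    mean value inequality compares it with the term of the Riemann sum up to A h^2, a total error of
    A h. *)
Lemma dyadic_int_derive u (du : R -> Y) :
  (forall t : R, 0 <= t <= 1 -> is_derive t (1 : R) u (du t)) -> lip01 du ->
  dyadic_int du = u 1 - u 0.
Proof.
move=> hu ldu; have [A A0 hA] := ldu.
apply: cvg_lim; first exact: norm_hausdorff.
apply/cvgrPdist_le => e e0.
have A1 : 0 < A + 1 by rewrite ltr_pwDr.
have e1 : 0 < e / (A + 1) by rewrite divr_gt0.
have /cvgrPdist_lt/(_ _ e1) : (2^-1 : R) ^+ k @[k --> \oo] --> 0.
  by apply: cvg_expr; rewrite gtr0_norm ?invr_gt0// invf_lt1// ltr1n.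
case=> M _ hM; exists M => // N /hM /=; rewrite sub0r normrN ger0_norm ?exprn_ge0//.
rewrite ltr_pdivlMr// => hN.
set h := 2^-1 ^+ N in hN *; have h0 : 0 < h by rewrite exprn_gt0.
rewrite (@le_trans _ _ (A * h))//; last first.
  by rewrite mulrC (le_trans _ (ltW hN))// ler_wpM2l ?(ltW h0)// lerDl.
have -> : u 1 - u 0 = \sum_(0 <= k < 2 ^ N) (u (k.+1%:R * h) - u (k%:R * h)).
  by rewrite telescope_sumr// mul0r natrX mulrC half_pow.
rewrite /dyadic_sum scaler_sumr -sumrB (le_trans (ler_norm_sum _ _ _))//.
have -> : A * h = \sum_(0 <= k < 2 ^ N) h * (A * h).
  by rewrite sum_const_pow mulrA [2 ^+ N * h]mulrC half_pow mul1r.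
apply: ler_sum_nat => k /andP[_ kN].
have khE : k%:R * h + h = k.+1%:R * h by rewrite -natr1 mulrDl mul1r.
have := @mean_value_ineq R Y R u (k%:R * h) h (h *: du (k%:R * h)) (h * (A * h)).
rewrite khE distrC => -> // t /andP[t0 t1].
all: have k01 := @dyadic_in01 N _ kN; have k00 := @dyadic_in01 N _ (ltnW kN).
all: have tin : 0 <= (k%:R * h + t *: h : R) <= 1.
1,3: rewrite addr_ge0/= ?mulr_ge0 ?(ltW h0)//.
1,2: by case/andP: k01 => _; apply: le_trans; rewrite -khE lerD2l ler_piMl// ltW.
all: have dt := hu _ tin.
  by apply/derivable1_diffP; exact: ex_derive.
have -> : 'D_h u (k%:R * h + t *: h) = h *: du (k%:R * h + t *: h).
  rewrite -[X in 'D_X _ _](mulr1 h) -[h * 1]/(h *: (1 : R^o)) deriveZv.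
    by rewrite (@derive_val _ _ _ _ _ _ _ dt).
  by apply/derivable1_diffP; exact: ex_derive.
rewrite -scalerBr normrZ gtr0_norm// ler_wpM2l ?(ltW h0)//.
rewrite (le_trans (hA _ _ tin k00))// ler_wpM2l// addrAC subrr add0r.
by rewrite normrM (gtr0_norm h0) ger0_norm// ler_piMl// ltW.
Qed.

End DyadicIntegral.

(** * Differentiation under the integral sign *)

Section LineIntegral.
Context {R : realType} {n : nat} {Y : completeNormedModType R}.
Local Notation V := 'rV[R]_n.
Implicit Types (f g : V -> Y) (v w x h : V).

(** Global bounds on all derivatives make remainders uniform along a segment, as differentiation
    under the integral requires; smooth maps vanishing outside a cube qualify. *)
Definition tame f := smooth f /\ forall vs : seq V, exists B : R,
  forall x, `|iter_derive vs f x| <= B.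

Lemma tame_iter_derive f vs : tame f -> tame (iter_derive vs f).
Proof.
move=> [sf bf]; split; first exact: smooth_iter_derive.
by move=> ws; have [B hB] := bf (ws ++ vs); exists B => x; rewrite -iter_derive_cat.
Qed.

Lemma tame_derive f v : tame f -> tame ('D_v f).
Proof. exact: (@tame_iter_derive f [:: v]). Qed.

Lemma tameZD (c : R) f g : tame f -> tame g -> tame (fun x => c *: f x + g x).
Proof.
move=> [sf bf] [sg bg]; split.
  by apply: smoothD => //; exact: smoothZ.
move=> vs; have [A hA] := bf vs; have [B hB] := bg vs.
exists (`|c| * A + B) => x.
rewrite (_ : (fun x => _) = c *: f + g)// iter_deriveZD//.
rewrite (le_trans (ler_normD _ _))// lerD// normrZ ler_wpM2l//.
Qed.

Lemma tame_translate f b : tame f -> tame (fun x => f (x + b)).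
Proof.
move=> [sf bf].
have E vs : iter_derive vs (fun x => f (x + b)) = fun x => iter_derive vs f (x + b).
  have := iter_derive_affine 1 b f vs.
  have -> : (fun x => f (1 *: x + b)) = (fun x => f (x + b)).
    by apply/funext => x; rewrite scale1r.
  move=> ->; apply/funext => x; rewrite scale1r.
  by rewrite (eq_map (g := id)) ?map_id// => v; rewrite scale1r.
split=> [vs x|vs].
  rewrite E; apply: (@differentiable_comp _ _ _ _ (fun x => x + b)); last exact: sf.
  exact: differentiableD.
by have [B hB] := bf vs; exists B => x; rewrite E.
Qed.

Lemma tame_derive_bound f : tame f ->
  exists2 A : R, 0 <= A & forall x v, `|'D_v f x| <= A * `|v|.
Proof.
move=> [sf bf].
have /choice[B hB] : forall j : 'I_n, exists B : R, forall x,
    `|'D_(delta_mx ord0 j) f x| <= B by move=> j; exact: (bf [:: delta_mx ord0 j]).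
exists (n%:R * \sum_j `|B j|); first by rewrite mulr_ge0// sumr_ge0.
move=> x v; apply: derive_norm_le; first exact: smooth_differentiable.
move=> j; rewrite (le_trans (hB j x))// (le_trans (ler_norm _))//.
by rewrite (bigD1 j)//= lerDl sumr_ge0.
Qed.

Lemma tame_lipschitz f : tame f ->
  exists2 A : R, 0 <= A & forall x h, `|f (x + h) - f x| <= A * `|h|.
Proof.
move=> tf; have [A A0 hA] := tame_derive_bound tf; exists A => // x h.
have := @mean_value_ineq R Y V f x h 0 (A * `|h|); rewrite subr0.
apply=> t _; first by apply: smooth_differentiable; case: tf.
by rewrite subr0.
Qed.

(** The mean value inequality is used twice, with D_h D_h f bounded quadratically in [h] uniformly
    in space. *)
Lemma tame_second_order f : tame f ->
  exists2 A : R, 0 <= A & forall x h, `|f (x + h) - f x - 'D_h f x| <= A * `|h| * `|h|.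
Proof.
move=> tf; have [sf _] := tf.
have /choice[B hB] : forall j : 'I_n, exists B : R, 0 <= B /\ forall x v,
    `|'D_v ('D_(delta_mx ord0 j) f) x| <= B * `|v|.
  move=> j; have [A A0 hA] := tame_derive_bound (tame_derive (delta_mx ord0 j) tf).
  by exists A.
pose A := n%:R * \sum_j B j.
have SB0 : 0 <= \sum_j B j by rewrite sumr_ge0// => j _; case: (hB j).
exists A; first by rewrite mulr_ge0.
move=> x h; apply: mean_value_ineq => t /andP[t0 t1].
  exact: smooth_differentiable.
have := @mean_value_ineq R Y V ('D_h f) x (t *: h) 0 (A * `|h| * `|h|); rewrite subr0.
apply=> s _; first by apply: smooth_differentiable; exact: smooth_derive.
rewrite subr0 deriveZv; last by apply: smooth_differentiable; exact: smooth_derive.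
rewrite normrZ ger0_norm//.
have H y : `|'D_h ('D_h f) y| <= A * `|h| * `|h|.
  rewrite /A -[n%:R * _ * _]mulrA; apply: derive_norm_le.
    by apply: smooth_differentiable; exact: smooth_derive.
  move=> j; rewrite derive_comm//; have [Bj0 /(_ _ _)/le_trans] := hB j; apply.
  rewrite ler_wpM2r// (bigD1 j)//= lerDl sumr_ge0// => k _.
  by case: (hB k).
by rewrite (le_trans _ (H (x + s *: (t *: h))))// ler_piMl.
Qed.

(** The average of [f] over the segment from [x] to x - w; integrals with respect to length need the
    length as a factor. *)
Definition line_int w f : V -> Y := fun x => dyadic_int (fun t => f (x - t *: w)).

Lemma tame_lip01 f x w : tame f -> lip01 (fun t => f (x - t *: w)).
Proof.
move=> /tame_lipschitz[A A0 hA]; exists (A * `|w|); first by rewrite mulr_ge0.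
move=> s t _ _; have := hA (x - t *: w) (t *: w - s *: w).
by rewrite addrA subrK -scalerBl normrZ [`|t - s|]distrC mulrA mulrAC.
Qed.

Lemma line_intZD w (c : R) f g x : tame f -> tame g ->
  line_int w (fun y => c *: f y + g y) x = c *: line_int w f x + line_int w g x.
Proof. by move=> tf tg; apply: dyadic_int_linear; exact: tame_lip01. Qed.

Lemma line_int_bound w f x B : tame f ->
  (forall t : R, 0 <= t <= 1 -> `|f (x - t *: w)| <= B) -> `|line_int w f x| <= B.
Proof. by move=> tf hB; apply: dyadic_int_bound => //; exact: tame_lip01. Qed.

(** The remainder of the integral is the integral of the remainders, which are quadratic in [h]
    uniformly along the segment. *)
Lemma line_int_derive w f x v : tame f ->
  differentiable (line_int w f) x /\ 'D_v (line_int w f) x = line_int w ('D_v f) x.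
Proof.
move=> tf; have [sf _] := tf.
have [A A0 hA] := tame_second_order tf.
have [B B0 hB] := tame_derive_bound tf.
have [c a b||e e0|d E] := @differentiable_intro R V Y (line_int w f) x
  (fun h => line_int w ('D_h f) x); last by split.
- rewrite -line_intZD; [|exact: tame_derive|exact: tame_derive].
  congr (line_int w _ x); apply/funext => y.
  by rewrite derive_linear//; exact: smooth_differentiable.
- exists B => h; apply: line_int_bound => //; exact: tame_derive.
have A1 : 0 < A + 1 by rewrite ltr_pwDr.
exists (e / (A + 1)); first by rewrite divr_gt0.
move=> h hh.
have tt := tame_translate h tf; have td := tame_derive h tf.
have -> : line_int w f (x + h) = line_int w (fun y => f (y + h)) x.
  by congr dyadic_int; apply/funext => t; rewrite addrAC.
pose g y := (-1) *: f y + f (y + h).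
have tg : tame g by exact: tameZD.
have -> : line_int w (fun y => f (y + h)) x - line_int w f x - line_int w ('D_h f) x =
    line_int w (fun y => (-1) *: 'D_h f y + g y) x.
  rewrite line_intZD// line_intZD// !scaleN1r addrC.
  by congr (_ + _); rewrite addrC.
apply: line_int_bound => [|t _]; first exact: tameZD.
rewrite /g !scaleN1r addrC [- f _ + _]addrC (le_trans (hA _ _))//.
rewrite ler_wpM2r//; move: hh; rewrite ltr_pdivlMr// => /ltW.
by apply: le_trans; rewrite mulrC ler_wpM2l// lerDl.
Qed.

Lemma iter_derive_line_int w f vs : tame f ->
  iter_derive vs (line_int w f) = line_int w (iter_derive vs f).
Proof.
move=> tf; elim: vs => //= v vs ->; apply/funext => x.
by have [] := line_int_derive w x v (tame_iter_derive vs tf).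
Qed.

Lemma line_int_smooth w f : tame f -> smooth (line_int w f).
Proof.
move=> tf vs x; rewrite iter_derive_line_int//.
by have [] := line_int_derive w x 0 (tame_iter_derive vs tf).
Qed.

Lemma line_int_bnd w f x m B : tame f ->
  (forall t : R, 0 <= t <= 1 -> bnd m B f (x - t *: w)) -> bnd m B (line_int w f) x.
Proof.
move=> tf hf vs sz hvs; rewrite iter_derive_line_int//.
apply: line_int_bound; first exact: tame_iter_derive.
by move=> t t01; exact: hf.
Qed.

Lemma line_int_fundamental w f x : tame f -> 'D_w (line_int w f) x = f x - f (x - w).
Proof.
move=> tf; have [sf _] := tf; have [_ ->] := line_int_derive w x w tf.
have td := tame_derive w tf.
(* The fundamental theorem for t -> f(x - t w), whose derivative is - D_w f; the added 0 only brings
   the integrand into the form of [line_intZD]. *)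
have E : line_int w (fun y => (-1) *: 'D_w f y + 0) x = f (x - w) - f x.
  rewrite /line_int (_ : (fun t => _) = (fun t : R => 'D_(- w) f (x + t *: (- w)))).
    have := @dyadic_int_derive R Y (fun t => f (x + t *: (- w)))
      (fun t => 'D_(- w) f (x + t *: (- w))).
    rewrite scale1r scale0r addr0; apply.
    - by move=> t _; apply: is_derive_line; exact: smooth_differentiable.
    - have := tame_lip01 x w (tame_derive (- w) tf).
      by under eq_fun do rewrite -scalerN.
  apply/funext => t; rewrite addr0 scalerN -[- w]scaleN1r deriveZv//.
  exact: smooth_differentiable.
rewrite -[LHS]opprK -[RHS]opprB -E; congr (- _).
have t0 : tame (fun _ : V => 0 : Y).
  have E0 vs : iter_derive vs (fun _ : V => 0 : Y) = fun=> 0.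
    by elim: vs => //= v vs ->; apply/funext => y; rewrite derive_cst.
  split; first exact: smooth_cst.
  by move=> vs; exists 0 => y; rewrite E0 normr0.
rewrite line_intZD// scaleN1r.
suff -> : line_int w (fun=> 0) x = 0 by rewrite addr0.
apply/eqP; rewrite -normr_le0; apply: line_int_bound => // t _.
by rewrite normr0.
Qed.

End LineIntegral.

(** * A smooth step function *)

Section SmoothStep.
Context {R : realType}.
Implicit Types (p : {poly R}) (t u : R).

(* For every polynomial p the function p(1/t) exp(-1/t), extended by 0 to
   t <= 0, is differentiable with derivative of the same form. *)
Definition flat p t : R := if 0 < t then p.[t^-1] * expR (- t^-1) else 0.

(** With u = 1/t one has d/dt = - u^2 d/du, which sends p(u) exp(-u) to u^2 (p - p')(u) exp(-u). *)
Definition flat_deriv p : {poly R} := 'X^2 * (p - p^`()).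

(** From the exponential series, u^k exp(-u) is at most k! for k > 0 and at most 1 for k = 0; the
    coefficients are then summed. *)
Lemma horner_exp_bounded p : exists2 K : R, 0 <= K & forall u, 0 < u ->
  `|p.[u]| * expR (- u) <= K.
Proof.
elim/poly_ind: p => [|p c [K K0 hK]].
  by exists 0 => // u _; rewrite horner0 normr0 mul0r.
have pow k : exists2 M : R, 0 <= M & forall u, 0 < u -> u ^+ k * expR (- u) <= M.
  case: k => [|k].
    exists 1 => // u u0; rewrite expr0 mul1r -expR0 ler_expR oppr_le0 ltW//.
  exists (k.+1)`!%:R => // u u0.
  rewrite expRN ler_pdivrMr ?expR_gt0// -ler_pdivrMl ?ltr0n ?fact_gt0//.
  rewrite mulrC (le_trans _ (expR_ge1Dxn k (ltW u0)))// lerDr ler01//.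
have coefb : forall q : {poly R}, exists2 M : R, 0 <= M & forall u, 0 < u ->
    `|q.[u]| * expR (- u) <= M.
  move=> q; have /choice[M hM] : forall k : nat, exists M : R, 0 <= M /\
      forall u, 0 < u -> u ^+ k * expR (- u) <= M.
    by move=> k; have [M M0 hM] := pow k; exists M.
  exists (\sum_(i < size q) `|q`_i| * M i).
    by apply: sumr_ge0 => i _; rewrite mulr_ge0//; case: (hM i).
  move=> u u0; rewrite horner_coef.
  apply: (@le_trans _ _ (\sum_(i < size q) `|q`_i| * u ^+ i * expR (- u))).
    rewrite -mulr_suml ler_wpM2r ?expR_ge0// (le_trans (ler_norm_sum _ _ _))//.
    by apply: ler_sum => i _; rewrite normrM normrX (gtr0_norm u0).
  apply: ler_sum => i _; rewrite -mulrA ler_wpM2l//.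
  by case: (hM i) => _; apply.
exact: coefb.
Qed.

(** The preceding bound for p X^2. Quadratic decay gives differentiability at 0 with derivative
    0. *)
Lemma flat_quadratic p : exists2 K : R, 0 <= K & forall t, `|flat p t| <= K * t ^+ 2.
Proof.
have [K K0 hK] := horner_exp_bounded (p * 'X^2).
exists K => // t; rewrite /flat; case: ifPn => t0; last first.
  by rewrite normr0 mulr_ge0// sqr_ge0.
have := hK t^-1; rewrite invr_gt0 => /(_ t0).
rewrite hornerM hornerXn normrM normrX normfV (gtr0_norm t0).
rewrite normrM (gtr0_norm (expR_gt0 _)) mulrAC exprVn ler_pdivrMr//.
by rewrite exprn_gt0.
Qed.

Lemma flat_is_derive p t : is_derive t (1 : R) (flat p) (flat (flat_deriv p) t).
Proof.
have [t0|t0|->] := ltgtP t 0.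
- rewrite {2}/flat ltNge (ltW t0)/=.
  apply: (@near_eq_is_derive _ _ _ (cst 0)).
    near=> s; rewrite /flat ifN//= -leNgt ltW//; near: s.
    exact: lt_nbhsl.
- rewrite {2}/flat t0.
  apply: (@near_eq_is_derive _ _ _ (fun s : R => p.[s^-1] * expR (- s^-1))).
    near=> s; rewrite /flat ifT//; near: s.
    exact: lt_nbhsr.
  have di : is_derive t 1 (fun s : R => s^-1) (- t ^- 2).
    have := @is_deriveV R id t 1 1; rewrite gt_eqF// => /(_ isT (is_derive_id _ _)).
    by move/is_derive_eq; apply; rewrite /= /GRing.scale/= mulr1.
  have dp := @is_derive1_comp R (horner p) (fun s => s^-1) t _ _ (is_derive_poly _ _) di.
  have dn : is_derive t 1 (fun s : R => - s^-1) (t ^- 2).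
    by have := is_deriveN di; rewrite opprK.
  have de := @is_derive1_comp R expR (fun s => - s^-1) t _ _ (is_derive_expR _) dn.
  have := is_deriveM dp de; move/is_derive_eq; apply.
  rewrite /flat_deriv hornerM hornerXn hornerD hornerN /GRing.scale/=.
  by rewrite exprVn; ring.
- rewrite {2}/flat ltxx.
  have [K K0 hK] := flat_quadratic p.
  have [||e e0|d E] := @differentiable_intro R R R (flat p) 0 (fun=> 0).
  + by move=> a b c; rewrite scaler0 addr0.
  + by exists 0 => h; rewrite normr0 mul0r.
  + have K1 : 0 < K + 1 by rewrite ltr_pwDr.
    exists (e / (K + 1)); first by rewrite divr_gt0.
    move=> h hh; rewrite add0r {2}/flat ltxx !subr0 (le_trans (hK _))//.
    rewrite -real_normK ?num_real// expr2 mulrA ler_wpM2r//.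
    move: hh; rewrite ltr_pdivlMr// => /ltW; apply: le_trans.
    by rewrite mulrC ler_wpM2l// lerDl.
  by split; [exact: diff_derivable|rewrite E].
Unshelve. all: by end_near. Qed.

Context {n : nat}.
Local Notation V := 'rV[R]_n.

Lemma flat_smooth p (j : 'I_n) (c b : R) : smooth (fun x : V => flat p (c * x ord0 j + b)).
Proof.
apply/smoothP => m.
have E q (x v : V) : differentiable (fun x : V => flat q (c * x ord0 j + b)) x /\
    'D_v (fun x : V => flat q (c * x ord0 j + b)) x =
    (c * v ord0 j) *: flat (flat_deriv q) (c * x ord0 j + b).
  have dq : differentiable (flat q) (c * x ord0 j + b).
    by apply/derivable1_diffP; have [] := flat_is_derive q (c * x ord0 j + b).
  have dc : differentiable (fun x : V => c * x ord0 j + b) x.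
    apply: differentiableD => //; apply: (@differentiableZ _ _ R).
    exact: differentiable_coord.
  split; first exact: (@differentiable_comp _ _ _ _ _ (flat q)).
  have Dc : 'D_v (fun x : V => c * x ord0 j + b) x = c * v ord0 j.
    rewrite deriveD//; last first.
      by apply: (@derivableZ _ _ R); apply: diff_derivable; exact: differentiable_coord.
    rewrite derive_cst addr0 (@deriveZ _ _ R) ?derive_coordE//.
    by apply: diff_derivable; exact: differentiable_coord.
  rewrite deriveE; last exact: (@differentiable_comp _ _ _ _ _ (flat q)).
  rewrite (diff_comp dc dq)/= -deriveE// -deriveE// Dc -[X in 'D_X _ _]mulr1 -[_ * 1]/(_ *: (1 : R^o)) deriveZv//.
  by have [_ ->] := flat_is_derive q (c * x ord0 j + b).
elim: m p => [|m IH] p; (split; first by move=> x; have [] := E p x 0) => // v.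
rewrite (_ : 'D_v _ = fun x => (c * v ord0 j) *: flat (flat_deriv p) (c * x ord0 j + b)).
  apply: CkM (IH _); have /smoothP := @smooth_cst R n R (c * v ord0 j); exact.
by apply/funext => x; have [] := E p x v.
Qed.

Lemma flat_gt0 t : (0 < flat 1 t) = (0 < t).
Proof.
rewrite /flat; case: ifP => t0; last exact: ltxx.
by rewrite hornerC mul1r expR_gt0.
Qed.

Lemma flat_ge0 t : 0 <= flat 1 t.
Proof. by rewrite /flat; case: ifP => // t0; rewrite hornerC mul1r expR_ge0. Qed.

Lemma flat_le0 t : t <= 0 -> flat 1 t = 0.
Proof. by rewrite /flat ltNge => ->. Qed.

(** A smooth transition from 0 on t <= -1 to 1 on t >= 1. At least one of 1 + t and 1 - t is
    positive, so the denominator does not vanish. *)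
Definition step t := flat 1 (1 + t) / (flat 1 (1 + t) + flat 1 (1 - t)).

Lemma step_den_gt0 t : 0 < flat 1 (1 + t) + flat 1 (1 - t).
Proof.
have [t0|t0] := ltP 0 (1 + t).
  by rewrite ltr_pwDl ?flat_gt0// flat_ge0.
by rewrite ltr_wpDl ?flat_ge0// flat_gt0; lra.
Qed.

Lemma step0 t : t <= -1 -> step t = 0.
Proof. by move=> t1; rewrite /step flat_le0 ?mul0r//; lra. Qed.

Lemma step1 t : 1 <= t -> step t = 1.
Proof.
move=> t1; have := step_den_gt0 t; rewrite /step [flat 1 (1 - t)]flat_le0 ?addr0; last lra.
by move=> h; rewrite divff// gt_eqF.
Qed.

Definition stepv (j : 'I_n) (x : V) : R := step (x ord0 j).

Lemma stepv_smooth j : smooth (stepv j).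
Proof.
have s1 := flat_smooth 1 j 1 1; have s2 := flat_smooth 1 j (-1) 1.
have E x : stepv j x = flat 1 (1 * x ord0 j + 1) *:
   (flat 1 (1 * x ord0 j + 1) + flat 1 (-1 * x ord0 j + 1))^-1.
  by rewrite /stepv /step mul1r mulN1r addrC [- _ + 1]addrC.
rewrite (funext E : stepv j = _).
apply: smoothM => //; apply: smoothV; last exact: smoothD.
move=> x; rewrite mul1r mulN1r addrC [_ + 1]addrC gt_eqF//.
by rewrite addrC [x ord0 j + 1]addrC step_den_gt0.
Qed.

(** Defined as a derivative so that its primitive is the step: its integral along a line in
    direction e_j is 1 by the fundamental theorem, and a dilation divides it by the dilation
    factor. *)
Definition bump (j : 'I_n) : V -> R := 'D_(delta_mx ord0 j) (stepv j).

Lemma bump_smooth j : smooth (bump j).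
Proof. by apply: smooth_derive; exact: stepv_smooth. Qed.

Lemma stepv_shift j (x v : V) : v ord0 j = 0 -> stepv j (x + v) = stepv j x.
Proof. by move=> vj; rewrite /stepv mxE vj addr0. Qed.

Lemma derive_translate {W : normedModType R} (f : V -> W) b v x :
  'D_v (fun y => f (y + b)) x = 'D_v f (x + b).
Proof.
have := congr1 (fun F => F x) (iter_derive_affine 1 b f [:: v]).
rewrite /= !scale1r => <-; congr ('D_v _ x).
by apply/funext => y; rewrite scale1r.
Qed.

Lemma bump_shift j (x v : V) : v ord0 j = 0 -> bump j (x + v) = bump j x.
Proof.
move=> vj; rewrite /bump -derive_translate.
have -> : (fun y => stepv j (y + v)) = stepv j by apply/funext => y; rewrite stepv_shift.
by [].
Qed.

Lemma bump_supp j (x : V) : 1 < `|x ord0 j| -> bump j x = 0.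
Proof.
move=> xj.
have [c hc] : exists c, \forall y \near x, stepv j y = c.
  exists (stepv j x); apply/nbhs_ballP; exists (`|x ord0 j| - 1); first by rewrite /= subr_gt0.
  move=> y; rewrite -ball_normE /= => xy.
  have {xy} := le_lt_trans (coord_le_norm (x - y) j) xy; rewrite !mxE => xy.
  have [x0|x0] := ltP 0 (x ord0 j).
    rewrite (gtr0_norm x0) in xy xj; rewrite /stepv (step1 (ltW xj)) step1//.
    by move: xy; rewrite ltr_norml => /andP[]; lra.
  rewrite (ler0_norm x0) in xy xj; rewrite /stepv (@step0 (x _ _)) ?step0//; last by lra.
  by move: xy; rewrite ltr_norml => /andP[]; lra.
by rewrite /bump (near_eq_derive _ hc) derive_cst.
Qed.

End SmoothStep.

(** * Functions with compact support as divergences *)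

Section Supports.
Context {R : realType} {n : nat} {W : normedModType R}.
Local Notation V := 'rV[R]_n.
Implicit Types (f : V -> W) (x v : V).

Lemma smoothN f : smooth f -> smooth (fun x => - f x).
Proof.
move=> sf; rewrite (_ : (fun x => - f x) = fun x => (-1 : R) *: f x); first exact: smoothZ.
by apply/funext => x; rewrite scaleN1r.
Qed.

(** The norm of row vectors is the sup norm, so the support lies in a cube, that is, in an
    intersection of slabs. *)
Definition vanishes_beyond (rho : R) f := forall x, rho < `|x| -> f x = 0.

Lemma vanishes_derive rho f v : vanishes_beyond rho f -> vanishes_beyond rho ('D_v f).
Proof.
move=> hf x rx; have hx : \forall y \near x, f y = 0.
  apply/nbhs_ballP; exists (`|x| - rho); first by rewrite /= subr_gt0.
  move=> y; rewrite -ball_normE /= => xy; apply: hf.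
  have := ler_normB (x - y) (- y); rewrite opprK subrK normrN.
  by move: xy; lra.
by rewrite (near_eq_derive _ hx) derive_cst.
Qed.

Lemma vanishes_iter_derive rho f vs :
  vanishes_beyond rho f -> vanishes_beyond rho (iter_derive vs f).
Proof. by move=> hf; elim: vs => //= v vs; exact: vanishes_derive. Qed.

Lemma bnd_everywhere rho m B f : 0 <= B -> vanishes_beyond rho f ->
  (forall x, `|x| <= rho -> bnd m B f x) -> forall x, bnd m B f x.
Proof.
move=> B0 hf hb x; have [|rx] := leP `|x| rho; first exact: hb.
by move=> vs _ _; rewrite (vanishes_iter_derive _ hf)// normr0.
Qed.

Lemma compact_cube (rho : R) : compact [set x : V | `|x| <= rho].
Proof.
apply: bounded_closed_compact.
  exists rho; split; first exact: num_real.
  by move=> M rM x /= xr; rewrite (le_trans xr)// ltW.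
rewrite (_ : [set x | _] = (fun x => `|x|) @^-1` [set t | t <= rho])//.
by apply: closed_comp; [move=> x _; exact: norm_continuous|exact: closed_le].
Qed.

Lemma smooth_vanishes_bnd m rho f : smooth f -> vanishes_beyond rho f ->
  exists2 B, 0 < B & forall x, bnd m B f x.
Proof.
move=> sf hf; have [B B0 hB] := smooth_bnd_compact m (@compact_cube rho) sf.
by exists B => //; apply: (bnd_everywhere (ltW B0) hf) => x /hB.
Qed.

Definition slab j f := forall x, 1 < `|x ord0 j| -> f x = 0.

Lemma vanishes_slab f : vanishes_beyond 1 f <-> forall j, slab j f.
Proof.
split=> [hf j x xj|hf x x1].
  by apply: hf; apply: lt_le_trans xj _; exact: coord_le_norm.
apply: contrapT => fx; move: x1; apply/negP; rewrite -leNgt.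
rewrite [leLHS]/Num.Def.normr /= mx_normrE.
apply/bigmax_leP; split=> // -[i j] _ /=; rewrite ord1 leNgt; apply/negP => xj.
by apply: fx; exact: (hf j).
Qed.

End Supports.

Section TameExtra.
Context {R : realType} {n : nat} {Y : completeNormedModType R}.
Local Notation V := 'rV[R]_n.

Lemma smooth_vanishes_tame rho (f : V -> Y) :
  smooth f -> vanishes_beyond rho f -> tame f.
Proof.
move=> sf hf; split=> // vs.
have [B _ hB] := smooth_vanishes_bnd 0 (smooth_iter_derive vs sf)
  (vanishes_iter_derive vs hf).
by exists B => x; have := bnd0 (hB x).
Qed.

Lemma line_int_tame w (f : V -> Y) : tame f -> tame (line_int w f).
Proof.
move=> tf; split; first exact: line_int_smooth.
move=> vs; have [_ bf] := tf; have [B hB] := bf vs; exists B => x.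
by rewrite iter_derive_line_int//; apply: line_int_bound => //; exact: tame_iter_derive.
Qed.

Lemma tame_cst (y : Y) : tame (fun _ : V => y).
Proof.
split; first exact: smooth_cst.
move=> vs; exists `|y| => x; case/lastP: vs => [|vs v]//.
rewrite iter_derive_rcons (_ : 'D_v _ = 0); last by apply/funext => z; rewrite derive_cst.
suff -> : iter_derive vs (0 : V -> Y) = 0 by rewrite normr0.
by elim: vs => //= w vs ->; apply/funext => z; rewrite derive_cst.
Qed.

Lemma tameZ (c : R) (f : V -> Y) : tame f -> tame (fun x => c *: f x).
Proof.
move=> tf; have := tameZD c tf (tame_cst 0).
by under eq_fun do rewrite addr0.
Qed.

Lemma tameD (f g : V -> Y) : tame f -> tame g -> tame (fun x => f x + g x).
Proof.
move=> tf tg; have := tameZD 1 tf tg.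
by under eq_fun do rewrite scale1r.
Qed.

Lemma line_int_eq w (f g : V -> Y) x :
  (forall t : R, f (x - t *: w) = g (x - t *: w)) -> line_int w f x = line_int w g x.
Proof. by move=> fg; congr dyadic_int; apply/funext. Qed.

Lemma line_int_scale w (t : V -> R) (f : V -> Y) x : tame f ->
  (forall s : R, t (x - s *: w) = t x) ->
  line_int w (fun y => t y *: f y) x = t x *: line_int w f x.
Proof.
move=> tf ht.
have t0 := tame_cst 0.
transitivity (line_int w (fun y => t x *: f y + 0) x).
  by apply: line_int_eq => s; rewrite ht addr0.
rewrite line_intZD// (_ : line_int w (fun=> 0) x = 0) ?addr0//.
apply/eqP; rewrite -normr_le0; apply: line_int_bound => // s _.
by rewrite normr0.
Qed.

Lemma line_int0 w (f : V -> Y) x : tame f ->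
  (forall t : R, 0 <= t <= 1 -> f (x - t *: w) = 0) -> line_int w f x = 0.
Proof.
move=> tf hf; apply/eqP; rewrite -normr_le0; apply: line_int_bound => // t t01.
by rewrite hf// normr0.
Qed.

End TameExtra.

(** * Integration in one coordinate direction after the other *)

Section Poincare.
Context {R : realType} {n : nat} {Y : completeNormedModType R}.
Local Notation V := 'rV[R]_n.
Implicit Types (f g : V -> Y) (x v : V) (j k : 'I_n).

Local Notation e_ j := (delta_mx ord0 j : V).

(* For f vanishing where |x_j| > 1, [int_left j f] and [int_right j f] are the
   integrals of f over the half-lines issued from x in the directions -e_j and
   e_j (as long as |x_j| < 2); a segment of length 3 is enough. *)
Definition int_left j f : V -> Y := fun x => 3 *: line_int (3 *: e_ j) f x.
Definition int_right j f : V -> Y := fun x => 3 *: line_int (- 3 *: e_ j) f x.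
Definition int_full j f : V -> Y := fun x => int_left j f x + int_right j f x.

(** The primitive from the left takes the value of the full integral on the right of the support.
    Subtracting the step times the full integral removes it, at the cost of the error term
    [fiber_average] in the derivative. *)
Definition fiber_primitive j f : V -> Y :=
  fun x => int_left j f x + - stepv j x *: int_full j f x.

Definition fiber_average j f : V -> Y := fun x => bump j x *: int_full j f x.

Lemma int_left_tame j f : tame f -> tame (int_left j f).
Proof. by move=> tf; apply: tameZ; exact: line_int_tame. Qed.

Lemma int_right_tame j f : tame f -> tame (int_right j f).
Proof. by move=> tf; apply: tameZ; exact: line_int_tame. Qed.

Lemma int_full_tame j f : tame f -> tame (int_full j f).
Proof. by move=> tf; apply: tameD; [exact: int_left_tame|exact: int_right_tame]. Qed.

Lemma derive_int_left j f x : tame f ->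
  'D_(e_ j) (int_left j f) x = f x - f (x - 3 *: e_ j).
Proof.
move=> tf; have sl := line_int_smooth (3 *: e_ j) tf.
rewrite /int_left deriveZ; last by apply: diff_derivable; exact: smooth_differentiable.
rewrite -deriveZv ?line_int_fundamental//; exact: smooth_differentiable.
Qed.

Lemma derive_int_right j f x : tame f ->
  'D_(e_ j) (int_right j f) x = f (x + 3 *: e_ j) - f x.
Proof.
move=> tf; have sl := line_int_smooth (- 3 *: e_ j) tf.
rewrite /int_right deriveZ; last by apply: diff_derivable; exact: smooth_differentiable.
have dl := smooth_differentiable x sl.
have -> : 3 *: 'D_(e_ j) (line_int (- 3 *: e_ j) f) x =
    - 'D_(- 3 *: e_ j) (line_int (- 3 *: e_ j) f) x.
  by move: (line_int _ f) dl => F dl; rewrite deriveZv// scaleNr opprK.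
by rewrite line_int_fundamental// opprB scaleNr opprK.
Qed.

Lemma derive_int_full j f x : tame f ->
  'D_(e_ j) (int_full j f) x = f (x + 3 *: e_ j) - f (x - 3 *: e_ j).
Proof.
move=> tf; rewrite /int_full deriveD.
- by rewrite derive_int_left// derive_int_right// addrC subrKA.
- by apply: diff_derivable; apply: smooth_differentiable; have [] := int_left_tame j tf.
- by apply: diff_derivable; apply: smooth_differentiable; have [] := int_right_tame j tf.
Qed.

Lemma derive_int_full_comm j f v x : tame f ->
  'D_v (int_full j f) x = int_full j ('D_v f) x.
Proof.
move=> tf; have dl w := line_int_derive w x v tf.
have dd w : derivable (line_int w f) x v by apply: diff_derivable; case: (dl w).
rewrite /int_full /int_left /int_right deriveD; [|exact: derivableZ|exact: derivableZ].
have [_ E1] := dl (3 *: e_ j); have [_ E2] := dl (- 3 *: e_ j).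
by rewrite !deriveZ// E1 E2.
Qed.

Lemma fiber_primitive_smooth j f : tame f -> smooth (fiber_primitive j f).
Proof.
move=> tf; apply: smoothD; first by have [] := int_left_tame j tf.
apply: smoothM; last by have [] := int_full_tame j tf.
by apply: smoothN; exact: stepv_smooth.
Qed.

Lemma fiber_average_smooth j f : tame f -> smooth (fiber_average j f).
Proof.
move=> tf; apply: smoothM; first exact: bump_smooth.
by have [] := int_full_tame j tf.
Qed.

(** Since segments of finite length replace half-lines, values of [f] at distance 3 appear; each of
    them is multiplied by a factor that vanishes where it does not. *)
Lemma derive_fiber_primitive j f x : tame f -> slab j f ->
  'D_(e_ j) (fiber_primitive j f) x + fiber_average j f x = f x.
Proof.
move=> tf sf.
have sF : smooth (int_full j f) by have [] := int_full_tame j tf.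
have sS : smooth (fun x => - stepv j x).
  by apply: smoothN; exact: stepv_smooth.
have [dS DS] := derive_scale (e_ j) (smooth_differentiable x sS) (smooth_differentiable x sF).
rewrite /fiber_primitive deriveD; last 2 first.
- by apply: diff_derivable; apply: smooth_differentiable; have [] := int_left_tame j tf.
- exact: diff_derivable.
rewrite DS derive_int_left// derive_int_full// deriveN; last first.
  by apply: diff_derivable; apply: smooth_differentiable; exact: stepv_smooth.
rewrite /fiber_average -[X in - X *: _]/(bump j x).
(* Either the step has already reached its constant value, or the shifted point lies outside the
   slab. *)
have Z1 : stepv j x *: f (x + 3 *: e_ j) = 0.
  have [x1|x1] := leP (x ord0 j) (-1); first by rewrite /stepv step0// scale0r.
  rewrite sf ?scaler0// !mxE !eqxx mulr1; apply: lt_le_trans (ler_norm _).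
  by lra.
have Z2 : (1 - stepv j x) *: f (x - 3 *: e_ j) = 0.
  have [x1|x1] := leP 1 (x ord0 j); first by rewrite /stepv step1// subrr scale0r.
  rewrite sf ?scaler0// !mxE !eqxx mulr1 -normrN; apply: lt_le_trans (ler_norm _).
  by lra.
rewrite scalerBr !scaleNr Z1 oppr0 add0r opprK.
move: Z2; rewrite scalerBl scale1r => /eqP; rewrite subr_eq0 => /eqP <-.
by rewrite [LHS](AC (2*2*1)%AC (1*(2*4)*(3*5))%AC)/= !addNr !addr0.
Qed.

Lemma int_full_slab j k f : k != j -> tame f -> slab k f -> slab k (int_full j f).
Proof.
move=> kj tf sf x xk.
rewrite /int_full /int_left /int_right !line_int0 ?scaler0 ?addr0//.
all: by move=> t _; apply: sf; rewrite !mxE (negbTE kj) !mulr0 subr0.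
Qed.

Lemma fiber_average_slab j k f : tame f -> slab k f -> slab k (fiber_average j f).
Proof.
move=> tf sf x xk; rewrite /fiber_average.
have [kj|kj] := eqVneq k j; first by rewrite bump_supp ?scale0r// -kj.
by rewrite (int_full_slab kj tf sf)// scaler0.
Qed.

(** In the direction of integration, the step is 1 on the right, leaving minus the integral to the
    right, and 0 on the left, leaving the integral from the left; both vanish. In other directions
    the segment stays where [f] is 0. *)
Lemma fiber_primitive_slab j k f : tame f -> slab k f -> slab k (fiber_primitive j f).
Proof.
move=> tf sf x xk; rewrite /fiber_primitive.
have [kj|kj] := eqVneq k j; last first.
  rewrite (int_full_slab kj tf sf)// scaler0 addr0 /int_left line_int0 ?scaler0//.
  by move=> t _; apply: sf; rewrite !mxE (negbTE kj) !mulr0 subr0.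
subst k; have [x0|x0] := ltP 0 (x ord0 j).
  move: xk; rewrite gtr0_norm// => xk.
  rewrite /stepv step1 ?(ltW xk)// scaleN1r opprD addrA subrr add0r.
  rewrite /int_right line_int0 ?scaler0 ?oppr0// => t /andP[t0 t1]; apply: sf.
  rewrite !mxE !eqxx !mulr1; apply: lt_le_trans (ler_norm _).
  by rewrite mulrN opprK (lt_le_trans xk)// lerDl mulr_ge0.
move: xk; rewrite ler0_norm// => xk.
rewrite /stepv step0 ?oppr0 ?scale0r ?addr0; last lra.
rewrite /int_left line_int0 ?scaler0// => t /andP[t0 t1]; apply: sf.
rewrite !mxE !eqxx !mulr1 -normrN; apply: lt_le_trans (ler_norm _).
by rewrite opprB (lt_le_trans xk)// addrC lerDl mulr_ge0.
Qed.

Lemma int_left_bnd j f m B : tame f -> (forall x, bnd m B f x) ->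
  forall x, bnd m (3 * B) (int_left j f) x.
Proof.
move=> tf hB x; have := bndZ 3 (line_int_smooth (3 *: e_ j) tf)
  (line_int_bnd tf (fun t _ => hB (x - t *: (3 *: e_ j)))).
by rewrite gtr0_norm.
Qed.

Lemma int_right_bnd j f m B : tame f -> (forall x, bnd m B f x) ->
  forall x, bnd m (3 * B) (int_right j f) x.
Proof.
move=> tf hB x; have := bndZ 3 (line_int_smooth (- 3 *: e_ j) tf)
  (line_int_bnd tf (fun t _ => hB (x - t *: (- 3 *: e_ j)))).
by rewrite gtr0_norm.
Qed.

Lemma int_full_bnd j f m B : tame f -> (forall x, bnd m B f x) ->
  forall x, bnd m (6 * B) (int_full j f) x.
Proof.
move=> tf hB x.
have -> : 6 * B = 3 * B + 3 * B by ring.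
apply: bndD; [by have [] := int_left_tame j tf|by have [] := int_right_tame j tf|..].
  exact: int_left_bnd.
exact: int_right_bnd.
Qed.

Lemma fiber_bnd m : exists2 C : R, 1 <= C & forall j f B, smooth f ->
  vanishes_beyond 1 f -> (forall x, bnd m B f x) ->
  (forall x, bnd m (C * B) (fiber_primitive j f) x) /\
  (forall x, bnd m (C * B) (fiber_average j f) x).
Proof.
have /choice[A hA] : forall j, exists A : R, 0 < A /\ forall x : V, `|x| <= 1 ->
    bnd m A (fun x => - stepv j x) x /\ bnd m A (bump j) x.
  move=> j; have sS : smooth (fun x => - stepv j x).
    by apply: smoothN; exact: stepv_smooth.
  have [A A0 hA] := smooth_bnd_compact m (@compact_cube R n 1) sS.
  have [B B0 hB] := smooth_bnd_compact m (@compact_cube R n 1) (bump_smooth j).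
  exists (A + B); split; first by rewrite addr_gt0.
  move=> x x1; split; [apply: bnd_le (hA _ x1)|apply: bnd_le (hB _ x1)] => //.
    by rewrite lerDl ltW.
  by rewrite lerDr ltW.
have hA0 := hA.
have SA0 : 0 <= \sum_j A j by rewrite sumr_ge0// => j _; case: (hA j) => /ltW.
(* The length 3 of the segments, the length 6 of two of them, the Leibniz factor 2^m, and bounds for
   the step and the bump on the unit cube, outside of which the results vanish. *)
exists (3 + 2 ^+ m * ((\sum_j A j) * 6)).
  by rewrite ler_wpDr ?ler1n// !mulr_ge0 ?exprn_ge0.
move=> j f B sf vf hB.
have B0 : 0 <= B by apply: le_trans (bnd0 (hB 0)).
have tf := smooth_vanishes_tame sf vf.
have slf := (vanishes_slab f).1 vf.
have [Aj0 {}hA] := hA j.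
have AS : A j * 6 <= (\sum_j A j) * 6.
  rewrite ler_wpM2r// (bigD1 j)//= lerDl sumr_ge0// => k _.
  by case: (hA0 k) => /ltW.
have S0 : 0 <= 2 ^+ m * (A j * (6 * B)) by rewrite !mulr_ge0 ?exprn_ge0// ltW.
have SB : 2 ^+ m * (A j * (6 * B)) <= 2 ^+ m * ((\sum_j A j) * 6) * B.
  by rewrite -!mulrA ler_wpM2l ?exprn_ge0// !mulrA ler_wpM2r.
have sJ : smooth (int_full j f) by have [] := int_full_tame j tf.
have C0 : 0 <= (3 + 2 ^+ m * ((\sum_j A j) * 6)) * B.
  by rewrite mulr_ge0// addr_ge0// mulr_ge0 ?exprn_ge0// mulr_ge0.
split; apply: (@bnd_everywhere _ _ _ 1) => //.
- by apply/vanishes_slab => k; exact: fiber_primitive_slab.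
- move=> x x1; rewrite mulrDl; apply: bnd_le (leqnn m) _ _; last first.
    apply: bndD; [by have [] := int_left_tame j tf| |exact: int_left_bnd|].
      by apply: smoothM => //; apply: smoothN; exact: stepv_smooth.
    apply: (bndM _ sJ (hA x x1).1); last exact: int_full_bnd.
    by apply: smoothN; exact: stepv_smooth.
  by rewrite lerD2l.
- by apply/vanishes_slab => k; exact: fiber_average_slab.
- move=> x x1; apply: bnd_le (leqnn m) _ _; last first.
    apply: (bndM (bump_smooth j) sJ (hA x x1).2); exact: int_full_bnd.
  by rewrite (le_trans SB)// ler_wpM2r// lerDr.
Qed.

Fixpoint averages (s : seq 'I_n) f : V -> Y :=
  if s is j :: s' then fiber_average j (averages s' f) else f.

Fixpoint integrals (s : seq 'I_n) f : V -> Y :=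
  if s is j :: s' then int_full j (integrals s' f) else f.

Definition bumps (s : seq 'I_n) (x : V) : R := \prod_(j <- s) bump j x.

Lemma bumps_cons j s x : bumps (j :: s) x = bump j x * bumps s x.
Proof. by rewrite /bumps big_cons. Qed.

Lemma bumps_smooth s : smooth (bumps s).
Proof.
elim: s => [|j s IH].
  by rewrite (_ : bumps [::] = fun=> 1) ?(funext (fun x => big_nil _ _ _ _))//;
     [exact: smooth_cst|apply/funext => x; rewrite /bumps big_nil].
rewrite (_ : bumps (j :: s) = fun x => bump j x *: bumps s x).
  by apply: smoothM => //; exact: bump_smooth.
by apply/funext => x; rewrite /bumps big_cons.
Qed.

Lemma averages_smooth s f : smooth f -> vanishes_beyond 1 f ->
  smooth (averages s f) /\ vanishes_beyond 1 (averages s f).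
Proof.
move=> sf vf; elim: s => [|j s [sI vI]] //=.
have tI := smooth_vanishes_tame sI vI; split; first exact: fiber_average_smooth.
apply/vanishes_slab => k; apply: fiber_average_slab => //.
exact: (vanishes_slab _).1.
Qed.

Lemma integrals_tame s f : tame f -> tame (integrals s f).
Proof. by move=> tf; elim: s => //= j s IH; exact: int_full_tame. Qed.

Lemma int_full_eq j f g x : (forall t : R, f (x + t *: e_ j) = g (x + t *: e_ j)) ->
  int_full j f x = int_full j g x.
Proof.
move=> fg; rewrite /int_full /int_left /int_right; congr (_ *: _ + _ *: _).
  by apply: line_int_eq => t; rewrite -scaleNr scalerA.
by apply: line_int_eq => t; rewrite -scaleNr scalerA.
Qed.

Lemma int_full_scale j (t : V -> R) f x : tame f ->
  (forall s : R, t (x + s *: e_ j) = t x) ->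
  int_full j (fun y => t y *: f y) x = t x *: int_full j f x.
Proof.
move=> tf ht; rewrite /int_full /int_left /int_right !line_int_scale//.
- by rewrite scalerDr !scalerA ![t x * _]mulrC.
- by move=> s; rewrite -scaleNr scalerA.
- by move=> s; rewrite -scaleNr scalerA.
Qed.

Lemma bumps_shift s j x (t : R) : j \notin s -> bumps s (x + t *: e_ j) = bumps s x.
Proof.
elim: s => [|k s IH]; first by rewrite /bumps !big_nil.
rewrite inE negb_or => /andP[jk js]; rewrite !bumps_cons (IH js) bump_shift//.
by rewrite !mxE eqxx /= eq_sym (negbTE jk) mulr0.
Qed.

(** The bumps of the directions in [s] are constant along a further direction [j], hence leave the
    integral in that direction as a factor. *)
Lemma averages_integrals s f x : uniq s -> tame f ->
  averages s f x = bumps s x *: integrals s f x.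
Proof.
move=> us tf; elim: s us x => [|j s IH] us x; first by rewrite /bumps big_nil scale1r.
move: us => /= /andP[js us]; rewrite bumps_cons -scalerA /fiber_average.
rewrite -(int_full_scale (integrals_tame s tf) (fun t => bumps_shift x t js)).
by congr (_ *: _); apply: int_full_eq => t; exact: IH.
Qed.

Lemma integrals_slab s k f : tame f -> slab k f -> k \notin s -> slab k (integrals s f).
Proof.
move=> tf sf; elim: s => //= j s IH; rewrite inE negb_or => /andP[kj ks].
by apply: int_full_slab => //; [exact: integrals_tame|exact: IH].
Qed.

(** In the direction integrated last, the derivative is a difference of values at distance 3, both
    outside the slab; an earlier direction is reached by commuting the derivative with the
    integral. *)
Lemma derive_integrals s k f x : uniq s -> tame f -> (forall j, slab j f) ->
  k \in s -> `|x ord0 k| <= 1 -> 'D_(e_ k) (integrals s f) x = 0.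
Proof.
move=> us tf sf; elim: s us x => //= j s IH /andP[js us] x.
have tI := integrals_tame s tf.
have [kE _|kj] := eqVneq k j.
  subst k.
  rewrite ler_norml => /andP[x0 x1]; have sl := integrals_slab tf (sf j) js.
  rewrite derive_int_full// !sl ?subrr// !mxE !eqxx mulr1.
    by rewrite -normrN; apply: lt_le_trans (ler_norm _); lra.
  by apply: lt_le_trans (ler_norm _); lra.
rewrite inE (negbTE kj)/= => ks xk; rewrite derive_int_full_comm//.
rewrite /int_full /int_left /int_right !line_int0 ?scaler0 ?addr0//.
all: try exact: tame_derive.
all: move=> t _; apply: IH => //; rewrite !mxE eqxx (negbTE kj) !mulr0 subr0//.
Qed.

Definition bump_prod : V -> R := bumps (enum 'I_n).

(** On the unit cube the iterated integral has vanishing gradient and equals its value at 0; outside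
    the product of bumps is zero. Thus [integrals] at 0 plays the role of the integral of [f] over
    space. *)
Lemma averages_const f x : smooth f -> vanishes_beyond 1 f ->
  averages (enum 'I_n) f x = bump_prod x *: integrals (enum 'I_n) f 0.
Proof.
move=> sf vf; have tf := smooth_vanishes_tame sf vf.
have slf := (vanishes_slab f).1 vf; set s := enum _.
have us : uniq s by exact: enum_uniq.
rewrite averages_integrals// -/bump_prod.
have tI := integrals_tame s tf; set G := integrals s f in tI *.
have sG : smooth G by case: tI.
have [x1|x1] := leP `|x| 1; last first.
  have : vanishes_beyond 1 bump_prod.
    apply/vanishes_slab => j y yj; rewrite /bump_prod /bumps (bigD1_seq j)/= ?mem_enum//.
    by rewrite bump_supp// mul0r.
  by move=> /(_ x x1) ->; rewrite !scale0r.
congr (_ *: _); apply/eqP; rewrite -subr_eq0 -normr_le0.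
have := @mean_value_ineq R Y V G 0 x 0 0; rewrite add0r subr0; apply => t /andP[t0 t1].
  exact: smooth_differentiable.
rewrite add0r subr0 normr_le0 derive_coord; last exact: smooth_differentiable.
apply/eqP/big1 => k _; rewrite derive_integrals ?scaler0 ?mem_enum//.
rewrite mxE normrM ger0_norm// -[leRHS]mul1r ler_pM//.
by rewrite (le_trans (coord_le_norm _ _)).
Qed.

(** Each new direction splits the average left by the previous ones into a derivative and a further
    average. The potentials depend on [f] alone and the bounds hold for every admissible [B], so the
    decomposition is bounded linearly. *)
Lemma poincare_partial m s : uniq s -> exists2 C : R, 1 <= C &
  forall f, smooth f -> vanishes_beyond 1 f ->
  exists psi : 'I_n -> V -> Y,
  [/\ forall j, smooth (psi j) /\ vanishes_beyond 1 (psi j),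
      forall x, f x = \sum_(j <- s) 'D_(e_ j) (psi j) x + averages s f x &
      forall B, (forall x, bnd m B f x) ->
        (forall j x, bnd m (C * B) (psi j) x) /\
        forall x, bnd m (C * B) (averages s f) x].
Proof.
elim: s => [_|j s IH /= /andP[js /IH[C C1 HC]]].
  exists 1 => // f sf vf; exists (fun _ _ => 0); split.
  - by move=> j; split => //; exact: smooth_cst.
  - by move=> x; rewrite big_nil add0r.
  move=> B hB; rewrite mul1r; split=> // j x vs _ _.
  have B0 : 0 <= B by apply: le_trans (bnd0 (hB x)).
  suff -> : iter_derive vs (fun _ : V => 0 : Y) = fun=> 0 by rewrite normr0.
  by elim: vs => //= v vs ->; apply/funext => z; rewrite derive_cst.
have [D D1 HD] := fiber_bnd m.
have CD : C <= D * C by rewrite ler_peMl// (le_trans ler01).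
exists (D * C); first by rewrite (le_trans C1).
move=> f sf vf; have [psi [h1 h2 h3]] := HC f sf vf.
have [sA vA] := averages_smooth s sf vf; have tA := smooth_vanishes_tame sA vA.
have slA := (vanishes_slab _).1 vA.
exists (fun k => if k == j then fiber_primitive j (averages s f) else psi k); split.
- move=> k; case: ifP => // _; split; first exact: fiber_primitive_smooth.
  by apply/vanishes_slab => i; exact: fiber_primitive_slab.
- move=> x; rewrite big_cons eqxx addrAC derive_fiber_primitive// h2 addrC.
  congr (_ + _); apply: eq_big_seq => k ks; rewrite ifN//.
  by apply: contraNneq js => <-.
move=> B hB; have [h4 h5] := h3 B hB; have [h6 h7] := HD j _ _ sA vA h5.
have B0 : 0 <= B by apply: le_trans (bnd0 (hB 0)).
split; last by move=> x; rewrite -mulrA.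
move=> k x; case: ifP => _; first by rewrite -mulrA.
by apply: bnd_le (h4 k x) => //; rewrite ler_wpM2r.
Qed.

Lemma integrals_bound s f B : tame f -> (forall x, `|f x| <= B) ->
  forall x, `|integrals s f x| <= 6 ^+ size s * B.
Proof.
move=> tf hB.
suff : forall x, bnd 0 (6 ^+ size s * B) (integrals s f) x by move=> h x; exact: bnd0 (h x).
elim: s => [x|j s IH x /=]; first by case=> // _ _; rewrite expr0 mul1r.
by rewrite exprS -mulrA; apply: int_full_bnd => //; exact: integrals_tame.
Qed.

Lemma poincare_fun m : exists2 C : R, 1 <= C &
  forall f, smooth f -> vanishes_beyond 1 f ->
  exists psi : 'I_n -> V -> Y,
  [/\ forall j, smooth (psi j) /\ vanishes_beyond 1 (psi j),
      forall x, f x = \sum_j 'D_(e_ j) (psi j) x +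
        bump_prod x *: integrals (enum 'I_n) f 0 &
      forall B, (forall x, bnd m B f x) ->
        (forall j x, bnd m (C * B) (psi j) x) /\
        `|integrals (enum 'I_n) f 0| <= C * B].
Proof.
have [C C1 HC] := poincare_partial m (enum_uniq 'I_n).
exists (C + 6 ^+ size (enum 'I_n)); first by rewrite ler_wpDr// exprn_ge0.
move=> f sf vf; have [psi [h1 h2 h3]] := HC f sf vf.
exists psi; split=> //.
  by move=> x; rewrite {1}h2 big_enum averages_const.
move=> B hB; have [h4 _] := h3 B hB.
have B0 : 0 <= B by apply: le_trans (bnd0 (hB 0)).
split.
  by move=> j x; apply: bnd_le (h4 j x) => //; rewrite ler_wpM2r// lerDl exprn_ge0.
rewrite (@le_trans _ _ (6 ^+ size (enum 'I_n) * B))//.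
  apply: integrals_bound; first exact: smooth_vanishes_tame vf.
  by move=> x; exact: bnd0 (hB x).
by rewrite ler_wpM2r// lerDr (le_trans ler01).
Qed.

Lemma derive_stepv j x v : 'D_v (stepv j) x = v ord0 j * bump j x.
Proof.
have dst := smooth_differentiable x (stepv_smooth j).
suff D0 k : k != j -> 'D_(e_ k) (stepv j) x = 0.
  rewrite (derive_coord v dst) (bigD1 j)//= [X in _ + X]big1 ?addr0// => k kj.
  by rewrite D0// scaler0.
move=> kj.
have := is_derive_line (x := x) (v := e_ k) (t := 0) (f := stepv j).
rewrite scale0r addr0 => /(_ dst)[_ <-].
have -> : (fun t : R => stepv j (x + t *: e_ k)) = cst (stepv j x).
  by apply/funext => t; rewrite stepv_shift// !mxE eqxx eq_sym (negbTE kj) mulr0.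
by rewrite derive_cst.
Qed.

Lemma derive_dilated_step (lam : R) j (w : Y) x v :
  differentiable (fun y => stepv j (lam *: y) *: w) x /\
  'D_v (fun y => stepv j (lam *: y) *: w) x = (lam * v ord0 j * bump j (lam *: x)) *: w.
Proof.
have sl : smooth (fun y => stepv j (lam *: y)).
  have := smooth_affine lam 0 (stepv_smooth j).
  by under eq_fun do rewrite addr0.
have [dS ->] := derive_scale v (smooth_differentiable x sl) (differentiable_cst w x).
split=> //; rewrite derive_cst scaler0 addr0; congr (_ *: _).
have := congr1 (fun F => F x) (iter_derive_affine lam 0 (stepv j) [:: v]).
rewrite /= addr0.
have -> : (fun y => stepv j (lam *: y + 0)) = (fun y => stepv j (lam *: y)).
  by apply/funext => y; rewrite addr0.
by move=> ->; rewrite derive_stepv mxE.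
Qed.

(** A primitive of a bump dilated by lam is the dilated step divided by lam. *)
Lemma line_int_bump (lam c : R) j (g : V -> Y) (w : Y) x : lam != 0 -> c != 0 -> tame g ->
  (forall t : R, g (x + t *: e_ j) = bump j (lam *: (x + t *: e_ j)) *: w) ->
  c *: line_int (c *: e_ j) g x =
  (lam^-1 * (stepv j (lam *: x) - stepv j (lam *: (x - c *: e_ j)))) *: w.
Proof.
move=> lam0 c0 tg hg; pose F y := stepv j (lam *: y) *: w.
have -> : line_int (c *: e_ j) g x = (- (c * lam)^-1) *: F (x + 1 *: (- c *: e_ j)) -
    (- (c * lam)^-1) *: F (x + 0 *: (- c *: e_ j)).
  pose u t := (- (c * lam)^-1) *: F (x + t *: (- c *: e_ j)).
  rewrite -[RHS]/(u 1 - u 0).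
  apply: dyadic_int_derive; last exact: tame_lip01.
  move=> t _; have [dF DF] := derive_dilated_step lam j w (x + t *: (- c *: e_ j)) (- c *: e_ j).
  have := is_deriveZ (- (c * lam)^-1) (is_derive_line dF).
  move/is_derive_eq; apply; rewrite DF.
  have -> : x - t *: (c *: e_ j) = x + (- (t * c)) *: e_ j.
    by rewrite scalerA scaleNr.
  rewrite hg scalerA !mxE !eqxx mulr1.
  have -> : t *: (- c *: e_ j) = (- (t * c)) *: e_ j by rewrite scalerA mulrN.
  by congr (_ *: _); field; rewrite c0 lam0.
rewrite /F scale1r scale0r addr0 !scaleNr !opprK scalerDr !scalerN !scalerA.
rewrite mulrBr scalerBl addrC; congr (_ *: _ - _ *: _).
  by field; rewrite c0 lam0.
by field; rewrite c0 lam0.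
Qed.

(** As lam >= 1 and x_j lies in [-1,1], the ends x_j - 3 and x_j + 3 are dilated to points where the
    step is 0 and 1. *)
Lemma int_full_bump (lam : R) j (g : V -> Y) (w : Y) x : 1 <= lam -> tame g ->
  `|x ord0 j| <= 1 ->
  (forall t : R, g (x + t *: e_ j) = bump j (lam *: (x + t *: e_ j)) *: w) ->
  int_full j g x = lam^-1 *: w.
Proof.
move=> lam1 tg; rewrite ler_norml => /andP[x0 x1] hg.
have lam0 : lam != 0 by rewrite gt_eqF// (lt_le_trans ltr01).
have n3 : (- 3 : R) != 0 by rewrite oppr_eq0 pnatr_eq0.
have E2 := @line_int_bump lam (- 3) j g w x lam0 n3 tg hg.
rewrite /int_full /int_left /int_right (@line_int_bump lam 3 j g w x)//.
have -> : 3 *: line_int (- 3 *: e_ j) g x = - (- 3 *: line_int (- 3 *: e_ j) g x).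
  by move: (line_int _ g x) => z; rewrite scaleNr opprK.
rewrite E2 -scalerBl; congr (_ *: _).
rewrite /stepv !mxE !eqxx !mulr1 (@step0 _ (lam * (x ord0 j - 3))); last first.
  by nra.
rewrite (@step1 _ (lam * (x ord0 j - - 3))); last by nra.
by ring.
Qed.

(** Every direction in [s] contributes a factor 1/lam and uses up its bump; [s'] lists the
    directions still to be integrated. *)
Lemma integrals_dilated_bump (lam : R) s s' (y : Y) : 1 <= lam -> uniq (s ++ s') ->
  perm_eq (s ++ s') (enum 'I_n) ->
  tame (fun x => bump_prod (lam *: x) *: y) ->
  forall x, (forall j, j \in s -> `|x ord0 j| <= 1) ->
  integrals s (fun x => bump_prod (lam *: x) *: y) x =
  (lam ^- size s * bumps s' (lam *: x)) *: y.
Proof.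
move=> lam1 us ps tf; elim: s s' us ps => [|j s IH] s' us ps x hx.
  by rewrite expr0 invr1 mul1r /bump_prod /bumps (perm_big _ ps).
have pj : perm_eq (s ++ j :: s') (j :: s ++ s') by rewrite perm_catC /= perm_cons perm_catC.
have js' : j \notin s' by move: us => /= /andP[]; rewrite mem_cat negb_or => /andP[].
have js : j \notin s by move: us => /= /andP[]; rewrite mem_cat negb_or => /andP[].
rewrite /= (@int_full_bump lam _ _ ((lam ^- size s * bumps s' (lam *: x)) *: y))//.
- by rewrite scalerA mulrA exprS invfM.
- exact: integrals_tame.
- by apply: hx; rewrite inE eqxx.
move=> t; rewrite (IH (j :: s')) ?(perm_uniq pj) ?(perm_trans pj)//; last first.
  move=> k ks; rewrite !mxE eqxx (_ : (k == j) = false) ?mulr0 ?addr0.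
    by apply: hx; rewrite inE ks orbT.
  by apply: contraNF js => /eqP <-.
rewrite bumps_cons scalerDr scalerA bumps_shift// scalerA; congr (_ *: _).
by ring.
Qed.

End Poincare.

(** * Test functions *)

Section TestFunctionTools.
Context {R : realType} {n : nat} {Y : completeNormedModType R}.
Local Notation V := 'rV[R]_n.
Local Notation e_ j := (delta_mx ord0 j : V).
Implicit Types (phi psi : testfun n Y) (x v a : V) (y : Y) (r lam : R).

Lemma testfun_intro (f : V -> Y) rho : smooth f -> vanishes_beyond rho f ->
  testfun_pred f.
Proof.
move=> sf hf; apply/asboolP; split=> //.
apply: (subclosed_compact _ (@compact_cube R n rho)); first exact: closed_closure.
have cl : closed [set x : V | `|x| <= rho].
  by apply: compact_closed; [exact: norm_hausdorff|exact: compact_cube].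
rewrite [X in _ `<=` X](closure_id _).1//; apply: closureS => x /= fx.
by rewrite leNgt; apply: contra fx => /hf ->.
Qed.

Lemma testfun_smooth phi : smooth phi.
Proof. by have [] := testfunP phi. Qed.

Lemma testfun_differentiable phi x : differentiable phi x.
Proof. exact/smooth_differentiable/testfun_smooth. Qed.

Lemma vanishes_spt rho (f : V -> Y) : spt f `<=` [set x | `|x| <= rho] ->
  vanishes_beyond rho f.
Proof.
move=> hs x rx; apply/eqP/negPn/negP => fx.
have /hs /= : spt f x by exact: subset_closure.
by rewrite leNgt rx.
Qed.

Lemma testfun_vanishes phi : exists2 rho : R, 0 < rho & vanishes_beyond rho phi.
Proof.
have [_ /compact_bounded[M [_ hM]]] := testfunP phi.
exists (`|M| + 1); first by rewrite ltr_wpDl.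
by apply: vanishes_spt => x /= xs; apply: hM => //; rewrite (le_lt_trans (ler_norm _))// ltrDl.
Qed.

Lemma testfun_tame phi : tame phi.
Proof.
by have [rho _ /(smooth_vanishes_tame (testfun_smooth phi))] := testfun_vanishes phi.
Qed.

Definition mi1 (j : 'I_n) : multiindex n := [ffun k => (k == j) : nat].

Lemma basis_dirs_mi1 j : basis_dirs (mi1 j) = [:: e_ j].
Proof.
have h : perm_eq (basis_dirs (mi1 j)) [:: e_ j].
  have -> : basis_dirs (mi1 j) = [seq e_ k | k <- enum 'I_n & k == j].
    rewrite /basis_dirs; elim: (enum 'I_n) => //= k s ->; rewrite ffunE.
    by case: (k == j).
  have -> : [seq k <- enum 'I_n | k == j] = [:: j].
    have := filter_pred1_uniq (enum_uniq 'I_n) (mem_enum 'I_n j).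
    exact.
  by [].
by apply: perm_small_eq h.
Qed.

Lemma mdeg_mi1 j : mdeg (mi1 j) = 1%N.
Proof. by rewrite -(@size_basis_dirs R) basis_dirs_mi1. Qed.

Lemma partial_mi1 (f : V -> Y) j : partial (mi1 j) f = 'D_(e_ j) f.
Proof. by rewrite /partial basis_dirs_mi1. Qed.

Definition dtest j phi : testfun n Y := partial_testfun (mi1 j) phi.

Lemma dtestE j phi : dtest j phi = 'D_(e_ j) phi :> (V -> Y).
Proof. exact: partial_mi1. Qed.

Lemma bump_prod_smooth : smooth (bump_prod : V -> R).
Proof. exact: bumps_smooth. Qed.

Lemma bump_prod_vanishes : vanishes_beyond 1 (bump_prod : V -> R).
Proof.
apply/vanishes_slab => j y yj; rewrite /bump_prod /bumps (bigD1_seq j)/= ?mem_enum ?enum_uniq//.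
by rewrite bump_supp// mul0r.
Qed.

Lemma bump_test_subproof y : testfun_pred (fun x : V => bump_prod x *: y).
Proof.
apply: (@testfun_intro _ 1); last by move=> x /bump_prod_vanishes ->; rewrite scale0r.
by apply: smoothM; [exact: bump_prod_smooth|exact: smooth_cst].
Qed.

Definition bump_test y : testfun n Y := TestFun (bump_test_subproof y).

Lemma testfunZDE (c : R) phi psi x : (c *: phi + psi) x = c *: phi x + psi x.
Proof. by []. Qed.

Lemma testfun_sumE (I : Type) (s : seq I) (F : I -> testfun n Y) x :
  (\sum_(i <- s) F i) x = \sum_(i <- s) F i x.
Proof.
by elim: s => [|i s IH]; [rewrite !big_nil|rewrite !big_cons -IH].
Qed.

Lemma testfun_eq phi psi : (forall x, phi x = psi x) -> phi = psi.
Proof. by move=> h; apply/val_inj/funext. Qed.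

Lemma bump_test_linear : linear bump_test.
Proof.
move=> c y z; apply: testfun_eq => x; rewrite testfunZDE /=.
by rewrite scalerDr !scalerA mulrC.
Qed.

Lemma rescaleEx a r phi x : r != 0 -> rescale a r phi x = phi (r^-1 *: (x - a)).
Proof. by move=> r0; exact: (congr1 (fun f => f x) (rescaleE a phi r0)). Qed.

Lemma testfunZE (c : R) phi x : (c *: phi) x = c *: phi x.
Proof. by []. Qed.

Lemma rescale_linear a r : r != 0 -> linear (rescale a r : testfun n Y -> _).
Proof.
by move=> r0 c phi psi; apply: testfun_eq => x; rewrite testfunZDE !(rescaleEx _ _ _ r0).
Qed.

(** This factor [r] is the source of the gain of one order when derivatives of a distribution are
    replaced by the distribution itself. *)
Lemma dtest_rescale a r j phi : r != 0 ->
  rescale a r (dtest j phi) = r *: dtest j (rescale a r phi).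
Proof.
move=> r0; apply: testfun_eq => x.
rewrite testfunZE (rescaleEx _ _ _ r0) !dtestE.
rewrite (_ : testfun_val (rescale a r phi) = fun x => phi (r^-1 *: (x - a))); last first.
  exact: rescaleE.
have := congr1 (fun F => F x) (iter_derive_rescale a r phi [:: e_ j]).
move=> /= ->; rewrite deriveZv ?scalerA ?divff ?scale1r//.
exact: testfun_differentiable.
Qed.

Lemma rescale_comp a r lam phi : r != 0 -> lam != 0 ->
  rescale a r (rescale 0 lam phi) = rescale a (r * lam) phi.
Proof.
move=> r0 l0; apply: testfun_eq => x; rewrite !rescaleEx ?mulf_neq0//.
by rewrite subr0 scalerA invfM mulrC.
Qed.

Lemma rescale0_vanishes lam rho phi : 0 < lam -> vanishes_beyond rho phi ->
  vanishes_beyond (lam * rho) (rescale 0 lam phi).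
Proof.
move=> l0 hphi x hx; rewrite rescaleEx ?gt_eqF// subr0; apply: hphi.
by rewrite normrZ gtr0_norm ?invr_gt0// ltr_pdivlMl.
Qed.

(** A derivative of order k is multiplied by lam^-k; the constant dominates these factors for all k
    <= m, whether lam is large or small. *)
Lemma rescale0_bnd lam m B phi : 0 < lam -> (forall x, bnd m B phi x) ->
  forall x, bnd m ((1 + lam^-1) ^+ m * B) (rescale 0 lam phi) x.
Proof.
move=> l0 hB x vs sz hvs.
have B0 : 0 <= B by apply: le_trans (bnd0 (hB 0)).
have l1 : 0 <= lam^-1 by rewrite invr_ge0 ltW.
rewrite (_ : testfun_val _ = fun x => phi (lam^-1 *: (x - 0))); last first.
  by apply: rescaleE; rewrite gt_eqF.
rewrite iter_derive_rescale iter_derive_mapZ; last exact: testfun_smooth.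
rewrite normrZ ler_pM//; last by apply: hB.
rewrite normrX ger0_norm// (@le_trans _ _ ((1 + lam^-1) ^+ size vs))//.
  by rewrite lerXn2r ?nnegrE ?addr_ge0// lerDr.
by rewrite ler_weXn2l// lerDl.
Qed.

Lemma poincare m : exists2 C : R, 1 <= C &
  forall phi, vanishes_beyond 1 phi -> exists (psi : 'I_n -> testfun n Y),
  [/\ forall j, vanishes_beyond 1 (psi j),
      phi = \sum_j dtest j (psi j) + bump_test (integrals (enum 'I_n) phi 0) &
      forall B, (forall x, bnd m B phi x) ->
        (forall j x, bnd m (C * B) (psi j) x) /\
        `|integrals (enum 'I_n) phi 0| <= C * B].
Proof.
have [C C1 HC] := @poincare_fun R n Y m; exists C => // phi vphi.
have [psi [h1 h2 h3]] := HC _ (testfun_smooth phi) vphi.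
have tpsi j : testfun_pred (psi j) by apply: (@testfun_intro _ 1); case: (h1 j).
exists (fun j => TestFun (tpsi j)); split=> //; first by move=> j; case: (h1 j).
apply: testfun_eq => x; rewrite h2.
rewrite -[in RHS](scale1r (\sum_j _)) testfunZDE scale1r testfun_sumE; congr (_ + _).
by apply: eq_bigr => j _; rewrite dtestE.
Qed.

Lemma bnd_cst m y x : bnd m `|y| (fun _ : V => y) x.
Proof.
move=> vs _ _; case/lastP: vs => [|vs v]//.
rewrite iter_derive_rcons (_ : 'D_v _ = 0); last by apply/funext => z; rewrite derive_cst.
suff -> : iter_derive vs (0 : V -> Y) = 0 by rewrite normr0.
by elim: vs => //= w vs ->; apply/funext => z; rewrite derive_cst.
Qed.

Lemma bump_test_bnd m : exists2 C : R, 0 < C & forall y x, bnd m (C * `|y|) (bump_test y) x.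
Proof.
have [A A0 hA] := smooth_vanishes_bnd m bump_prod_smooth bump_prod_vanishes.
exists (2 ^+ m * A); first by rewrite mulr_gt0 ?exprn_gt0.
move=> y x; rewrite -mulrA; apply: bndM => //; last exact: bnd_cst.
- exact: bump_prod_smooth.
- exact: smooth_cst.
Qed.

(** The decomposition of the shrunken bump: its iterated integral is lam^-n times [y], hence its
    bump part is known exactly and the rest is a divergence. *)
Lemma dilation_identity m lam : 1 <= lam -> exists2 C : R, 0 < C &
  forall y, exists psi : 'I_n -> testfun n Y,
  [/\ forall j, vanishes_beyond 1 (psi j),
      rescale 0 lam^-1 (bump_test y) =
        \sum_j dtest j (psi j) + lam ^- n *: bump_test y &
      forall j x, bnd m (C * `|y|) (psi j) x].
Proof.
move=> lam1; have l0 : 0 < lam by rewrite (lt_le_trans ltr01).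
have li0 : 0 < lam^-1 by rewrite invr_gt0.
have lin0 : lam^-1 != 0 by rewrite gt_eqF.
have [A A0 hA] := bump_test_bnd m; have [C C1 HC] := poincare m.
exists (C * ((1 + lam) ^+ m * A)).
  by rewrite !mulr_gt0// ?exprn_gt0 ?addr_gt0// (lt_le_trans ltr01).
move=> y; set phi := rescale 0 lam^-1 (bump_test y).
have phiE x : phi x = bump_prod (lam *: x) *: y.
  by rewrite /phi (rescaleEx _ _ _ lin0) subr0 invrK.
have vphi : vanishes_beyond 1 phi.
  have := rescale0_vanishes li0 (_ : vanishes_beyond 1 (bump_test y)).
  rewrite mulr1 => H x x1; apply: H.
    by move=> z z1; rewrite /= bump_prod_vanishes// scale0r.
  by rewrite (le_lt_trans _ x1)// invf_le1.
have [psi [h1 h2 h3]] := HC phi vphi; exists psi; split=> //.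
  rewrite {1}h2; congr (_ + _).
  have := @integrals_dilated_bump R n Y lam (enum 'I_n) [::] y lam1.
  rewrite cats0 enum_uniq => /(_ isT (perm_refl _)).
  have Ephi : (fun x => bump_prod (lam *: x) *: y) = phi by apply/funext => x; rewrite phiE.
  rewrite Ephi => /(_ (testfun_tame _) 0) ->; last first.
    by move=> j _; rewrite mxE normr0.
  rewrite size_enum_ord /bumps big_nil mulr1.
  have := bump_test_linear (lam ^- n) y 0.
  have b0 : bump_test 0 = 0 by apply: testfun_eq => x; rewrite /= scaler0.
  by rewrite b0 !addr0.
have [x|h4 _] := h3 ((1 + lam) ^+ m * (A * `|y|)).
  by have := rescale0_bnd li0 (hA y) x; rewrite invrK.
by move=> j x; have := h4 j x; rewrite !mulrA.
Qed.

End TestFunctionTools.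

(** * Integration over space *)

Section TupleMeasurability.
Context {R : realType} {n : nat}.
Local Notation V := 'rV[R]_n.
Local Notation tupleR n := (n.-tuple (measurableTypeR R)).

Definition row_of (t : tupleR n) : V := \row_j tnth t j.

Lemma row_ofE t j : row_of t ord0 j = tnth t j.
Proof. by rewrite mxE. Qed.

Definition tbox (a : V) (rho : R) : set (tupleR n) :=
  [set t | forall j, `|tnth t j - a ord0 j| <= rho].

Lemma measurable_coord_set (j : 'I_n) (B : set R) : measurable B ->
  measurable [set t : tupleR n | B (tnth t j)].
Proof.
move=> mB; rewrite -[X in measurable X]setTI.
exact: (@measurable_tnth _ (measurableTypeR R) n j).
Qed.

Lemma measurable_forall_coord (B : 'I_n -> set R) : (forall j, measurable (B j)) ->
  measurable [set t : tupleR n | forall j, B j (tnth t j)].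
Proof.
move=> mB; rewrite (_ : [set t | _] = \bigcap_(j in setT) [set t : tupleR n | B j (tnth t j)]).
  by apply: fin_bigcap_measurable => // j _; exact: measurable_coord_set.
by apply/seteqP; split => [t h j _|t h j]; exact: h.
Qed.

Lemma measurable_tbox a rho : measurable (tbox a rho).
Proof.
apply: (@measurable_forall_coord (fun j => [set s : R | `|s - a ord0 j| <= rho])) => j.
rewrite (_ : [set s | _] = `[a ord0 j - rho, a ord0 j + rho]%classic)//.
by apply/seteqP; split => s /=; rewrite in_itv/= ler_norml => /andP[s1 s2];
  apply/andP; split; lra.
Qed.

Lemma norm_rV_lt (x : V) e : 0 < e -> (`|x| < e) <-> forall j, `|x ord0 j| < e.
Proof.
move=> e0; split=> [xe j|h]; first exact: le_lt_trans (coord_le_norm _ _) xe.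
rewrite [ltLHS]/Num.Def.normr /= mx_normrE; apply/bigmax_ltP; split=> // -[i j] _ /=.
by rewrite ord1.
Qed.

(** Tuples carry the product sigma-algebra and row vectors the topology. The preimage of an open
    interval is open, hence a union of countably many cubes with rational centre and radius 1/(k +
    1), which are measurable coordinatewise. *)
Lemma continuous_measurable_row (u : V -> R) : continuous u ->
  measurable_fun setT (fun t => u (row_of t) : measurableTypeR R).
Proof.
move=> /continuousP cu; apply: (measurability _ (measurable_realfun.RGenOpens.measurableE R)).
move=> _ [_ [b [c ->] <-]]; rewrite setTI.
set O := u @^-1` `]b, c[%classic.
have oO : open O by apply: cu; exact: interval_open.
pose Q (p : 'rV[rat]_n * nat) : set (tupleR n) :=
  if `[< [set x : V | forall j, `|x ord0 j - ratr (p.1 ord0 j)| < p.2.+1%:R^-1] `<=` O >]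
  then [set t | forall j, `|tnth t j - ratr (p.1 ord0 j)| < p.2.+1%:R^-1] else set0.
rewrite (_ : _ @^-1` _ = \bigcup_p Q p).
  apply: countable_bigcupT_measurable => // p; rewrite /Q; case: ifP => // _.
  apply: (@measurable_forall_coord (fun j => [set s : R | `|s - ratr (p.1 ord0 j)| < p.2.+1%:R^-1])) => j.
  set q : R := ratr _; set e : R := _^-1.
  rewrite (_ : [set s | _] = `]q - e, q + e[%classic)//.
  by apply/seteqP; split => s /=; rewrite in_itv/= ltr_norml => /andP[s1 s2];
    apply/andP; split; lra.
apply/seteqP; split => t /=; last first.
  case=> p _; rewrite /Q; case: asboolP => // h /= ht; apply: h => j.
  by rewrite row_ofE.
move=> Ot; have : nbhs (row_of t) O by exact: open_nbhs_nbhs.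
move=> /nbhs_normP[e /= e0 he].
(* Half of [e], because the given point and the other points of the cube are each compared with the
   rational centre. *)
have [k ke] : exists k : nat, k.+1%:R^-1 < e / 2.
  exists (Num.truncn (2 / e)); rewrite -[ltRHS]invrK ltf_pV2 ?posrE ?invr_gt0 ?divr_gt0//.
  by rewrite invf_div truncnS_gt.
have /choice[q hq] : forall j : 'I_n, exists q : rat, `|tnth t j - ratr q| < k.+1%:R^-1.
  move=> j; have : tnth t j - k.+1%:R^-1 < tnth t j + k.+1%:R^-1.
    by rewrite ltrD2l gtrN// invr_gt0.
  move=> /rat_in_itvoo[q]; rewrite in_itv/= => /andP[q1 q2]; exists q.
  move: (k.+1%:R^-1) q1 q2 => d q1 q2.
  by rewrite ltr_norml; apply/andP; split; lra.
exists (\row_j q j, k) => //; rewrite /Q; case: asboolP => /= [_ j|].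
  by rewrite mxE.
case=> x hx; apply: he; rewrite /= norm_rV_lt// => j.
have := hx j; have := hq j; rewrite !mxE => h1 h2.
rewrite -[_ - _](subrKA (ratr (q j))) (le_lt_trans (ler_normD _ _))//.
rewrite [e]splitr ltrD//; first exact: lt_trans h1 ke.
by rewrite distrC; exact: lt_trans h2 ke.
Qed.

End TupleMeasurability.

(** * Fubini's theorem on tuples *)

Section LebesgueTuple.
Context {R : realType}.
Local Notation tupleR n := (n.-tuple (measurableTypeR R)).
Local Open Scope ereal_scope.

Lemma lebesgue_interval (c rho : R) : (0 <= rho)%R ->
  lebesgue_measure [set s : R | `|s - c| <= rho]%R = (2 * rho)%:E.
Proof.
move=> r0; rewrite (_ : [set s | _] = `[(c - rho)%R, (c + rho)%R]%classic).
  rewrite lebesgue_measure_itv/= lte_fin; case: ifPn => h.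
    by rewrite -EFinD; congr EFin; ring.
  suff -> : rho = 0%R by rewrite mulr0.
  by apply/eqP; rewrite eq_le r0 andbT; move: h; rewrite -leNgt; lra.
by apply/seteqP; split => s /=; rewrite in_itv/= ler_norml => /andP[s1 s2];
  apply/andP; split; lra.
Qed.

Lemma lebesgue_tbox n (a : 'rV[R]_n) (rho : R) : (0 <= rho)%R ->
  lebesgue_tuple R n (tbox a rho) = ((2 * rho) ^+ n)%:E.
Proof.
move=> r0; elim: n a => [|n IH] a.
  rewrite /= diracE mem_set ?expr0// => -[].
  by [].
rewrite /= /lebesgue_step /pushforward.
pose a' : 'rV[R]_n := \row_j a ord0 (lift ord0 j).
rewrite (_ : _ @^-1` _ = [set s : R | `|s - a ord0 ord0| <= rho]%R `*` tbox a' rho).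
  rewrite product_measure1E; last exact: measurable_tbox.
    rewrite [X in X * _](lebesgue_interval _ r0) [X in _ * X](IH a').
    by rewrite exprS EFinM.
  rewrite (_ : [set s | _] = `[(a ord0 ord0 - rho)%R, (a ord0 ord0 + rho)%R]%classic)//.
  by apply/seteqP; split => s /=; rewrite in_itv/= ler_norml => /andP[s1 s2];
    apply/andP; split; lra.
apply/seteqP; split => -[x t] /=.
  move=> h; split; first exact: (h ord0).
  by move=> j; have := h (lift ord0 j); rewrite /= mxE tnthS.
move=> [hx ht] j; case: (unliftP ord0 j) => [k ->|->]; last exact: hx.
by have := ht k; rewrite /= mxE tnthS.
Qed.

Lemma integrable_tbox n (a : 'rV[R]_n) (rho B : R) (h : tupleR n -> R) : (0 <= rho)%R ->
  measurable_fun setT h -> (forall t, `|h t| <= B)%R ->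
  (forall t, ~ tbox a rho t -> h t = 0%R) ->
  (lebesgue_tuple R n).-integrable setT (EFin \o h).
Proof.
move=> r0 mh hB h0.
have : (lebesgue_tuple R n).-integrable (tbox a rho) (EFin \o h).
  apply: measurable_bounded_integrable => //.
  - exact: measurable_tbox.
  - by rewrite [X in X < _](lebesgue_tbox a r0) ltry.
  - exact: measurable_funTS.
  - exists `|B|%R; split; first exact: num_real.
    by move=> M BM t _ /=; rewrite (le_trans (hB t))// (le_trans (ler_norm _))// ltW.
rewrite (integrable_mkcond _ (measurable_tbox a rho)).
rewrite (_ : _ \_ _ = EFin \o h)//; apply/funext => t.
rewrite /patch; case: ifPn => //; rewrite notin_setE => /h0 ht.
by rewrite /= ht.
Qed.

Lemma integrable_tuple_cons n (rho B : R) (h : tupleR n.+1 -> R) : (0 <= rho)%R ->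
  measurable_fun setT h -> (forall t, `|h t| <= B)%R ->
  (forall t, ~ tbox 0 rho t -> h t = 0%R) ->
  (lebesgue_measure \x lebesgue_tuple R n).-integrable setT
    (fun p => (h (tuple_cons p))%:E).
Proof.
move=> r0 mh hB h0.
have mhc : measurable_fun setT (h \o @tuple_cons R n).
  by apply: measurableT_comp => //; exact: measurable_tuple_cons.
pose D : set (measurableTypeR R * tupleR n) := @tuple_cons R n @^-1` tbox 0 rho.
have mD : measurable D.
  rewrite -[X in measurable X]setTI.
  by apply: (@measurable_tuple_cons R n) => //; exact: measurable_tbox.
have : (lebesgue_measure \x lebesgue_tuple R n).-integrable D (EFin \o (h \o @tuple_cons R n)).
  apply: measurable_bounded_integrable => //.
  - have := @lebesgue_tbox n.+1 0 rho r0; rewrite /= /lebesgue_step /pushforward => E.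
    by rewrite [X in X < _]E ltry.
  - exact: measurable_funTS.
  - exists `|B|%R; split; first exact: num_real.
    by move=> M BM t _ /=; rewrite (le_trans (hB _))// (le_trans (ler_norm _))// ltW.
rewrite (integrable_mkcond _ mD).
rewrite (_ : _ \_ _ = fun p => (h (tuple_cons p))%:E)//; apply/funext => t.
rewrite /patch; case: ifPn => //; rewrite notin_setE => /h0 ht.
by rewrite /= ht.
Qed.

Lemma integral_tuple_cons n (rho B : R) (h : tupleR n.+1 -> R) : (0 <= rho)%R ->
  measurable_fun setT h -> (forall t, `|h t| <= B)%R ->
  (forall t, ~ tbox 0 rho t -> h t = 0%R) ->
  \int[lebesgue_tuple R n.+1]_t (h t)%:E =
    \int[lebesgue_measure \x lebesgue_tuple R n]_p (h (tuple_cons p))%:E.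
Proof.
move=> r0 mh hB h0.
have ih := integrable_tuple_cons r0 mh hB h0.
have := @integral_pushforward _ _ _ _ R (@tuple_cons R n) (@measurable_tuple_cons R n)
  (lebesgue_measure \x lebesgue_tuple R n) setT (EFin \o h).
by apply => //; apply/measurable_realfun.measurable_EFinP.
Qed.

Definition tupd n (t : tupleR n) (j : 'I_n) (x : R) : tupleR n :=
  [tuple if i == j then x else tnth t i | i < n].

Lemma tnth_tupd n (t : tupleR n) j x i : tnth (tupd t j x) i = if i == j then x else tnth t i.
Proof. by rewrite tnth_mktuple. Qed.

(** Fubini's theorem, peeling off the first coordinate: if it is the distinguished one it is
    integrated first, otherwise last, with the induction hypothesis for the slices. *)
Lemma integral_lines0 n (rho B : R) (j : 'I_n) (h : tupleR n -> R) : (0 <= rho)%R ->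
  measurable_fun setT h -> (forall t, `|h t| <= B)%R ->
  (forall t, ~ tbox 0 rho t -> h t = 0%R) ->
  (forall t, \int[lebesgue_measure]_x (h (tupd t j x))%:E = 0) ->
  \int[lebesgue_tuple R n]_t (h t)%:E = 0.
Proof.
move=> r0; elim: n j h => [[]//|n IH] j h mh hB h0 hj.
rewrite (integral_tuple_cons r0 mh hB h0).
have ih := integrable_tuple_cons r0 mh hB h0.
case: (unliftP ord0 j) hj => [k ->|->] hj.
  rewrite -(integral12_prod_meas1 ih) /fubini_F integral0_eq// => x _ /=.
  apply: (IH k (fun t => h (tuple_cons (x, t)))).
  - apply: measurableT_comp => //; apply: measurableT_comp.
      exact: measurable_tuple_cons.
    exact: pair1_measurable.
  - by move=> t; exact: hB.
  - move=> t ht; apply: h0 => hb; apply: ht => i; have := hb (lift ord0 i).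
    by rewrite /tuple_cons tnthS /= !mxE.
  - move=> t; rewrite -[RHS](hj (tuple_cons (x, t))); apply: eq_integral => s _.
    congr (h _)%:E; apply: eq_from_tnth => i; rewrite tnth_tupd.
    case: (unliftP ord0 i) => [i' ->|->].
      by rewrite (inj_eq lift_inj) /tuple_cons !tnthS tnth_tupd.
    by rewrite eq_liftF /tuple_cons !tnth0.
rewrite -(integral21_prod_meas1 ih) /fubini_G integral0_eq// => t _ /=.
rewrite -[RHS](hj (tuple_cons (0%R, t))); apply: eq_integral => s _.
congr (h _)%:E; apply: eq_from_tnth => i; rewrite tnth_tupd.
case: (unliftP ord0 i) => [i' ->|->].
  by rewrite eq_sym eq_liftF /tuple_cons !tnthS.
by rewrite eqxx /tuple_cons tnth0.
Qed.

End LebesgueTuple.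

Section SpaceIntegral.
Context {R : realType} {n : nat}.
Local Notation V := 'rV[R]_n.
Local Notation e_ j := (delta_mx ord0 j : V).
Local Notation tupleR n := (n.-tuple (measurableTypeR R)).
Implicit Types (u v : V -> R) (a x : V).

Definition space_int u : R := \int[lebesgue_tuple R n]_t u (row_of t).

Lemma continuous_vanishes_bounded rho u : continuous u -> vanishes_beyond rho u ->
  exists B : R, forall x, `|u x| <= B.
Proof.
move=> cu vu; have : compact (u @` [set x | `|x| <= rho]).
  by apply: continuous_compact (@compact_cube R n rho); exact: continuous_subspaceT.
move=> /compact_bounded[M [_ hM]]; exists (`|M| + 1) => x.
have [xr|xr] := leP `|x| rho; last by rewrite vu// normr0 addr_ge0.
by apply: hM; [rewrite (le_lt_trans (ler_norm _))// ltrDl|exists x].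
Qed.

Lemma tbox_norm a rho (t : tupleR n) : 0 <= rho ->
  tbox a rho t <-> `|row_of t - a| <= rho.
Proof.
move=> r0; split=> [h|h j].
  rewrite [leLHS]/Num.Def.normr /= mx_normrE; apply/bigmax_leP; split=> // -[i j] _ /=.
  by rewrite ord1; have := h j; rewrite !mxE.
by have := le_trans (coord_le_norm _ j) h; rewrite !mxE.
Qed.

Lemma integrable_row_of rho u : continuous u -> vanishes_beyond rho u ->
  (lebesgue_tuple R n).-integrable setT (EFin \o (fun t => u (row_of t))).
Proof.
move=> cu vu; have [B hB] := continuous_vanishes_bounded cu vu.
have r0 : 0 <= `|rho| by [].
apply: (@integrable_tbox R n 0 `|rho| B) => //.
  exact: continuous_measurable_row.
move=> t; rewrite tbox_norm// subr0 => /negP; rewrite -ltNge => h; apply: vu.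
exact: le_lt_trans (ler_norm _) h.
Qed.

Lemma space_intD rho u v : continuous u -> vanishes_beyond rho u ->
  continuous v -> vanishes_beyond rho v ->
  space_int (fun x => u x + v x) = space_int u + space_int v.
Proof.
move=> cu vu cv vv; rewrite /space_int RintegralD//.
  exact: integrable_row_of vu.
exact: integrable_row_of vv.
Qed.

Lemma space_intZ rho (c : R) u : continuous u -> vanishes_beyond rho u ->
  space_int (fun x => c * u x) = c * space_int u.
Proof. by move=> cu vu; rewrite /space_int RintegralZl//; exact: integrable_row_of vu. Qed.

Lemma integrable_patch_cst a rho (B : R) : 0 <= rho ->
  (lebesgue_tuple R n).-integrable setT (EFin \o ((fun=> B) \_ (tbox a rho))).
Proof.
move=> r0; have : (lebesgue_tuple R n).-integrable (tbox a rho) (EFin \o (fun=> B)).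
  apply: measurable_bounded_integrable => //.
  - exact: measurable_tbox.
  - by rewrite [X in (X < _)%E](lebesgue_tbox a r0) ltry.
  - exists `|B|; split; first exact: num_real.
    by move=> M BM t _ /=; rewrite ltW.
rewrite (integrable_mkcond _ (measurable_tbox a rho)); congr (integrable _ _ _).
by apply/funext => t; rewrite /patch /=; case: ifP.
Qed.

Lemma space_int_bound rho a B u : 0 <= rho -> continuous u -> (forall x, `|u x| <= B) ->
  (forall x, rho < `|x - a| -> u x = 0) -> `|space_int u| <= B * (2 * rho) ^+ n.
Proof.
move=> r0 cu hB hu.
have vu : vanishes_beyond (rho + `|a|) u.
  move=> x xr; apply: hu; rewrite -(ltrD2r `|a|) (lt_le_trans xr)//.
  by rewrite -{1}(subrK a x) ler_normD.
have iu := integrable_row_of cu vu.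
rewrite /space_int (le_trans (le_normr_Rintegral _ iu))//.
have -> : B * (2 * rho) ^+ n = \int[lebesgue_tuple R n]_(t in tbox a rho) B.
  rewrite Rintegral_cst; last exact: measurable_tbox.
  by rewrite [X in fine X](lebesgue_tbox a r0).
rewrite [leRHS]Rintegral_mkcond; apply: le_Rintegral => //.
- exact: integrable_norm.
- exact: integrable_patch_cst.
move=> t _; rewrite /patch; case: ifPn => [_|]; first exact: hB.
rewrite notin_setE tbox_norm// => /negP; rewrite -ltNge => /hu ->.
by rewrite normr0.
Qed.

(** On every line in direction e_j the fundamental theorem on an interval [-M, M] beyond the support
    gives integral zero. *)
Lemma space_int_derive rho j u : smooth u -> vanishes_beyond rho u ->
  space_int ('D_(e_ j) u) = 0.
Proof.
move=> su vu; rewrite /space_int /Rintegral.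
have sd : smooth ('D_(e_ j) u) by exact: smooth_derive.
have cd := smooth_continuous sd.
have vd := vanishes_derive (e_ j) vu.
have [B hB] := continuous_vanishes_bounded cd vd.
pose M := `|rho| + 1.
have M0 : 0 < M by rewrite ltr_wpDl.
have rM : rho < M by rewrite (le_lt_trans (ler_norm _))// ltrDl.
rewrite (@integral_lines0 R n M B j)//; first exact: ltW.
- exact: (continuous_measurable_row cd).
- move=> t; rewrite tbox_norm ?(ltW M0)// subr0 => /negP; rewrite -ltNge => h.
  by rewrite vd// (lt_trans rM).
move=> t; pose x0 := row_of (tupd t j 0).
have xE s : row_of (tupd t j s) = x0 + s *: e_ j.
  apply/rowP => i; rewrite !mxE !tnth_tupd eqxx /=.
  by case: (i == j); rewrite ?mulr1 ?add0r// mulr0 addr0.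
under eq_integral do rewrite xE.
have xj s : `|s| <= `|x0 + s *: e_ j|.
  have := coord_le_norm (x0 + s *: e_ j) j.
  by rewrite -xE row_ofE tnth_tupd eqxx.
pose F s := u (x0 + s *: e_ j); pose f s := 'D_(e_ j) u (x0 + s *: e_ j).
have dF s : is_derive s (1 : R) F (f s).
  by apply: is_derive_line; exact: smooth_differentiable.
have cf : continuous f.
  move=> s; apply/differentiable_continuous/derivable1_diffP.
  by have [] := is_derive_line (smooth_differentiable (x0 + s *: e_ j) sd).
have cF : continuous F.
  by move=> s; apply/differentiable_continuous/derivable1_diffP; case: (dF s).
have fM s : M <= `|s| -> u (x0 + s *: e_ j) = 0 /\ f s = 0.
  move=> Ms; have h : rho < `|x0 + s *: e_ j|.
    by rewrite (lt_le_trans rM)// (le_trans Ms).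
  by split; [exact: vu|exact: vd].
transitivity (\int[lebesgue_measure]_(s in `[(- M)%R, M]) (f s)%:E)%E.
  rewrite [RHS]integral_mkcond; apply: eq_integral => s _; rewrite /patch.
  case: ifPn => //; rewrite notin_setE /= in_itv/= => /negP hs.
  have [|_ fs] := fM s; last by rewrite -[X in X%:E]/(f s) fs.
  by move: hs; rewrite -ler_norml -ltNge; exact: ltW.
rewrite (@continuous_FTC2 _ f F).
- rewrite /F (fM M _).1 ?(fM (- M) _).1 ?subee// ?normrN ger0_norm ?(ltW M0)//.
- by lra.
- exact: continuous_subspaceT.
- split.
  + by move=> s _; case: (dF s).
  + exact/cvg_at_right_filter/cF.
  + exact/cvg_at_left_filter/cF.
- by move=> s _; rewrite derive1E; case: (dF s).
Qed.

Lemma space_int_gt0 rho u a : continuous u -> vanishes_beyond rho u ->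
  (forall x, 0 <= u x) -> 0 < u a -> 0 < space_int u.
Proof.
move=> cu vu u0 ua.
have : \forall x \near a, u a / 2 < u x.
  have := cu a; move=> /cvgrPdist_lt/(_ (u a / 2)); rewrite divr_gt0// => /(_ isT).
  apply: filterS => x; rewrite ltr_norml => /andP[_]; lra.
move=> /nbhs_ballP[d /= d0 hd]; pose r := d / 2.
have r0 : 0 < r by rewrite divr_gt0.
have : \int[lebesgue_tuple R n]_(t in tbox a r) (u a / 2) <= space_int u.
  rewrite Rintegral_mkcond; apply: le_Rintegral => //.
  - by apply: integrable_patch_cst; exact: ltW.
  - exact: integrable_row_of vu.
  move=> t _; rewrite /patch; case: ifPn => // /set_mem.
  rewrite (tbox_norm _ _ (ltW r0)) => h; apply/ltW/hd.
  rewrite -ball_normE /= distrC (le_lt_trans h)// /r; lra.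
apply: lt_le_trans; rewrite Rintegral_cst; last exact: measurable_tbox.
rewrite [X in fine X](lebesgue_tbox a (ltW r0))/=.
by rewrite !mulr_gt0// ?divr_gt0// exprn_gt0// mulr_gt0.
Qed.

End SpaceIntegral.

(** * Pairing with the dual space *)

Section RealContinuity.
Context {R : realType} {n : nat}.
Implicit Types f g : 'rV[R]_n -> R.

Lemma continuous_fun_add f g : continuous f -> continuous g ->
  continuous (fun x => f x + g x).
Proof. by move=> cf cg x; exact: (@continuousD _ _ _ f g x (cf x) (cg x)). Qed.

Lemma continuous_fun_mull (c : R) f : continuous f -> continuous (fun x => c * f x).
Proof.
move=> cf x.
exact: (@continuousM _ _ (fun=> c) f x (@cst_continuous _ _ c x) (cf x)).
Qed.

End RealContinuity.

Section DualPairing.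
Context {R : realType} {n : nat} {Y : completeNormedModType R}.
Local Notation V := 'rV[R]_n.
Local Notation e_ j := (delta_mx ord0 j : V).
Implicit Types (phi psi : testfun n Y) (x v a : V) (y : Y) (c : dual Y).

Lemma pairing_le y c : `|pairing y c| <= `|c| * `|y|.
Proof.
have [->|y0] := eqVneq y 0; first by rewrite pairing0r !normr0 mulr0.
have yn : 0 < `|y| by rewrite normr_gt0.
have -> : y = `|y| *: (`|y|^-1 *: y) by rewrite scalerA divff ?scale1r// gt_eqF.
rewrite pairingZr normrM normr_id mulrC normrZ normr_id.
rewrite [X in _ <= _ * (_ * X)](_ : _ = 1) ?mulr1.
  by rewrite ler_wpM2r// dual_norm_ub// normrZ normfV normr_id mulVf// gt_eqF.
by rewrite normrZ normfV normr_id mulVf// gt_eqF.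
Qed.

Lemma pairingDl y z c : pairing (y + z) c = pairing y c + pairing z c.
Proof. by have := pairing_linear c 1 y z; rewrite !scale1r. Qed.

Lemma pairingBl y z c : pairing (y - z) c = pairing y c - pairing z c.
Proof. by rewrite pairingDl -scaleN1r pairingZr mulN1r. Qed.

Lemma derive_pairing (f : V -> Y) c x v : differentiable f x ->
  differentiable (fun z => pairing (f z) c) x /\
  'D_v (fun z => pairing (f z) c) x = pairing ('D_v f x) c.
Proof.
move=> df; have [k k0 hk] := derive_bounded df.
have [|||d E] := @differentiable_intro R V R (fun z => pairing (f z) c) x
  (fun h => pairing ('D_h f x) c); last by split.
- by move=> b u w; rewrite derive_linear// pairingDl pairingZr.
- exists (`|c| * k) => h; rewrite (le_trans (pairing_le _ _))// -mulrA.
  by rewrite ler_wpM2l.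
move=> e e0; have c1 : 0 < `|c| + 1 by rewrite ltr_wpDl.
have e1 : 0 < e / (`|c| + 1) by rewrite divr_gt0.
have [d d0 hd] := differentiable_elim df e1; exists d => // h /hd H.
rewrite -!pairingBl (le_trans (pairing_le _ _))// (le_trans (ler_wpM2l _ H))//.
rewrite mulrA ler_wpM2r// mulrCA ler_piMr ?(ltW e0)// ler_pdivrMr// mul1r.
by rewrite lerDl.
Qed.

Lemma smooth_pairing (f : V -> Y) c : smooth f -> smooth (fun x => pairing (f x) c).
Proof.
move=> sf; apply/smoothP => m; elim: m f sf => [|m IH] f sf.
all: have D x v := derive_pairing c v (smooth_differentiable x sf).
all: have df x := (D x 0).1.
  by split.
split=> // v; rewrite (_ : 'D_v _ = fun x => pairing ('D_v f x) c).
  by apply: IH; exact: smooth_derive.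
by apply/funext => x; case: (D x v).
Qed.

Lemma vanishes_pairing rho (f : V -> Y) (P : V -> dual Y) : vanishes_beyond rho f ->
  vanishes_beyond rho (fun x => pairing (f x) (P x)).
Proof. by move=> vf x /vf ->; rewrite pairing0r. Qed.

Lemma poly_distE P phi : poly_dist P phi = space_int (fun x => pairing (phi x) (P x)).
Proof. by []. Qed.

Lemma poly_dist_cst_dtest c j phi : poly_dist (cst c) (dtest j phi) = 0.
Proof.
have [rho _ vphi] := testfun_vanishes phi.
rewrite poly_distE -(@space_int_derive R n rho j (fun x => pairing (phi x) c)).
- congr space_int; apply/funext => x; rewrite dtestE.
  by have [_ ->] := derive_pairing c (e_ j) (testfun_differentiable phi x).
- exact/smooth_pairing/testfun_smooth.
- exact: (@vanishes_pairing rho phi (fun=> c)).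
Qed.

Lemma pairing_continuous2 (f : V -> Y) (P : V -> dual Y) : continuous f -> continuous P ->
  continuous (fun x => pairing (f x) (P x)).
Proof.
move=> cf cP x.
apply: (proj2 (@cvgrPdist_lt _ _ _ (nbhs x) (nbhs_filter x) _ _)) => e e0.
have pc : (fun z => pairing (f z) (P x)) z @[z --> x] --> pairing (f x) (P x).
  apply: (@continuous_comp _ _ _ f (fun y => pairing y (P x) : R^o)); first exact: cf.
  exact: pairing_continuous.
have e2 : 0 < e / 2 by rewrite divr_gt0.
have k0 : 0 < `|f x| + 1 by rewrite ltr_wpDl.
have e3 : 0 < e / 2 / (`|f x| + 1) by rewrite divr_gt0.
have /cvgrPdist_lt/(_ _ e2) := pc.
have := cP x; move=> /cvgrPdist_lt/(_ _ e3).
have := cf x; move=> /cvgrPdist_lt/(_ _ ltr01).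
apply: filterS3 => z h1 h2 h3.
have -> : pairing (f x) (P x) - pairing (f z) (P z) =
  (pairing (f x) (P x) - pairing (f z) (P x)) + pairing (f z) (P x - P z).
  have -> : pairing (f z) (P x - P z) = pairing (f z) (P x) - pairing (f z) (P z).
    by rewrite -scaleN1r pairingD pairingZ mulN1r.
  by rewrite addrA subrK.
rewrite (le_lt_trans (ler_normD _ _))// [e]splitr ltrD//.
rewrite (le_lt_trans (pairing_le _ _))//.
have fz : `|f z| <= `|f x| + 1.
  rewrite -(subrK (f x) (f z)) addrC (le_trans (ler_normD _ _))// lerD2l.
  by rewrite distrC ltW.
rewrite (le_lt_trans (ler_wpM2l _ fz))//.
by rewrite -ltr_pdivlMr.
Qed.

Lemma testfun_continuous phi : continuous phi.
Proof. exact/smooth_continuous/testfun_smooth. Qed.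

Lemma poly_dist_linear P : continuous P -> linear (poly_dist P : testfun n Y -> R^o).
Proof.
move=> cP c phi psi; rewrite !poly_distE.
have [r1 _ v1] := testfun_vanishes phi; have [r2 _ v2] := testfun_vanishes psi.
have c1 := pairing_continuous2 (@testfun_continuous phi) cP.
have c2 := pairing_continuous2 (@testfun_continuous psi) cP.
rewrite -[c *: space_int _]/(c * space_int _) -(space_intZ c c1 (vanishes_pairing P v1)).
rewrite -(@space_intD R n (Num.max r1 r2) (fun x => c * pairing (phi x) (P x))).
- by congr space_int; apply/funext => x; rewrite testfunZDE pairingDl pairingZr.
- exact: continuous_fun_mull c1.
- move=> x; rewrite gt_max => /andP[xr _].
  by rewrite (vanishes_pairing P v1 xr) mulr0.
- exact: c2.
- by move=> x; rewrite gt_max => /andP[_ xr]; rewrite (vanishes_pairing P v2 xr).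
Qed.

End DualPairing.

(** * The mass of the bump *)

Section BumpMass.
Context {R : realType} {n : nat}.
Local Notation V := 'rV[R]_n.
Local Notation e_ j := (delta_mx ord0 j : V).

Definition bump_mass (a : V) : R := space_int (fun x => bump_prod (x - a)).

Lemma flat_bump_smooth (s : seq 'I_n) :
  smooth (fun x : V => \prod_(j <- s) (flat 1 (1 * x ord0 j + 1) * flat 1 (- 1 * x ord0 j + 1))).
Proof.
elim: s => [|j s IH].
  under eq_fun do rewrite big_nil.
  exact: (@smooth_cst R n R 1).
under eq_fun do rewrite big_cons.
apply: (smoothM _ IH).
by apply: (@smoothM _ _ R); exact: flat_smooth.
Qed.

Lemma vanishes_translate {W : normedModType R} rho (f : V -> W) a :
  vanishes_beyond rho f -> vanishes_beyond (rho + `|a|) (fun x => f (x - a)).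
Proof.
move=> vf x xr; apply: vf; rewrite -(ltrD2r `|a|) (lt_le_trans xr)//.
by rewrite -{1}(subrK a x) ler_normD.
Qed.

Lemma smooth_translate {W : normedModType R} (f : V -> W) a :
  smooth f -> smooth (fun x => f (x - a)).
Proof.
move=> sf; have := smooth_affine 1 (- a) sf.
by under eq_fun do rewrite scale1r.
Qed.

(** Positivity of the bump is not read off its definition as a derivative. Instead a nonnegative
    function [b], positive at 0, is decomposed: the divergence integrates to zero, so a bump of mass
    zero would force the integral of [b] to vanish. *)
Lemma bump_mass_neq0 a : bump_mass a != 0.
Proof.
pose b (x : V) : R := \prod_(j <- enum 'I_n) (flat 1 (1 * x ord0 j + 1) * flat 1 (- 1 * x ord0 j + 1)).
have sb : smooth b by exact: flat_bump_smooth.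
have b0 x : 0 <= b x by apply: prodr_ge0 => j _; rewrite mulr_ge0 ?flat_ge0.
have vb : vanishes_beyond 1 b.
  apply/vanishes_slab => j x xj; rewrite /b (bigD1_seq j)/= ?mem_enum ?enum_uniq//.
  suff -> : flat 1 (1 * x ord0 j + 1) * flat 1 (- 1 * x ord0 j + 1) = 0 by rewrite mul0r.
  have [x0|x0] := ltP 0 (x ord0 j).
    by move: xj; rewrite gtr0_norm// => xj; rewrite [X in _ * X]flat_le0 ?mulr0//; lra.
  by move: xj; rewrite ler0_norm// => xj; rewrite flat_le0 ?mul0r//; lra.
have [C _ HC] := @poincare_fun R n R 0; have [psi [h1 h2 _]] := HC b sb vb.
set I := integrals _ _ _ in h2.
have P0 : 0 < space_int (fun x => b (x - a)).
  apply: (@space_int_gt0 R n (1 + `|a|) _ a).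
  - exact/smooth_continuous/smooth_translate.
  - exact: vanishes_translate.
  - by move=> x.
  rewrite subrr /b; apply: prodr_gt0 => j _; rewrite mulr_gt0// flat_gt0 !mxE; lra.
apply/eqP => M0; move: P0; rewrite ltNge => /negP; apply.
have cD j : continuous (fun x : V => 'D_(e_ j) (psi j) (x - a)).
  apply: smooth_continuous; apply: (@smooth_translate _ ('D_(e_ j) (psi j))).
  by apply: smooth_derive; case: (h1 j).
have vD j : vanishes_beyond (1 + `|a|) (fun x : V => 'D_(e_ j) (psi j) (x - a)).
  apply: (@vanishes_translate _ 1 ('D_(e_ j) (psi j))).
  by apply: vanishes_derive; case: (h1 j).
have I0 j : space_int (fun x : V => 'D_(e_ j) (psi j) (x - a)) = 0.
  rewrite -(@space_int_derive R n (1 + `|a|) j (fun x => psi j (x - a))).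
  - by congr space_int; apply/funext => x; rewrite derive_translate.
  - by apply: smooth_translate; case: (h1 j).
  - by apply: vanishes_translate; case: (h1 j).
have cB : continuous (fun x : V => bump_prod (x - a) : R).
  exact/smooth_continuous/smooth_translate/bump_prod_smooth.
have vB : vanishes_beyond (1 + `|a|) (fun x : V => bump_prod (x - a) : R).
  exact/vanishes_translate/bump_prod_vanishes.
have S s : continuous (fun x : V => \sum_(j <- s) 'D_(e_ j) (psi j) (x - a)) /\
    vanishes_beyond (1 + `|a|) (fun x : V => \sum_(j <- s) 'D_(e_ j) (psi j) (x - a)) /\
    space_int (fun x : V => \sum_(j <- s) 'D_(e_ j) (psi j) (x - a)) = 0.
  elim: s => [|j s [c1 [v1 i1]]].
    under eq_fun do rewrite big_nil; split; first exact: cst_continuous.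
    by split=> //; rewrite /space_int Rintegral_cst// mul0r.
  under eq_fun do rewrite big_cons.
  split; first exact: continuous_fun_add (cD j) c1.
  split; first by move=> x xr; rewrite vD// v1// addr0.
  by rewrite (space_intD (cD j) (vD j) c1 v1) I0 i1 addr0.
have [c1 [v1 i1]] := S (index_enum 'I_n).
have -> : (fun x => b (x - a)) =
    (fun x => \sum_j 'D_(e_ j) (psi j) (x - a) + I * bump_prod (x - a)).
  by apply/funext => x; rewrite h2 mulrC.
rewrite (@space_intD R n (1 + `|a|))//; last 2 first.
- exact: continuous_fun_mull cB.
- by move=> x xr; rewrite vB// mulr0.
by rewrite i1 add0r (space_intZ _ cB vB) -/(bump_mass a) M0 mulr0.
Qed.

End BumpMass.

(** * The constant term of a functional *)

Section Smallness.
Context {R : realType} {n : nat} {Y : completeNormedModType R}.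
Local Notation V := 'rV[R]_n.
Implicit Types (o pt : bool) (m : nat) (A : set (testfun n Y)) (s e d r : R).

(* [o] selects little-o ([true]) or big-O ([false]) estimates as r -> 0+, and
   [pt] selects estimates for each single test function ([true]) or uniform
   ones over C^m-bounded families with common bounded support ([false]). *)
Definition for_constants o (Q : R -> Prop) : Prop :=
  if o then forall e, 0 < e -> Q e else exists2 e, 0 < e & Q e.

Definition small o s (F : R -> testfun n Y -> R) A : Prop :=
  for_constants o (fun e => exists2 d, 0 < d &
    forall r phi, 0 < r -> r < d -> A phi -> `|F r phi| <= e * r `^ s).

(** For [pt] the set has at most one element, so that quantifying over admissible sets means
    treating test functions one by one. Both cases are stable under the images by choices of
    potentials taken below. *)
Definition admissible pt m A : Prop :=
  (exists rho C, forall phi, A phi ->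
     vanishes_beyond rho phi /\ forall x, bnd m C phi x) /\
  (pt -> forall phi psi, A phi -> A psi -> phi = psi).

(** Lets little-o and big-O be proved by one computation that maps a constant [e] to c e. *)
Lemma for_constants_scale o (Q Q' : R -> Prop) (c : R) : 0 < c ->
  (forall e, 0 < e -> Q e -> Q' (c * e)) -> for_constants o Q -> for_constants o Q'.
Proof.
move=> c0 QQ'; case: o => /= [h e e0|[e e0 he]]; last first.
  by exists (c * e); [rewrite mulr_gt0|exact: QQ'].
rewrite -(divfK (lt0r_neq0 c0) e) mulrC; apply: QQ'; first by rewrite divr_gt0.
by apply: h; rewrite divr_gt0.
Qed.

Lemma for_constants_fin o (I : finType) (Q : I -> R -> Prop) :
  (forall i e e', e <= e' -> Q i e -> Q i e') ->
  (forall i, for_constants o (Q i)) -> for_constants o (fun e => forall i, Q i e).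
Proof.
move=> mQ; case: o => /= [h e e0 i|h]; first exact: h.
have /choice[E hE] : forall i, exists e, 0 < e /\ Q i e.
  by move=> i; have [e e0 he] := h i; exists e.
have S0 : 0 <= \sum_i E i by rewrite sumr_ge0// => i _; case: (hE i) => /ltW.
exists (1 + \sum_i E i); first by rewrite ltr_pwDl.
move=> i; case: (hE i) => e0; apply: mQ; rewrite (bigD1 i)//= addrCA lerDl.
by rewrite addr_ge0// sumr_ge0// => k _; case: (hE k) => /ltW.
Qed.

(** A finite family of estimates with a common constant and a common threshold. *)
Lemma small_fin o (I : finType) s (F : I -> R -> testfun n Y -> R)
    (A : I -> set (testfun n Y)) : (forall i, small o s (F i) (A i)) ->
  for_constants o (fun e => exists2 d, 0 < d & forall i r phi, 0 < r -> r < d ->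
    A i phi -> `|F i r phi| <= e * r `^ s).
Proof.
move=> h; suff : for_constants o (fun e => forall i, exists2 d, 0 < d &
    forall r phi, 0 < r -> r < d -> A i phi -> `|F i r phi| <= e * r `^ s).
  move=> H; have := @for_constants_scale o _ _ 1 ltr01 _ H; apply=> e e0.
  rewrite mul1r => {}H.
  have /choice[D hD] : forall i, exists d, 0 < d /\
    forall r phi, 0 < r -> r < d -> A i phi -> `|F i r phi| <= e * r `^ s.
    by move=> i; have [d d0 hd] := H i; exists d.
  exists (\big[Num.min/1]_i D i).
    apply: lt_bigmin => // i _; by case: (hD i).
  move=> i r phi r0 rd; case: (hD i) => _; apply=> //.
  by rewrite (lt_le_trans rd)// bigmin_le_cond.
apply: for_constants_fin => // i e e' ee [d d0 hd]; exists d => // r phi r0 rd Aphi.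
by rewrite (le_trans (hd r phi r0 rd Aphi))// ler_wpM2r// powR_ge0.
Qed.

Lemma for_constants_ex o (Q : R -> Prop) : for_constants o Q -> exists2 e, 0 < e & Q e.
Proof. by case: o => //= h; exists 1 => //; exact: h. Qed.

Lemma linear_continuous_dual (f : Y -> R^o) : linear f -> continuous f ->
  exists c : dual Y, forall y, pairing y c = f y.
Proof.
move=> lf cf; have H : dual_pred f by apply/asboolP.
by exists (Dual H).
Qed.

Lemma unit_bounded_linear_continuous (f : Y -> R^o) (M : R) : linear f -> 0 <= M ->
  (forall y, `|y| <= 1 -> `|f y| <= M) -> continuous f.
Proof.
move=> lf M0 hM.
have f0 : f 0 = 0 by have := lf (- 1) 0 0; rewrite scaler0 addr0 scaleN1r addNr.
have fM y : `|f y| <= M * `|y|.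
  have [->|y0] := eqVneq y 0; first by rewrite f0 normr0 mulr_ge0.
  have yn : 0 < `|y| by rewrite normr_gt0.
  have := hM (`|y|^-1 *: y); rewrite normrZ normfV normr_id mulVf ?gt_eqF// => /(_ (lexx _)).
  have := lf (`|y|^-1) y 0; rewrite !addr0 f0 addr0 => ->.
  by rewrite normrZ normfV normr_id mulrC ler_pdivrMr.
move=> y; apply: (proj2 (@cvgrPdist_lt _ _ _ (nbhs y) (nbhs_filter y) _ _)) => e e0.
have M1 : 0 < M + 1 by rewrite ltr_wpDl.
have e1 : 0 < e / (M + 1) by rewrite divr_gt0.
have /cvgrPdist_lt/(_ _ e1) : z @[z --> y] --> y by exact: cvg_id.
apply: filterS => z yz.
have -> : f y - f z = f (y - z).
  have -> : y - z = - 1 *: z + y by rewrite scaleN1r addrC.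
  by rewrite lf scaleN1r addrC.
rewrite (le_lt_trans (fM _))// (@le_lt_trans _ _ ((M + 1) * `|y - z|))//.
  by rewrite ler_wpM2r// lerDl.
by rewrite mulrC -ltr_pdivlMr.
Qed.

Lemma poly_dist_cst_linear (c : dual Y) : linear (poly_dist (cst c) : testfun n Y -> R^o).
Proof. by apply: poly_dist_linear; exact: cst_continuous. Qed.

(** The factor r^n comes from the dilation identity with lam = 1/r, hence the restriction r <= 1:
    constants integrate divergences to zero, and the bump part carries lam^-n. *)
Lemma poly_dist_bump (a : V) (c : dual Y) r y : 0 < r -> r <= 1 ->
  poly_dist (cst c) (rescale a r (bump_test y)) = r ^+ n * (pairing y c * bump_mass a).
Proof.
move=> r0 r1; have rn0 : r != 0 by rewrite gt_eqF.
have lam1 : 1 <= r^-1 by rewrite invf_ge1.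
have [C _ HC] := @dilation_identity R n Y 0 _ lam1; have [psi [_ E _]] := HC y.
have S (l : seq 'I_n) :
    poly_dist (cst c) (rescale a 1 (\sum_(j <- l) dtest j (psi j))) = 0.
  have L0 : poly_dist (cst c) (rescale a 1 (0 : testfun n Y)) = 0.
    rewrite poly_distE (_ : (fun _ => _) = cst (0 : R)).
      by rewrite /space_int Rintegral_cst// mul0r.
    by apply/funext => x; rewrite rescaleEx ?oner_eq0// pairing0r.
  elim: l => [|j l IH]; first by rewrite big_nil.
  rewrite big_cons -[dtest _ _]scale1r (rescale_linear a (oner_neq0 R)).
  rewrite poly_dist_cst_linear IH addr0 (dtest_rescale _ _ _ (oner_neq0 R)) scale1r.
  by rewrite !scale1r poly_dist_cst_dtest.
rewrite -[r in LHS]mul1r -(rescale_comp _ _ (oner_neq0 R) rn0) -[r in LHS]invrK E.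
rewrite addrC exprVn invrK (rescale_linear a (oner_neq0 R)) poly_dist_cst_linear S addr0.
rewrite -[_ *: _]/(_ * _); congr (_ * _); rewrite poly_distE.
rewrite -[RHS](@space_intZ R n (1 + `|a|)); last 2 first.
- exact/smooth_continuous/smooth_translate/bump_prod_smooth.
- exact/vanishes_translate/bump_prod_vanishes.
congr space_int; apply/funext => x; rewrite rescaleEx ?oner_eq0//=.
by rewrite invr1 scale1r pairingZr mulrC.
Qed.

(* The mean values [h r y] of [U] over rescaled bumps have a limit as r -> 0: a
   dilated bump is a multiple of the bump plus a divergence, so that [h] varies
   by a summable amount along dyadic scales.  The limit is a continuous linear
   functional of [y] by Banach-Steinhaus, and it is the constant term of [U]
   since every test function is a multiple of the bump plus a divergence. *)
Section ConstantTerm.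
Variables (o pt : bool) (m : nat) (a : V) (U : testfun n Y -> R^o) (s : R).
Hypothesis linU : linear U.
Hypothesis contU : forall r, 0 < r ->
  continuous (fun y => U (rescale a r (bump_test y))).
Hypothesis s1 : 1 <= s.
Hypothesis smallU : forall j A, admissible pt m A ->
  small o (s + n%:R) (fun r phi => U (rescale a r (dtest j phi))) A.

Let T r phi : R := U (rescale a r phi).

Let linT r : r != 0 -> linear (T r : testfun n Y -> R^o).
Proof. by move=> r0 c f g; rewrite /T (rescale_linear a r0) linU. Qed.

Let T_sum r (I : Type) (l : seq I) (F : I -> testfun n Y) : r != 0 ->
  T r (\sum_(i <- l) F i) = \sum_(i <- l) T r (F i).
Proof.
move=> r0; pose TL : {linear testfun n Y -> R^o} :=
  HB.pack (T r : testfun n Y -> R^o) (GRing.isLinear.Build _ _ _ _ _ (linT r0)).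
exact: (linear_sum TL).
Qed.

Let TZ r (c : R) phi : r != 0 -> T r (c *: phi) = c * T r phi.
Proof.
move=> r0; have T0 : T r 0 = 0.
  have := linT r0 (- 1) 0 0; rewrite scaler0 addr0 scaleN1r => ->.
  by rewrite addNr.
by have := linT r0 c phi 0; rewrite !addr0 T0 addr0.
Qed.

Let TD r phi psi : r != 0 -> T r (phi + psi) = T r phi + T r psi.
Proof. by move=> r0; have := linT r0 1 phi psi; rewrite !scale1r. Qed.

(** The dilation identity tested with the functional: only derivatives of the potentials remain, and
    on these it is small by hypothesis. *)
Let dilation_small (lam : R) (B : set Y) M : 1 <= lam -> (forall y, B y -> `|y| <= M) ->
  (pt -> forall y z, B y -> B z -> y = z) ->
  for_constants o (fun e => exists2 d, 0 < d & forall r y, 0 < r -> r < d -> B y ->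
    `|T (r / lam) (bump_test y) - lam ^- n * T r (bump_test y)| <= e * r `^ (s + n%:R)).
Proof.
move=> lam1 BM Bpt; have [C C0 HC] := @dilation_identity R n Y m lam lam1.
have /choice[psi hpsi] := HC.
have l0 : 0 < lam by rewrite (lt_le_trans ltr01).
(* The potentials of all bumps with coefficient in [B] form one admissible family, since their
   bounds are linear in the coefficient. *)
pose A j : set (testfun n Y) := [set psi y j | y in B].
have admA j : admissible pt m (A j).
  split.
    exists 1, (C * M) => _ [y By <-]; have [v _ b] := hpsi y; split=> // x.
    by apply: bnd_le (b j x) => //; rewrite ler_wpM2l ?(ltW C0)// BM.
  by move=> p _ _ [y By <-] [z Bz <-]; rewrite (Bpt p y z).
have := small_fin (fun j => smallU j (admA j)).
apply: (@for_constants_scale _ _ _ (n%:R + 1)); first by rewrite ltr_wpDl.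
move=> e e0 [d d0 hd]; exists d => // r y r0 rd By.
have rn0 : r != 0 by rewrite gt_eqF.
have ln0 : lam^-1 != 0 by rewrite invr_eq0 gt_eqF.
have [_ E _] := hpsi y.
have -> : T (r / lam) (bump_test y) = T r (rescale 0 lam^-1 (bump_test y)).
  by rewrite /T rescale_comp.
rewrite E TD// TZ// addrK T_sum//.
rewrite (le_trans (ler_norm_sum _ _ _))//.
apply: (@le_trans _ _ (\sum_(j < n) e * r `^ (s + n%:R))).
  by apply: ler_sum => j _; apply: hd => //; exists y.
rewrite sumr_const card_ord -[leLHS]mulr_natl mulrA ler_wpM2r ?powR_ge0//.
by rewrite ler_wpM2r ?(ltW e0)// lerDl.
Qed.

Let h r y : R := r ^- n * T r (bump_test y).

(** The place where s >= 1 is used to compare powers of dyadic scales. *)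
Let powR_half r k : 0 < r -> (r * 2^-1 ^+ k) `^ s <= r `^ s * 2^-1 ^+ k.
Proof.
move=> r0; rewrite powRM ?(ltW r0) ?exprn_ge0// ler_wpM2l ?powR_ge0//.
have hk : 0 < (2^-1 : R) ^+ k <= 1.
  by rewrite exprn_gt0//= exprn_ile1// invf_le1// ler1n.
by rewrite -[leRHS]powRr1 ?exprn_ge0// ger_powR.
Qed.

Let dyadic_limit (B : set Y) M : (forall y, B y -> `|y| <= M) ->
  (pt -> forall y z, B y -> B z -> y = z) ->
  for_constants o (fun e => exists2 d, 0 < d & forall r y, 0 < r -> r < d -> B y ->
    exists2 l : R, h (r * 2^-1 ^+ k) y @[k --> \oo] --> l & `|h r y - l| <= e * r `^ s).
Proof.
move=> BM Bpt; have l2 : 1 <= (2 : R) by rewrite ler1n.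
have := dilation_small l2 BM Bpt.
(* The factor 2^n comes from normalising at scale t/2, the factor 2 from summing the geometric
   series. *)
apply: (@for_constants_scale _ _ _ (2 * 2 ^+ n)); first by rewrite mulr_gt0 ?exprn_gt0.
move=> e e0 [d d0 hd]; exists d => // r y r0 rd By.
have step t : 0 < t -> t < d -> `|h (t / 2) y - h t y| <= 2 ^+ n * e * t `^ s.
  move=> t0 td; have tn0 : t != 0 by rewrite gt_eqF.
  have -> : h (t / 2) y - h t y = (t / 2) ^- n *
      (T (t / 2) (bump_test y) - 2 ^- n * T t (bump_test y)).
    rewrite /h mulrBr; congr (_ - _); rewrite mulrA -invfM -exprMn divfK//.
  rewrite normrM normfV normrX (gtr0_norm (divr_gt0 t0 _))//.
  rewrite mulrC ler_pdivrMr ?exprn_gt0 ?divr_gt0// (le_trans (hd _ _ t0 td By))//.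
  rewrite powRD ?tn0 ?implybT// powR_mulrn ?(ltW t0)//.
  rewrite le_eqVlt; apply/orP; left; apply/eqP.
  by rewrite expr_div_n; field; rewrite expf_neq0.
have [|k|l hl Hl] := @geometric_cvg R R (fun k => h (r * 2^-1 ^+ k) y) (2 ^+ n * e * r `^ s).
- by rewrite !mulr_ge0 ?powR_ge0 ?exprn_ge0 ?(ltW e0).
- have rk0 : 0 < r * 2^-1 ^+ k by rewrite mulr_gt0 ?exprn_gt0.
  have rkd : r * 2^-1 ^+ k < d.
    by rewrite (le_lt_trans _ rd)// ler_piMr ?(ltW r0)// exprn_ile1// invf_le1// ler1n.
  have := step _ rk0 rkd; rewrite exprSr mulrA => /le_trans; apply.
  by rewrite -[leRHS]mulrA ler_wpM2l ?powR_half// mulr_ge0 ?exprn_ge0 ?(ltW e0).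
exists l => //; have := Hl 0%N; rewrite expr0 !mulr1 => /le_trans; apply.
by rewrite !mulrA.
Qed.

Let c' y : R := lim (h (2^-1 ^+ k) y @[k --> \oo]).

(** The dilation identity with lam = 1/r compares the values at the scales r 2^-k and 2^-k with an
    error tending to 0, so the limit does not depend on the starting scale. *)
Let ratio_limit y r (l : R) : 0 < r -> r < 1 ->
  h (r * 2^-1 ^+ k) y @[k --> \oo] --> l -> h (2^-1 ^+ k) y @[k --> \oo] --> l.
Proof.
move=> r0 r1 hl.
have lam1 : 1 <= r^-1 by rewrite invf_ge1// ltW.
have : for_constants o (fun e => exists2 d, 0 < d & forall t z, 0 < t -> t < d -> z = y ->
    `|T (t / r^-1) (bump_test z) - r^-1 ^- n * T t (bump_test z)| <= e * t `^ (s + n%:R)).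
  apply: (@dilation_small _ [set y] `|y|) => // [z /= ->//|_ z z' /= -> ->//].
move=> H; have [e e0 [d d0 hd]] : exists2 e, 0 < e & exists2 d, 0 < d &
    forall t z, 0 < t -> t < d -> z = y ->
    `|T (t / r^-1) (bump_test z) - r^-1 ^- n * T t (bump_test z)| <= e * t `^ (s + n%:R).
  by case: (o) H => /= [H|//]; exists 1 => //; apply: H.
have diff0 : h (r * 2^-1 ^+ k) y - h (2^-1 ^+ k) y @[k --> \oo] --> (0 : R).
  have g0 : e * r ^- n * 2^-1 ^+ k @[k --> \oo] --> (0 : R).
    rewrite -[X in _ --> X](mulr0 (e * r ^- n)); apply: cvgM; first exact: cvg_cst.
    by apply: cvg_expr; rewrite gtr0_norm ?invr_gt0// invf_lt1// ltr1n.
  have : (2^-1 : R) ^+ k @[k --> \oo] --> 0.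
    by apply: cvg_expr; rewrite gtr0_norm ?invr_gt0// invf_lt1// ltr1n.
  move=> /cvgrPdist_lt/(_ _ d0)[K _ hK].
  apply/cvgrPdist_le => e1 e10; move/cvgrPdist_le : g0 => /(_ _ e10)[K' _ hK'].
  exists (maxn K K') => // k /=; rewrite geq_max => /andP[Kk K'k].
  have := hK k Kk; rewrite /= sub0r normrN ger0_norm ?exprn_ge0// => kd.
  have := hK' k K'k; rewrite /= !sub0r !normrN => /(le_trans _); apply.
  set t := 2^-1 ^+ k in kd *; have t0 : 0 < t by rewrite exprn_gt0.
  have := hd t y t0 kd erefl; rewrite invrK [t * r]mulrC => H1.
  have -> : h (r * t) y - h t y = (r * t) ^- n *
      (T (r * t) (bump_test y) - r^-1 ^- n * T t (bump_test y)).
    rewrite /h mulrBr; congr (_ - _); rewrite mulrA; congr (_ * _).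
    by rewrite exprMn invfM exprVn invrK mulrAC mulVf ?mul1r// expf_neq0// gt_eqF.
  rewrite normrM normfV normrX (gtr0_norm (mulr_gt0 r0 t0)).
  rewrite mulrC ler_pdivrMr ?exprn_gt0 ?mulr_gt0// (le_trans H1)//.
  rewrite powRD ?(gt_eqF t0) ?implybT// powR_mulrn ?(ltW t0)//.
  rewrite ger0_norm ?mulr_ge0 ?invr_ge0 ?exprn_ge0 ?(ltW e0) ?(ltW r0) ?(ltW t0)//.
  rewrite exprMn -!mulrA ler_wpM2l ?(ltW e0)// [leRHS]mulrCA mulKf; last first.
    by rewrite expf_neq0// gt_eqF.
  rewrite ler_wpM2r ?exprn_ge0 ?(ltW t0)// -[leRHS]powRr1 ?(ltW t0)// ger_powR//.
  by rewrite t0 exprn_ile1// invf_le1// ler1n.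
have -> : (fun k => h (2^-1 ^+ k) y) = (fun k => h (r * 2^-1 ^+ k) y -
    (h (r * 2^-1 ^+ k) y - h (2^-1 ^+ k) y)).
  by apply/funext => k; move: (h _ _) (h _ _) => u v; rewrite subKr.
by rewrite -[l]subr0; apply: cvgB.
Qed.

Let limit_small (B : set Y) M : (forall y, B y -> `|y| <= M) ->
  (pt -> forall y z, B y -> B z -> y = z) ->
  for_constants o (fun e => exists2 d, 0 < d & forall r y, 0 < r -> r < d -> B y ->
    `|h r y - c' y| <= e * r `^ s).
Proof.
move=> BM Bpt; have := dyadic_limit BM Bpt.
apply: (@for_constants_scale _ _ _ 1) => // e e0 [d d0 hd]; rewrite mul1r.
exists (Num.min d 1); first by rewrite lt_min d0 ltr01.
move=> r y r0; rewrite lt_min => /andP[rd r1] By; have [l hl Hl] := hd r y r0 rd By.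
suff -> : c' y = l by [].
by apply: cvg_lim; [exact: norm_hausdorff|exact: ratio_limit hl].
Qed.

Let h_cvg y : h (2^-1 ^+ k) y @[k --> \oo] --> c' y.
Proof.
have [z /= ->//|_ z z' /= -> ->//|e e0 [d d0 hd]] :=
  for_constants_ex (@dyadic_limit [set y] `|y| _ _).
have r0 : 0 < Num.min d 1 / 2 by rewrite divr_gt0// lt_min d0 ltr01.
have rm : Num.min d 1 / 2 < Num.min d 1 by rewrite ltr_pdivrMr// ltr_pMr ?ltr1n// lt_min d0 ltr01.
have [rd r1] : Num.min d 1 / 2 < d /\ Num.min d 1 / 2 < 1.
  by apply/andP; rewrite -lt_min.
have [l hl _] := hd _ y r0 rd erefl.
have H := ratio_limit r0 r1 hl.
by rewrite /c' (cvg_lim _ H)//; exact: norm_hausdorff.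
Qed.

Let t_neq0 k : (2^-1 : R) ^+ k != 0.
Proof. by rewrite expf_neq0// invr_eq0. Qed.

Let h_linear r : r != 0 -> linear (h r : Y -> R^o).
Proof.
move=> r0 b y z; rewrite /h bump_test_linear (linT r0).
by rewrite mulrDr; congr (_ + _); exact: mulrCA.
Qed.

Let c'_linear : linear (c' : Y -> R^o).
Proof.
move=> b y z; have H := @h_cvg (b *: y + z).
have H' : h (2^-1 ^+ k) (b *: y + z) @[k --> \oo] --> b * c' y + c' z.
  have -> : (fun k => h (2^-1 ^+ k) (b *: y + z)) =
      (fun k => b * h (2^-1 ^+ k) y + h (2^-1 ^+ k) z).
    by apply/funext => k; rewrite (h_linear (t_neq0 k)).
  by apply: cvgD; [apply: cvgM; [exact: cvg_cst|exact: h_cvg]|exact: h_cvg].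
by rewrite -[LHS](cvg_lim (@norm_hausdorff _ R) H) (cvg_lim (@norm_hausdorff _ R) H').
Qed.

Let c'_continuous : continuous (c' : Y -> R^o).
Proof.
pose F : set (Y -> R^o) := [set (h (2^-1 ^+ k) : Y -> R^o) | k in setT].
have FU : uniform_bounded F.
  apply: Banach_Steinhauss => [f [k _ <-]|y].
    split; last exact: h_linear.
    have lc : linear (fun y => U (rescale a (2^-1 ^+ k) (bump_test y)) : R^o).
      by move=> b y z; rewrite bump_test_linear; exact: linT.
    have [|c hc] := linear_continuous_dual lc; first by apply: contU; rewrite exprn_gt0.
    move=> r; exists (`|(2^-1 ^+ k) ^- n| * (`|c| * r)) => y yr.
    rewrite normrM ler_wpM2l// -[T _ _]/(U _) -hc (le_trans (pairing_le _ _))//.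
    by rewrite ler_wpM2l.
  have : cvgn (fun k => h (2^-1 ^+ k) y) by apply/cvg_ex; exists (c' y); exact: h_cvg.
  move=> /cvg_seq_bounded[M [_ hM]]; exists (`|M| + 1) => f [k _ <-].
  by apply: hM => //; rewrite (le_lt_trans (ler_norm _))// ltrDl.
have [M hM] := FU 1.
have M0 : 0 <= M.
  by apply: le_trans (hM (h (2^-1 ^+ 0)) _ 0 _); rewrite ?normr_ge0 ?normr0//; exists 0%N.
have c1 y : `|y| <= 1 -> `|c' y| <= M.
  move=> y1; have H : `|h (2^-1 ^+ k) y| @[k --> \oo] --> `|c' y| by apply: cvg_norm; exact: h_cvg.
  rewrite -(cvg_lim (@norm_hausdorff _ R) H); apply: limr_le; first by apply/cvg_ex; exists `|c' y|.
  by apply: nearW => k; apply: (hM (h (2^-1 ^+ k))) => //; exists k.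
apply: (unit_bounded_linear_continuous c'_linear M0 c1).
Qed.

Let c_exists : exists c : dual Y, forall y, pairing y c * bump_mass a = c' y.
Proof.
have [c hc] := linear_continuous_dual c'_linear c'_continuous.
exists ((bump_mass a)^-1 *: c) => y.
by rewrite pairingZ mulrAC mulVf ?bump_mass_neq0// mul1r hc.
Qed.

Let D (c : dual Y) r phi : R := T r phi - poly_dist (cst c) (rescale a r phi).

Let D_linear c r : r != 0 -> linear (D c r : testfun n Y -> R^o).
Proof.
move=> r0 b f g; rewrite /D linT// (rescale_linear a r0) poly_dist_cst_linear.
by rewrite scalerBr addrACA opprD.
Qed.

Let D_dtest c r j phi : r != 0 -> D c r (dtest j phi) = T r (dtest j phi).
Proof.
move=> r0; rewrite /D dtest_rescale//.
have := poly_dist_cst_linear c r (dtest j (rescale a r phi)) 0.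
have := poly_dist_cst_linear c (- 1) 0 0; rewrite scaler0 addr0 scaleN1r addNr => P0.
by rewrite P0 !addr0 poly_dist_cst_dtest scaler0 => ->; rewrite subr0.
Qed.

Let D_sum c r (l : seq 'I_n) F : r != 0 ->
  D c r (\sum_(j <- l) F j) = \sum_(j <- l) D c r (F j).
Proof.
move=> r0; elim: l => [|j l IH].
  by rewrite !big_nil; have := D_linear c r0 (- 1) 0 0; rewrite scaler0 addr0 scaleN1r addNr.
by rewrite !big_cons -[F j]scale1r (D_linear c r0) IH !scale1r.
Qed.

(** On the divergence part the constant term contributes nothing and the functional is small; on the
    bump part the difference is r^n times the distance of the mean value to its limit. *)
Let unit_support c : (forall y, pairing y c * bump_mass a = c' y) -> forall A,
  admissible pt m A -> (forall phi, A phi -> vanishes_beyond 1 phi) ->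
  small o (s + n%:R) (D c) A.
Proof.
move=> hc A [[rho [C hA]] hpt] A1; have [K K1 HK] := @poincare R n Y m.
(* Potentials and bump coefficients are chosen for all test functions at once, with value 0 outside
   [A]; their bounds depend on [C] only, so they form admissible families again. *)
have /choice[F hF] : forall phi, exists p : ('I_n -> testfun n Y) * Y, A phi ->
  [/\ forall j, vanishes_beyond 1 (p.1 j),
      phi = \sum_j dtest j (p.1 j) + bump_test p.2,
      forall j x, bnd m (K * C) (p.1 j) x & `|p.2| <= K * C].
  move=> phi; have [Aphi|nA] := pselect (A phi); last by exists (fun=> 0, 0).
  have [psi [h1 h2 h3]] := HK phi (A1 _ Aphi).
  have [h4 h5] := h3 C (hA _ Aphi).2.
  by exists (psi, integrals (enum 'I_n) phi 0).
pose Aj (j : 'I_n) : set (testfun n Y) := [set (F phi).1 j | phi in A].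
have admA j : admissible pt m (Aj j).
  split; last by move=> p _ _ [f Af <-] [g Ag <-]; rewrite (hpt p f g).
  by exists 1, (K * C) => _ [phi Aphi <-]; have [h1 _ h3 _] := hF _ Aphi.
pose B : set Y := [set (F phi).2 | phi in A].
have H1 := small_fin (fun j => smallU j (admA j)).
have H2 : for_constants o (fun e => exists2 d, 0 < d & forall r y, 0 < r -> r < d -> B y ->
    `|h r y - c' y| <= e * r `^ s).
  apply: (@limit_small B (K * C)).
    by move=> _ [phi Aphi <-]; have [] := hF _ Aphi.
  by move=> p _ _ [f Af <-] [g Ag <-]; rewrite (hpt p f g).
have mono (e e' : R) : e <= e' -> forall s' r, e * r `^ s' <= e' * r `^ s'.
  by move=> ee s' r; rewrite ler_wpM2r ?powR_ge0.
have : for_constants o (fun e => (exists2 d, 0 < d & forall i r phi, 0 < r -> r < d ->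
    Aj i phi -> `|U (rescale a r (dtest i phi))| <= e * r `^ (s + n%:R)) /\
  (exists2 d, 0 < d & forall r y, 0 < r -> r < d -> B y ->
    `|h r y - c' y| <= e * r `^ s)).
  move: H1 H2; case: (o) => /= [H1 H2 e e0|[e1 e10 [d1 d10 H1]] [e2 e20 [d2 d20 H2]]].
    by split; [exact: H1|exact: H2].
  exists (Num.max e1 e2); first by rewrite lt_max e10.
  split; [exists d1 => // j r phi r0 rd Ap|exists d2 => // r y r0 rd By].
    by rewrite (le_trans (H1 _ _ _ r0 rd Ap))// mono// le_max lexx.
  by rewrite (le_trans (H2 _ _ r0 rd By))// mono// le_max lexx orbT.
(* The sum of [n] divergence terms and one bump term. *)
apply: (@for_constants_scale _ _ _ (n%:R + 1)); first by rewrite ltr_wpDl.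
move=> e e0 [[d1 d10 h1] [d2 d20 h2]].
exists (Num.min 1 (Num.min d1 d2)); first by rewrite !lt_min ltr01 d10.
move=> r phi r0; rewrite !lt_min => /andP[r1 /andP[rd1 rd2]] Aphi.
have rn0 : r != 0 by rewrite gt_eqF.
have [_ -> _ _] := hF _ Aphi; set y := (F phi).2.
have By : B y by exists phi.
rewrite -[\sum_j _]scale1r D_linear// scale1r D_sum//.
rewrite (le_trans (ler_normD _ _))// mulrDl mulrDl; apply: lerD.
  rewrite (le_trans (ler_norm_sum _ _ _))//.
  apply: (@le_trans _ _ (\sum_(j < n) e * r `^ (s + n%:R))).
    by apply: ler_sum => j _; rewrite D_dtest//; apply: h1 => //; exists phi.
  by rewrite sumr_const card_ord -[leLHS]mulr_natl mulrA.
rewrite /D poly_dist_bump ?(ltW r1)// hc mul1r.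
have -> : T r (bump_test y) = r ^+ n * h r y by rewrite /h mulrA divff ?mul1r// expf_neq0.
rewrite -mulrBr normrM ger0_norm ?exprn_ge0 ?(ltW r0)//.
rewrite powRD ?rn0 ?implybT// powR_mulrn ?(ltW r0)// mulrA mulrC.
by rewrite ler_wpM2r ?exprn_ge0 ?(ltW r0)// h2.
Qed.

Lemma constant_term : exists c : dual Y, forall A, admissible pt m A ->
  small o (s + n%:R)
    (fun r phi => U (rescale a r phi) - poly_dist (cst c) (rescale a r phi)) A.
Proof.
have [c hc] := c_exists; exists c => A [[rho0 [C hA]] hpt].
(* Dilating by 1/rho brings the supports into the unit cube. The scale [r] then becomes r rho, which
   costs the factor rho^(s + n) in the remainder. *)
pose rho := Num.max rho0 1.
have rho_ge1 : 1 <= rho by rewrite le_max lexx orbT.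
have rho_gt0 : 0 < rho by rewrite (lt_le_trans ltr01).
have rhoi_gt0 : 0 < rho^-1 by rewrite invr_gt0.
have rho_neq0 : rho != 0 by rewrite gt_eqF.
pose A' : set (testfun n Y) := [set rescale 0 rho^-1 phi | phi in A].
have A'1 phi : A' phi -> vanishes_beyond 1 phi.
  move=> [psi Apsi <-] x x1; have [v _] := hA psi Apsi.
  apply: (rescale0_vanishes rhoi_gt0 v); rewrite (le_lt_trans _ x1)//.
  by rewrite mulrC ler_pdivrMr// mul1r le_max lexx.
have admA' : admissible pt m A'.
  split; last by move=> p _ _ [f Af <-] [g Ag <-]; rewrite (hpt p f g).
  exists 1, ((1 + rho^-1^-1) ^+ m * C) => _ [phi Aphi <-]; split; first by apply: A'1; exists phi.
  by apply: rescale0_bnd => //; have [] := hA phi Aphi.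
have := unit_support hc admA' A'1.
apply: (@for_constants_scale _ _ _ (rho `^ (s + n%:R))); first by rewrite powR_gt0.
move=> e e0 [d d0 hd]; exists (d / rho); first by rewrite divr_gt0.
move=> r phi r0; rewrite ltr_pdivlMr// => rd Aphi; have rn0 : r != 0 by rewrite gt_eqF.
have := hd (r * rho) (rescale 0 rho^-1 phi) (mulr_gt0 r0 rho_gt0) rd.
move=> /(_ (ex_intro2 _ _ phi Aphi erefl)).
rewrite /D /T rescale_comp ?mulf_neq0 ?invr_eq0// mulfK// => /le_trans; apply.
by rewrite powRM ?(ltW r0) ?(ltW rho_gt0)// [_ `^ _ * rho `^ _]mulrC mulrA [e * _]mulrC.
Qed.

End ConstantTerm.
End Smallness.

(** * Polynomial functions *)

Section Homogeneous.
Context {R : realType} {n : nat} {W : normedModType R}.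
Local Notation V := 'rV[R]_n.
Local Notation e_ j := (delta_mx ord0 j : V).
Implicit Types (f g : V -> W) (x v a : V) (d k : nat).

(** Homogeneous polynomial maps described by generators, so that derivatives, Euler's relation and
    growth are obtained by structural induction. *)
Inductive homog : nat -> (V -> W) -> Prop :=
| homog_zero d : homog d (fun _ => 0)
| homog_cst w : homog 0 (fun _ => w)
| homog_add d f g : homog d f -> homog d g -> homog d (fun x => f x + g x)
| homog_mulx d j f : homog d f -> homog d.+1 (fun x => x ord0 j *: f x).

Lemma homog_scale (c : R) d f : homog d f -> homog d (fun x => c *: f x).
Proof.
elim=> {d f} [d|w|d f g _ Hf _ Hg|d j f _ Hf].
- by under eq_fun do rewrite scaler0; exact: homog_zero.
- exact: homog_cst.
- by under eq_fun do rewrite scalerDr; exact: homog_add.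
- rewrite (_ : (fun _ => _) = fun x => x ord0 j *: (c *: f x)); last first.
    by apply/funext => x; rewrite !scalerA mulrC.
  exact: homog_mulx.
Qed.

Lemma homog_smooth d f : homog d f -> smooth f.
Proof.
elim=> {d f} [d|w|d f g _ Hf _ Hg|d j f _ Hf].
- exact: smooth_cst.
- exact: smooth_cst.
- exact: smoothD.
- by apply: smoothM => //; exact: smooth_coord.
Qed.

Lemma deriveD_fun f g v : smooth f -> smooth g ->
  'D_v (fun x => f x + g x) = fun x => 'D_v f x + 'D_v g x.
Proof.
move=> sf sg; apply/funext => x.
by rewrite deriveD//; apply/diff_derivable/smooth_differentiable.
Qed.

Lemma deriveZ_fun (c : R) f v : smooth f -> 'D_v (fun x => c *: f x) = fun x => c *: 'D_v f x.
Proof. by move=> sf; have := iter_deriveZ c [:: v] sf. Qed.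

Lemma derive_mulx f j v : smooth f ->
  'D_v (fun x => x ord0 j *: f x) = fun x => v ord0 j *: f x + x ord0 j *: 'D_v f x.
Proof.
move=> sf; apply/funext => x.
have [_ ->] := derive_scale v (smooth_differentiable x (@smooth_coord R n j))
  (smooth_differentiable x sf).
by rewrite derive_coordE.
Qed.

Lemma derive_cst_fun (w : W) v : 'D_v (fun _ : V => w) = fun _ => 0.
Proof. by apply/funext => x; rewrite derive_cst. Qed.

Lemma homog_derive d f v : homog d f ->
  if d is d'.+1 then homog d' ('D_v f) else 'D_v f = fun _ => 0.
Proof.
elim=> {d f} [d|w|d f g Hf IHf Hg IHg|d j f Hf IHf].
- by rewrite derive_cst_fun; case: d => // d; exact: homog_zero.
- by rewrite derive_cst_fun.
- rewrite deriveD_fun; [|exact: homog_smooth Hf|exact: homog_smooth Hg].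
  case: d IHf IHg Hf Hg => [h1 h2 _ _|d h1 h2 _ _]; last exact: homog_add.
  apply/funext => x; have /= -> := congr1 (fun F => F x) h1.
  by have /= -> := congr1 (fun F => F x) h2; rewrite addr0.
- rewrite derive_mulx; last exact: homog_smooth Hf.
  apply: homog_add; first exact: homog_scale.
  case: d IHf {Hf} => [h|d IH]; last exact: homog_mulx.
  rewrite (_ : (fun _ => _) = fun _ => 0); first exact: homog_zero.
  by apply/funext => x; have /= -> := congr1 (fun F => F x) h; rewrite scaler0.
Qed.

Lemma homog0_cst f : homog 0 f -> exists w, f = fun _ => w.
Proof.
move: {1 3}0%N (erefl 0%N) => k kE H; elim: H kE => {k f} [d|w|d f g _ Hf _ Hg|d j f _ _ //] E.
- by exists 0.
- by exists w.
- by have [w ->] := Hf E; have [w' ->] := Hg E; exists (w + w').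
Qed.

Lemma homog_euler d f x : homog d f -> 'D_x f x = d%:R *: f x.
Proof.
elim=> {d f} [d|w|d f g Hf IHf Hg IHg|d j f Hf IHf].
- by rewrite derive_cst scaler0.
- by rewrite derive_cst scale0r.
- have /= -> := congr1 (fun F => F x) (deriveD_fun x (homog_smooth Hf) (homog_smooth Hg)).
  by rewrite IHf IHg scalerDr.
- have /= -> := congr1 (fun F => F x) (derive_mulx j x (homog_smooth Hf)).
  by rewrite IHf !scalerA -scalerDl -natr1 mulrDl mul1r addrC mulrC.
Qed.

Lemma homog_bound d f : homog d f -> exists2 C : R, 0 <= C & forall x, `|f x| <= C * `|x| ^+ d.
Proof.
elim=> {d f} [d|w|d f g _ [A A0 hA] _ [B B0 hB]|d j f _ [A A0 hA]].
- by exists 0 => // x; rewrite normr0 mul0r.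
- by exists `|w| => // x; rewrite expr0 mulr1.
- exists (A + B); first by rewrite addr_ge0.
  by move=> x; rewrite (le_trans (ler_normD _ _))// mulrDl lerD.
- exists A => // x; rewrite normrZ exprS mulrCA ler_pM//.
  exact: coord_le_norm.
Qed.

Definition polyL d f := exists2 g : nat -> V -> W,
  forall k, homog k (g k) & forall x, f x = \sum_(k < d.+1) g k x.

Lemma polyL_homog d k f : (k <= d)%N -> homog k f -> polyL d f.
Proof.
move=> kd Hf; exists (fun i => if i == k then f else fun _ => 0).
  by move=> i; case: eqP => [->//|_]; exact: homog_zero.
move=> x; have kd' : (k < d.+1)%N by [].
rewrite (bigD1 (Ordinal kd'))//= eqxx big1 ?addr0// => i ik.
by rewrite ifN.
Qed.

Lemma polyL_cst d w : polyL d (fun _ => w).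
Proof. by apply: polyL_homog (homog_cst w). Qed.

Lemma polyL_add d f g : polyL d f -> polyL d g -> polyL d (fun x => f x + g x).
Proof.
move=> [F HF EF] [G HG EG]; exists (fun k x => F k x + G k x).
  by move=> k; exact: homog_add.
by move=> x; rewrite EF EG big_split.
Qed.

Lemma polyL_scale (c : R) d f : polyL d f -> polyL d (fun x => c *: f x).
Proof.
move=> [F HF EF]; exists (fun k x => c *: F k x); first by move=> k; exact: homog_scale.
by move=> x; rewrite EF scaler_sumr.
Qed.

Lemma polyL_sum d (I : Type) (s : seq I) (F : I -> V -> W) :
  (forall i, polyL d (F i)) -> polyL d (fun x => \sum_(i <- s) F i x).
Proof.
move=> HF; elim: s => [|i s IH].
  by under eq_fun do rewrite big_nil; exact: polyL_cst.
by under eq_fun do rewrite big_cons; exact: polyL_add.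
Qed.

Lemma polyL_weaken d k f : (k <= d)%N -> polyL k f -> polyL d f.
Proof.
move=> kd [F HF EF]; rewrite (_ : f = fun x => \sum_(i < k.+1) F i x).
  apply: polyL_sum => i; apply: polyL_homog (HF i).
  by rewrite (leq_trans _ kd)// -ltnS.
exact/funext.
Qed.

Lemma polyL_mulx d j f : polyL d f -> polyL d.+1 (fun x => x ord0 j *: f x).
Proof.
move=> [F HF EF]; exists (fun k => if k is k'.+1 then fun x => x ord0 j *: F k' x else fun _ => 0).
  by case=> [|k]; [exact: homog_zero|exact: homog_mulx].
by move=> x; rewrite EF [RHS]big_ord_recl add0r scaler_sumr.
Qed.

Lemma polyL_smooth d f : polyL d f -> smooth f.
Proof.
move=> [F HF EF]; rewrite (_ : f = fun x => \sum_(i < d.+1) F i x); last exact/funext.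
by apply: smooth_sum => i; exact: homog_smooth (HF i).
Qed.

Lemma polyL_derive d f v : polyL d.+1 f -> polyL d ('D_v f).
Proof.
move=> [F HF EF]; rewrite (_ : 'D_v f = fun x => \sum_(i < d.+2) 'D_v (F i) x).
  apply: polyL_sum => i; have := homog_derive v (HF i).
  case: i => -[|i] /= id; first by move=> ->; exact: polyL_cst.
  exact: polyL_homog.
apply/funext => x; rewrite (funext EF) derive_fsum// => i.
exact/smooth_differentiable/homog_smooth/HF.
Qed.

Lemma polyL0_cst f : polyL 0 f -> exists w, f = fun _ => w.
Proof.
move=> [F HF EF]; have [w wE] := homog0_cst (HF 0%N); exists w.
by apply/funext => x; rewrite EF big_ord1 wE.
Qed.

Lemma homog_translate d f a : homog d f -> polyL d (fun x => f (x + a)).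
Proof.
elim=> {d f} [d|w|d f g _ Hf _ Hg|d j f _ Hf].
- exact: polyL_cst.
- exact: polyL_cst.
- exact: polyL_add.
- under eq_fun do rewrite mxE scalerDl; apply: polyL_add; first exact: polyL_mulx.
  by apply: polyL_scale; apply: polyL_weaken Hf.
Qed.

Lemma polyL_translate d f a : polyL d f -> polyL d (fun x => f (x + a)).
Proof.
move=> [F HF EF]; rewrite (_ : (fun _ => _) = fun x => \sum_(i < d.+1) F i (x + a)).
  apply: polyL_sum => i; apply: polyL_weaken (homog_translate a (HF i)).
  by rewrite -ltnS.
by apply/funext => x; rewrite EF.
Qed.

(** The Taylor polynomial at [a]: the homogeneous parts left out have degree at least q + 1 in x -
    a. *)
Lemma polyL_truncate d q f a : polyL d f -> (q <= d)%N ->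
  exists2 g, polyL q g & exists2 C : R, 0 <= C &
    forall x, `|x - a| <= 1 -> `|f x - g x| <= C * `|x - a| ^+ q.+1.
Proof.
move=> /(polyL_translate a)[F HF EF] qd.
exists (fun x => \sum_(i < q.+1) F i (x - a)).
  apply: polyL_sum => i; apply: polyL_weaken (homog_translate (- a) (HF i)).
  by rewrite -ltnS.
have /choice[C hC] : forall k, exists C : R, 0 <= C /\ forall x, `|F k x| <= C * `|x| ^+ k.
  by move=> k; have [C C0 hC] := homog_bound (HF k); exists C.
exists (\sum_(q.+1 <= i < d.+1) C i); first by rewrite sumr_ge0// => i _; case: (hC i).
move=> x xa; have -> : f x = \sum_(0 <= i < d.+1) F i (x - a).
  by rewrite -[x in f x](subrK a) EF big_mkord.
rewrite (big_cat_nat _ _ (n := q.+1))//= ?ltnS// big_mkord addrAC subrr add0r.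
rewrite (le_trans (ler_norm_sum _ _ _))// mulr_suml.
rewrite [leLHS]big_nat_cond [leRHS]big_nat_cond; apply: ler_sum => i /andP[/andP[qi _] _].
have [C0 hCi] := hC i; rewrite (le_trans (hCi _))// ler_wpM2l//.
by rewrite ler_wiXn2l.
Qed.

(** Commutation of D_v with the Euler field x -> D_x. *)
Lemma derive_euler f v y : smooth f ->
  'D_v (fun x => 'D_x f x) y = 'D_v f y + 'D_y ('D_v f) y.
Proof.
move=> sf; have sD j := @smooth_derive R n W f (e_ j) sf.
have -> : (fun x => 'D_x f x) = fun x => \sum_j x ord0 j *: 'D_(e_ j) f x.
  by apply/funext => x; rewrite (derive_coord x)//; exact: smooth_differentiable.
rewrite derive_fsum => [|j]; last first.
  apply/smooth_differentiable/smoothM => //; exact: smooth_coord.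
rewrite (eq_bigr _ (fun j _ => congr1 (fun F => F y) (derive_mulx j v (sD j)))) /=.
rewrite big_split /= -(derive_coord v); last exact: smooth_differentiable.
rewrite [in RHS](derive_coord y); last exact/smooth_differentiable/smooth_derive.
apply: (f_equal (fun z => 'D_v f y + z)); apply: eq_bigr => j _.
apply: (f_equal (fun z => y ord0 j *: z)); exact: derive_comm.
Qed.

(** The path t -> t f(t x) has derivative f(t x) + D_(t x) f(t x) = 0, vanishes at 0 and equals f(x)
    at 1. *)
Lemma euler_injective f : smooth f -> (forall x, f x + 'D_x f x = 0) -> f = fun _ => 0.
Proof.
move=> sf Ef; apply/funext => x.
pose g (t : R) : W := t *: f (0 + t *: x).
have g' t : is_derive t (1 : R) g 0.
  have L := @is_derive_line R V W f 0 x t (smooth_differentiable _ sf).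
  have dl : differentiable (fun s : R => f (0 + s *: x)) t by apply/derivable1_diffP; exact: ex_derive.
  have did : differentiable (id : R -> R) t by apply/derivable1_diffP; exact: derivable_id.
  have [d1 d2] := derive_scale (1 : R) did dl.
  have -> : 0 = 'D_1 g t; last by apply: DeriveDef => //; exact: diff_derivable.
  rewrite /g d2 derive_id derive_val scale1r add0r -deriveZv ?Ef//.
  exact: smooth_differentiable.
have := @mean_value_path R W g (fun=> 0) 0 (fun t _ => g' t).
rewrite normr0 => /(_ (fun _ _ => lexx _)); rewrite normr_le0 subr_eq0 => /eqP.
by rewrite /g scale0r !scale1r add0r.
Qed.

(* Euler's relation inverts the gradient degree by degree: if [A P_j] divides
   the part of degree [k] of [P_j] by [k + 1], the potential is
   [\sum_j x_j A P_j]. *)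
Lemma polyL_antiderivative d (P : 'I_n -> V -> W) : (forall j, polyL d (P j)) ->
  (forall i j, 'D_(e_ i) (P j) = 'D_(e_ j) (P i)) ->
  exists2 F, polyL d.+1 F & forall j, 'D_(e_ j) F = P j.
Proof.
move=> HP comm.
have /choice[g hg] : forall j, exists g : nat -> V -> W,
    (forall k, homog k (g k)) /\ forall x, P j x = \sum_(k < d.+1) g k x.
  by move=> j; have [g g1 g2] := HP j; exists g.
pose A j x : W := \sum_(k < d.+1) (k.+1%:R : R)^-1 *: g j k x.
have HA j : polyL d (A j).
  exists (fun k x => (k.+1%:R : R)^-1 *: g j k x) => // k.
  by apply: homog_scale; case: (hg j).
have sA j := polyL_smooth (HA j).
have EA j x : A j x + 'D_x (A j) x = P j x.
  rewrite derive_fsum => [|k]; last first.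
    by apply: smooth_differentiable; apply: smoothZ; apply: homog_smooth; case: (hg j) => + _; apply.
  rewrite (hg j).2 /A -big_split; apply: eq_bigr => k _ /=.
  have /= -> := congr1 (fun F => F x) (deriveZ_fun (k.+1%:R^-1) x (homog_smooth ((hg j).1 k))).
  rewrite (homog_euler x ((hg j).1 k)) -scalerDr -[X in X + _]scale1r -scalerDl.
  by rewrite scalerA nat1r mulVf ?pnatr_eq0// scale1r.
pose F x : W := \sum_j x ord0 j *: A j x.
have HF : polyL d.+1 F by apply: polyL_sum => j; exact: polyL_mulx.
have sF := polyL_smooth HF; exists F => // i.
have sM (G : 'I_n -> V -> W) j : smooth (G j) -> smooth (fun x => x ord0 j *: G j x).
  by apply: smoothM; exact: smooth_coord.
have DF (G : 'I_n -> V -> W) v x : (forall j, smooth (G j)) ->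
    'D_v (fun x => \sum_j x ord0 j *: G j x) x = \sum_j (v ord0 j *: G j x + x ord0 j *: 'D_v (G j) x).
  move=> sG; rewrite derive_fsum => [|j]; last exact/smooth_differentiable/sM.
  by apply: eq_bigr => j _; exact: (congr1 (fun F => F x) (derive_mulx j v (sG j))).
have EF x : 'D_x F x = \sum_j x ord0 j *: P j x.
  by rewrite DF//; apply: eq_bigr => j _; rewrite -scalerDr EA.
have sP j := polyL_smooth (HP j).
have sDF := smooth_derive (e_ i) sF.
have sPN : smooth (fun x => - 1 *: P i x) by exact: smoothZ.
(* The error D_i F - P_i is annihilated by identity plus Euler field: by commutation and D_x F = sum
   x_j P_j, the contributions reduce to P_i + D_x P_i on both sides, symmetry of the D_i P_j being
   used here. *)
have : (fun x => 'D_(e_ i) F x + (- 1) *: P i x) = fun _ => 0.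
  apply: euler_injective; first exact: smoothD.
  move=> x; have /= -> := congr1 (fun F => F x) (deriveD_fun x sDF sPN).
  have /= -> := congr1 (fun F => F x) (deriveZ_fun (- 1) x (sP i)).
  rewrite addrACA -scalerDr -derive_euler//.
  rewrite (_ : (fun x => 'D_x F x) = fun x => \sum_j x ord0 j *: P j x); last exact/funext.
  rewrite DF// big_split/=.
  have -> : \sum_j (e_ i) ord0 j *: P j x = P i x.
    rewrite (bigD1 i)//= mxE !eqxx scale1r big1 ?addr0// => j ji.
    by rewrite mxE (negbTE ji) andbF scale0r.
  have -> : \sum_j x ord0 j *: 'D_(e_ i) (P j) x = 'D_x (P i) x.
    rewrite (derive_coord x); last exact: smooth_differentiable.
    by apply: eq_bigr => j _; have /= -> := congr1 (fun F => F x) (comm i j).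
  by rewrite scaleN1r subrr.
move=> E; apply/funext => x; have := congr1 (fun f => f x) E.
by rewrite scaleN1r => /eqP; rewrite subr_eq0 => /eqP.
Qed.

Lemma homog_mulX (e : 'I_n -> nat) (s : seq 'I_n) (w : W) :
  homog (\sum_(j <- s) e j) (fun x => (\prod_(j <- s) x ord0 j ^+ e j) *: w).
Proof.
elim: s => [|j s IH].
  rewrite big_nil (_ : (fun _ => _) = fun _ => w); first exact: homog_cst.
  by apply/funext => x; rewrite big_nil scale1r.
have -> : (fun x : V => (\prod_(i <- j :: s) x ord0 i ^+ e i) *: w) =
    fun x => (x ord0 j ^+ e j * \prod_(i <- s) x ord0 i ^+ e i) *: w.
  by apply/funext => x; rewrite big_cons.
rewrite big_cons.
elim: (e j) => [|k IHk].
  rewrite (_ : (fun x : V => (_ * _) *: w) = fun x => (\prod_(i <- s) x ord0 i ^+ e i) *: w)//.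
  by apply/funext => x; rewrite expr0 mul1r.
have -> : (fun x : V => (x ord0 j ^+ k.+1 * \prod_(i <- s) x ord0 i ^+ e i) *: w) =
    fun x => x ord0 j *: ((x ord0 j ^+ k * \prod_(i <- s) x ord0 i ^+ e i) *: w).
  by apply/funext => x; rewrite scalerA mulrA -exprS.
exact: homog_mulx.
Qed.

Lemma homog_monomials d f : homog d f -> exists2 s : seq (multiindex n * W),
  forall p, List.In p s -> mdeg p.1 = d &
  forall x, f x = \sum_(p <- s) (\prod_j x ord0 j ^+ p.1 j) *: p.2.
Proof.
elim=> {d f} [d|w|d f g _ [s hs Es] _ [t ht Et]|d j f _ [s hs Es]].
- by exists [::] => // x; rewrite big_nil.
- exists [:: ([ffun=> 0%N], w)].
    by move=> _ [<-|//]; rewrite /mdeg big1// => j _; rewrite ffunE.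
  move=> x; rewrite big_seq1 big1 ?scale1r// => j _.
  by rewrite ffunE expr0.
- exists (s ++ t); last by move=> x; rewrite Es Et big_cat.
  by move=> p H; have [] := List.in_app_or _ _ _ H; [exact: hs|exact: ht].
- exists [seq (([ffun i => (p.1 i + (i == j))%N] : multiindex n), p.2) | p : multiindex n * W <- s].
    move=> _ /List.in_map_iff[p [<- /hs pd]]; rewrite /mdeg /=.
    under eq_bigr do rewrite ffunE.
    rewrite big_split /= -/(mdeg p.1) pd (bigD1 j)//= eqxx big1 ?addn0 ?addn1// => k kj.
    by rewrite (negbTE kj).
  move=> x; rewrite Es big_map scaler_sumr; apply: eq_bigr => p _ /=.
  rewrite scalerA; congr (_ *: _).
  rewrite (bigD1 j)//= [in RHS](bigD1 j)//= ffunE eqxx addn1 exprS mulrA; congr (_ * _).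
  by apply: eq_bigr => k kj; rewrite ffunE (negbTE kj) addn0.
Qed.

End Homogeneous.

(** * Polynomials given by coefficients and by homogeneous parts *)

Section PolynomialLe.
Context {R : realType} {n : nat} {Y : normedModType R}.
Local Notation V := 'rV[R]_n.
Local Notation e_ j := (delta_mx ord0 j : V).
Implicit Types (P Q : V -> dual Y).

Lemma polynomial_le_add (d : nat) P Q : polynomial_le d P -> polynomial_le d Q ->
  polynomial_le d (fun x => P x + Q x).
Proof.
move=> [b Eb] [c Ec]; exists (fun e => b e + c e) => x.
by rewrite Eb Ec -big_split; apply: eq_bigr => e _; rewrite scalerDr.
Qed.

Lemma polynomial_le_sum (d : nat) (I : Type) (s : seq I) (P : I -> V -> dual Y) :
  (forall i, List.In i s -> polynomial_le d (P i)) ->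
  polynomial_le d (fun x => \sum_(i <- s) P i x).
Proof.
elim: s => [_|i s IH h].
  by exists (fun=> 0) => x; rewrite big_nil big1// => e _; rewrite scaler0.
under eq_fun do rewrite big_cons.
by apply: polynomial_le_add; [apply: h; left|apply: IH => k ks; apply: h; right].
Qed.

Lemma polynomial_le_monomial (d : nat) (e : multiindex n) (w : dual Y) : (mdeg e <= d)%N ->
  polynomial_le d (fun x : V => (\prod_j x ord0 j ^+ e j) *: w).
Proof.
move=> ed; have ejd j : (e j <= d)%N.
  by apply: leq_trans ed; rewrite /mdeg (bigD1 j)//= leq_addr.
pose e' : {ffun 'I_n -> 'I_d.+1} := [ffun j => inord (e j)].
have e'E j : e' j = e j :> nat by rewrite ffunE inordK// ltnS.
exists (fun f => if f == e' then w else 0) => x.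
rewrite (bigD1 e') /=; last by under eq_bigr do rewrite e'E.
rewrite eqxx [X in _ = _ + X]big1 ?addr0; last by move=> f /andP[_ /negbTE ->]; rewrite scaler0.
by congr (_ *: _); apply: eq_bigr => j _; rewrite e'E.
Qed.

Definition polyZ (q : int) P := if q is Posz d then polyL d P else P = fun _ => 0.

Lemma polynomial_leP (q : int) P : polynomial_le q P <-> polyZ q P.
Proof.
case: q => d; last by split=> [/funext|-> x].
split=> [[c Ec]|[F HF EF]].
  have -> : P = fun x : V => \sum_(e <- [seq e : {ffun 'I_n -> 'I_d.+1} <-
    index_enum {ffun 'I_n -> 'I_d.+1} | (\sum_j e j <= d)%N])
    ((if (\sum_j e j <= d)%N then 1 else 0 : R) *: ((\prod_j x ord0 j ^+ e j) *: c e)).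
    apply/funext => x; rewrite Ec big_filter; apply: eq_bigr => e ->.
    by rewrite scale1r.
  apply: polyL_sum => e; case: ifP => ed; last first.
    rewrite (_ : (fun _ => _) = fun _ => 0); first exact: polyL_cst.
    by apply/funext => x; rewrite scale0r.
  apply: polyL_scale; exact: (polyL_homog ed (homog_mulX (fun j => e j : nat) (index_enum 'I_n) (c e))).
rewrite (funext EF); apply: polynomial_le_sum => k _.
have [s hs Es] := homog_monomials (HF k); rewrite (funext Es).
apply: polynomial_le_sum => p /hs pk; apply: polynomial_le_monomial.
by rewrite pk -ltnS.
Qed.

Lemma polyZ_smooth q P : polyZ q P -> smooth P.
Proof.
case: q => d; first exact: polyL_smooth.
by move=> ->; exact: smooth_cst.
Qed.

Lemma polyZ_derive (q : int) P v : polyZ (q + 1) P -> polyZ q ('D_v P).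
Proof.
case: q => [d|[|d]].
- by rewrite -PoszD addn1; exact: polyL_derive.
- by move=> /polyL0_cst[w ->]; exact: derive_cst_fun.
- rewrite (_ : Negz d.+1 + 1 = Negz d) => [->|]; first exact: derive_cst_fun.
  by rewrite !NegzE -[d.+2]addn1 PoszD opprD subrK.
Qed.

(** For q = -1 all P_j vanish and 0 is a potential of degree at most 0, which leaves room for the
    constant term added later. *)
Lemma polyZ_antiderivative (q : int) (P : 'I_n -> V -> dual Y) : - 1 <= q ->
  (forall j, polyZ q (P j)) -> (forall i j, 'D_(e_ i) (P j) = 'D_(e_ j) (P i)) ->
  exists2 F, polyZ (q + 1) F & forall j, 'D_(e_ j) F = P j.
Proof.
case: q => [d _ h c|[|d] // _ h _].
  by rewrite -PoszD addn1; exact: polyL_antiderivative.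
exists (fun _ => 0); first exact: (polyL_cst 0).
by move=> j; rewrite h; exact: derive_cst_fun.
Qed.

Lemma polyZ_add q P Q : polyZ q P -> polyZ q Q -> polyZ q (fun x => P x + Q x).
Proof.
case: q => d /=; first exact: polyL_add.
by move=> -> ->; apply/funext => x; rewrite addr0.
Qed.

Lemma polyZ_scale (c : R) q P : polyZ q P -> polyZ q (fun x => c *: P x).
Proof.
case: q => d /=; first exact: polyL_scale.
by move=> ->; apply/funext => x; rewrite scaler0.
Qed.

End PolynomialLe.

(** * Integration by parts against polynomials *)

Section SmallAlgebra.
Context {R : realType} {n : nat} {Y : completeNormedModType R}.
Implicit Types (o pt : bool) (m : nat) (F G : R -> testfun n Y -> R) (A B : set (testfun n Y)).

(** Replacing the test function and multiplying by a power r^t shifts the order by t; with t = 1 or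
    t = -1 this describes passing between a distribution and its derivative. *)
Lemma small_transfer o s t (c : R) F G A B (h : testfun n Y -> testfun n Y) : 0 < c ->
  (forall r phi, 0 < r -> A phi -> B (h phi) /\ `|G r phi| <= c * r `^ t * `|F r (h phi)|) ->
  small o s F B -> small o (t + s) G A.
Proof.
move=> c0 H; apply: (@for_constants_scale _ _ _ _ c) => // e e0 [d d0 hd].
exists d => // r phi r0 rd Aphi; have [Bp Gp] := H r phi r0 Aphi.
rewrite (le_trans Gp)// powRD ?(gt_eqF r0) ?implybT// -mulrA -[leRHS]mulrA.
rewrite ler_wpM2l ?(ltW c0)// mulrCA ler_wpM2l ?powR_ge0//.
exact: hd.
Qed.

Lemma small_subset o s F A B : A `<=` B -> small o s F B -> small o s F A.
Proof.
move=> AB; apply: (@for_constants_scale _ _ _ _ 1) => // e e0 [d d0 hd].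
by exists d => // r phi r0 rd /AB Bphi; rewrite mul1r hd.
Qed.

Lemma small_ext o s F G A : (forall r phi, 0 < r -> A phi -> `|G r phi| = `|F r phi|) ->
  small o s F A -> small o s G A.
Proof.
move=> FG; apply: (@for_constants_scale _ _ _ _ 1) => // e e0 [d d0 hd].
by exists d => // r phi r0 rd Aphi; rewrite FG// mul1r hd.
Qed.

Lemma smallB o s F G A : small o s F A -> small o s G A ->
  small o s (fun r phi => F r phi - G r phi) A.
Proof.
move=> sF sG.
have := @small_fin _ _ _ o bool s (fun b => if b then F else G) (fun _ => A).
have H b : small o s (if b then F else G) A by case: b.
move=> /(_ H); apply: (@for_constants_scale _ _ _ _ 2) => // e e0 [d d0 hd].
exists d => // r phi r0 rd Aphi; rewrite (le_trans (ler_normB _ _))//.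
rewrite -mulrA mulr_natl mulr2n.
by rewrite lerD//; [exact: (hd true)|exact: (hd false)].
Qed.

(** A big-O estimate yields a little-o estimate only at a strictly smaller order, whence the two
    cases of the hypothesis. *)
Lemma small_weaken o s s' F A : (if o then s' <= s else s' < s) -> small o s F A ->
  small true s' F A.
Proof.
case: o => /= [ss h e e0|ss [e0 e00 [d d0 hd]] e e1].
  have [d d0 hd] := h e e0; exists (Num.min d 1); first by rewrite lt_min d0 ltr01.
  move=> r phi r0; rewrite lt_min => /andP[rd r1] Aphi.
  rewrite (le_trans (hd _ _ r0 rd Aphi))// ler_wpM2l ?(ltW e0)// ger_powR//.
  by rewrite r0 ltW.
have t0 : 0 < s - s' by rewrite subr_gt0.
have ee : 0 < e / e0 by rewrite divr_gt0.
(* Below this threshold e0 r^(s - s') is at most e. *)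
exists (Num.min d ((e / e0) `^ (s - s')^-1)); first by rewrite lt_min d0 powR_gt0.
move=> r phi r0; rewrite lt_min => /andP[rd r1] Aphi.
rewrite (le_trans (hd _ _ r0 rd Aphi))// -[s](subrK s') powRD ?(gt_eqF r0) ?implybT//.
rewrite mulrA ler_wpM2r ?powR_ge0// mulrC -ler_pdivlMr//.
rewrite (@le_trans _ _ (((e / e0) `^ (s - s')^-1) `^ (s - s')))//.
  by rewrite ge0_ler_powR ?nnegrE ?powR_ge0 ?(ltW r0) ?(ltW t0) ?(ltW r1).
by rewrite -powRrM mulVf ?gt_eqF// powRr1// ltW.
Qed.

Lemma admissible1 pt m (phi : testfun n Y) : admissible pt m [set phi].
Proof.
split; last by move=> _ f g /= -> ->.
have [rho _ v] := testfun_vanishes phi; have [B _ hB] := smooth_vanishes_bnd m (@testfun_smooth _ _ _ phi) v.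
by exists rho, B => _ ->.
Qed.

End SmallAlgebra.

Section IntegrationByParts.
Context {R : realType} {n : nat} {Y : completeNormedModType R}.
Local Notation V := 'rV[R]_n.
Local Notation e_ j := (delta_mx ord0 j : V).
Implicit Types (phi psi : testfun n Y) (P Q : V -> dual Y).

Lemma poly_dist_continuous_integrand P phi : smooth P ->
  continuous (fun x => pairing (phi x) (P x)).
Proof.
by move=> sP; apply: pairing_continuous2; [exact: testfun_continuous|exact: smooth_continuous].
Qed.

Lemma poly_distD P Q phi : smooth P -> smooth Q ->
  poly_dist (fun x => P x + Q x) phi = poly_dist P phi + poly_dist Q phi.
Proof.
move=> sP sQ; have [rho _ v] := testfun_vanishes phi; rewrite !poly_distE -(@space_intD R n rho)//.
- exact: poly_dist_continuous_integrand.
- exact: vanishes_pairing.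
- exact: poly_dist_continuous_integrand.
- exact: vanishes_pairing.
Qed.

Lemma poly_distZ (c : R) P phi : smooth P ->
  poly_dist (fun x => c *: P x) phi = c * poly_dist P phi.
Proof.
move=> sP; have [rho _ v] := testfun_vanishes phi; rewrite !poly_distE.
rewrite -(@space_intZ R n rho)//; first exact: poly_dist_continuous_integrand.
exact: vanishes_pairing.
Qed.

Lemma mulx_test_subproof (j : 'I_n) phi : testfun_pred (fun x : V => x ord0 j *: phi x).
Proof.
have [rho _ v] := testfun_vanishes phi; apply: (@testfun_intro _ _ _ _ rho).
  by apply: smoothM; [exact: smooth_coord|exact: testfun_smooth].
by move=> x /v ->; rewrite scaler0.
Qed.

Definition mulx_test j phi : testfun n Y := TestFun (mulx_test_subproof j phi).

Lemma poly_dist_mulx j P phi :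
  poly_dist (fun x => x ord0 j *: P x) phi = poly_dist P (mulx_test j phi).
Proof.
rewrite !poly_distE; congr space_int; apply/funext => x.
by rewrite pairingZ /= pairingZr.
Qed.

Lemma dtest_mulx i j phi :
  dtest j (mulx_test i phi) = (e_ j) ord0 i *: phi + mulx_test i (dtest j phi).
Proof.
apply: testfun_eq => x; rewrite testfunZDE dtestE /= partial_mi1.
by have /= -> := congr1 (fun F => F x) (derive_mulx i (e_ j) (@testfun_smooth _ _ _ phi)).
Qed.

(** Induction on the generators: for constants a derivative integrates to zero, and a factor x_i is
    moved to the test function, where the product rule accounts for the derivative of x_i. *)
Lemma poly_dist_derive_homog d P j phi : homog d P ->
  poly_dist P (dtest j phi) = - poly_dist ('D_(e_ j) P) phi.
Proof.
move=> H; elim: H phi => {d P} [d|w|d f g Hf IHf Hg IHg|d i f Hf IHf] phi.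
- rewrite derive_cst_fun (poly_dist_cst_dtest 0 j phi) (_ : poly_dist _ _ = 0) ?oppr0//.
  rewrite poly_distE (_ : (fun _ => _) = cst (0 : R)).
    by rewrite /space_int Rintegral_cst// mul0r.
  by apply/funext.
- rewrite derive_cst_fun (poly_dist_cst_dtest w j phi) (_ : poly_dist _ _ = 0) ?oppr0//.
  rewrite poly_distE (_ : (fun _ => _) = cst (0 : R)).
    by rewrite /space_int Rintegral_cst// mul0r.
  by apply/funext.
- have sf := homog_smooth Hf; have sg := homog_smooth Hg.
  have H1 := poly_distD (dtest j phi) sf sg.
  have H2 := poly_distD phi (smooth_derive (e_ j) sf) (smooth_derive (e_ j) sg).
  by rewrite H1 IHf IHg (deriveD_fun (e_ j) sf sg) H2 opprD.
- have sf := homog_smooth Hf; have sD := smooth_derive (e_ j) sf.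
  rewrite (derive_mulx _ _ sf) poly_distD; last 2 first.
  + exact: smoothZ.
  + by apply: smoothM; [exact: smooth_coord|].
  rewrite poly_distZ// !poly_dist_mulx opprD -IHf dtest_mulx.
  rewrite (poly_dist_linear (smooth_continuous sf)) addrA.
  by rewrite -[_ *: poly_dist _ _]/(_ * poly_dist _ _) addNr add0r.
Qed.

Lemma polyZ0_dist phi : poly_dist (fun _ => 0) phi = 0.
Proof.
rewrite poly_distE (_ : (fun _ => _) = cst (0 : R)).
  by rewrite /space_int Rintegral_cst// mul0r.
by apply/funext.
Qed.

Lemma poly_dist_derive q P j phi : polyZ q P ->
  poly_dist P (dtest j phi) = - poly_dist ('D_(e_ j) P) phi.
Proof.
case: q => d; last first.
  by move=> ->; rewrite derive_cst_fun !polyZ0_dist oppr0.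
move=> [F HF EF]; rewrite (_ : P = fun x => \sum_(k < d.+1) F k x); last exact/funext.
elim: (index_enum _) => [|k l IH].
  rewrite (_ : (fun _ => _) = fun _ => 0); last by apply/funext => x; rewrite big_nil.
  by rewrite derive_cst_fun !polyZ0_dist oppr0.
have sS : smooth (fun x => \sum_(i <- l) F i x).
  by apply: smooth_sum => i; exact: homog_smooth (HF i).
have sk := homog_smooth (HF k).
rewrite (_ : (fun _ => _) = fun x => F k x + \sum_(i <- l) F i x); last first.
  by apply/funext => x; rewrite big_cons.
have H1 := poly_distD (dtest j phi) sk sS.
have H2 := poly_distD phi (smooth_derive (e_ j) sk) (smooth_derive (e_ j) sS).
by rewrite H1 IH (poly_dist_derive_homog _ _ (HF k)) (deriveD_fun (e_ j) sk sS) H2 opprD.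
Qed.

Lemma smooth_derive0_cst {W : normedModType R} (f : V -> W) : smooth f ->
  (forall j, 'D_(e_ j) f = fun _ => 0) -> f = fun _ => f 0.
Proof.
move=> sf Df; apply/funext => x.
have d z : differentiable f z by exact: smooth_differentiable.
have := @mean_value_ineq R W V f 0 x 0 0 (fun t _ => d _).
rewrite subr0 add0r normr_le0 subr_eq0 => H; apply/eqP/H => t _.
rewrite (derive_coord x (d _)) big1 ?subr0 ?normr0// => j _.
by have /= -> := congr1 (fun F => F (0 + t *: x)) (Df j); rewrite scaler0.
Qed.

(** Tested on the bump with coefficient [y], the hypothesis bounds the pairing times the mass of the
    bump by an arbitrarily small number, and the mass is not zero. *)
Lemma constant_unique (c : dual Y) a :
  (forall phi, small true (n%:R) (fun r psi => poly_dist (fun _ => c) (rescale a r psi)) [set phi]) ->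
  c = 0.
Proof.
move=> sQ; apply/val_inj/funext => y; apply/eqP; rewrite -normr_le0; apply/ler_addgt0Pr => e e0.
have M0 : 0 < `|bump_mass a| by rewrite normr_gt0 bump_mass_neq0.
have [d d0 hd] := sQ (bump_test y) (e * `|bump_mass a|) (mulr_gt0 e0 M0).
pose r := Num.min 1 d / 2.
have m0 : 0 < Num.min 1 d by rewrite lt_min ltr01.
have r0 : 0 < r by rewrite divr_gt0.
have : r < Num.min 1 d by rewrite ltr_pdivrMr// ltr_pMr// ltr1n.
rewrite lt_min => /andP[r1 rd].
have := hd r _ r0 rd erefl; rewrite (poly_dist_bump a c y r0 (ltW r1)).
rewrite powR_mulrn ?(ltW r0)// normrM normrX (gtr0_norm r0) mulrC.
by rewrite ler_pM2r ?exprn_gt0// normrM ler_pM2r// add0r.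
Qed.

(** Induction on the degree: by parts, the derivatives of [Q] satisfy the hypothesis with one order
    less and vanish, so that [Q] is constant. *)
Lemma polynomial_unique (q : int) Q a : polyZ q Q ->
  (forall phi, small true (q%:~R + n%:R) (fun r psi => poly_dist Q (rescale a r psi)) [set phi]) ->
  Q = fun _ => 0.
Proof.
case: q => d //; elim: d Q => [|d IH] Q.
  move=> /polyL0_cst[c ->] sQ; suff -> : c = 0 by [].
  by apply: (@constant_unique c a) => phi; have := sQ phi; rewrite add0r.
move=> HQ sQ; have sm := polyL_smooth HQ.
have DQ j : 'D_(e_ j) Q = fun _ => 0.
  apply: IH => [|phi]; first exact: polyL_derive.
  rewrite (_ : d%:~R + n%:R = - 1 + (d.+1%:~R + n%:R)); last first.
    by rewrite -addn1 PoszD intrD mulr1z -!pmulrn; ring.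
  apply: (@small_transfer _ _ _ _ _ _ 1 _ _ [set phi] [set dtest j phi] (dtest j)) (sQ (dtest j phi)) => //.
  move=> r _ r0 ->; split=> //; have rn0 : r != 0 by rewrite gt_eqF.
  have l0 := poly_dist_linear (smooth_continuous sm) r (dtest j (rescale a r phi)) 0.
  have P0 : poly_dist Q 0 = 0.
    by have := poly_dist_linear (smooth_continuous sm) (- 1) 0 0; rewrite scaler0 addr0 scaleN1r addNr.
  rewrite (dtest_rescale _ _ _ rn0); move: l0; rewrite P0 !addr0 => ->.
  have -> := poly_dist_derive j (rescale a r phi) (HQ : polyZ d.+1 Q).
  rewrite scalerN normrN -[_ *: _]/(_ * _) normrM (gtr0_norm r0) mul1r powR_inv1 ?(ltW r0)//.
  by rewrite mulrA mulVf// mul1r.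
have QE := smooth_derive0_cst sm DQ.
suff Q0 : Q 0 = 0 by rewrite QE Q0.
apply: (@constant_unique _ a) => phi; have := sQ phi; rewrite -QE.
by apply: small_weaken; rewrite lerDr ler0z.
Qed.

End IntegrationByParts.

(** * Integrating a gradient *)

Section Defects.
Context {R : realType} {n : nat} {Y : completeNormedModType R}.
Local Notation V := 'rV[R]_n.
Local Notation e_ j := (delta_mx ord0 j : V).
Implicit Types (phi psi : testfun n Y) (P Q : V -> dual Y) (T : sdistribution n Y) (a : V).

Definition defect T P a (r : R) phi : R :=
  T (rescale a r phi) - poly_dist P (rescale a r phi).

Lemma poly_dist0r P : smooth P -> poly_dist P (0 : testfun n Y) = 0.
Proof.
move=> sP; have := poly_dist_linear (smooth_continuous sP) (- 1) (0 : testfun n Y) 0.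
by rewrite scaler0 addr0 scaleN1r addNr.
Qed.

Lemma poly_distZr P (c : R) phi : smooth P -> poly_dist P (c *: phi) = c * poly_dist P phi.
Proof.
move=> sP; have := poly_dist_linear (smooth_continuous sP) c phi 0.
by rewrite poly_dist0r// !addr0.
Qed.

Lemma dist_derive1E j T phi : dist_derive (mi1 j) T phi = - T (dtest j phi).
Proof. have -> : dist_derive (mi1 j) T phi = (- 1) ^+ mdeg (mi1 j) * T (dtest j phi) by [].
by rewrite (_ : mdeg (mi1 j) = 1%N) ?mulN1r//; exact: (@mdeg_mi1 R). Qed.

(** The factor 1/r of the chain rule, together with integration by parts, is the exchange rate
    between the remainders of a distribution and of its derivative. *)
Lemma defect_derive q P T a j (r : R) phi : polyZ q P -> r != 0 ->
  defect (dist_derive (mi1 j) T) ('D_(e_ j) P) a r phi = - (r^-1 * defect T P a r (dtest j phi)).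
Proof.
move=> HP r0; rewrite /defect dist_derive1E dtest_rescale//.
have TZ (c : R) u : T (c *: u) = c * T u by rewrite linearZ.
rewrite TZ poly_distZr; last exact: polyZ_smooth HP.
by rewrite (poly_dist_derive j _ HP) -mulrBr mulrA mulVf// mul1r opprB addrC.
Qed.

Lemma defect_unique o (q : int) (s : R) T P Q a : (if o then q%:~R <= s else q%:~R < s) ->
  polyZ q P -> polyZ q Q ->
  (forall phi, small o (s + n%:R) (defect T P a) [set phi]) ->
  (forall phi, small o (s + n%:R) (defect T Q a) [set phi]) -> P = Q.
Proof.
move=> qs HP HQ sP sQ; have sN : smooth (fun x => - 1 *: Q x) by apply/smoothZ/(polyZ_smooth HQ).
have : (fun x => P x + (- 1) *: Q x) = fun _ => 0.
  apply: (@polynomial_unique _ _ _ q _ a).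
    by apply: polyZ_add => //; exact: polyZ_scale.
  move=> phi; have H := smallB (sQ phi) (sP phi).
  have qsn : if o then q%:~R + n%:R <= s + n%:R else q%:~R + n%:R < s + n%:R.
    by case: (o) qs; rewrite ?lerD2r ?ltrD2r.
  apply: small_ext (small_weaken qsn H) => r psi r0 _; rewrite /defect.
  rewrite (poly_distD _ (polyZ_smooth HP) sN) (poly_distZ _ _ (polyZ_smooth HQ)).
  by congr (`|_|); rewrite mulN1r; ring.
move=> E; apply/funext => x; have := congr1 (fun f => f x) E.
by rewrite scaleN1r => /eqP; rewrite subr_eq0 => /eqP.
Qed.

Lemma dtestC i j phi : dtest i (dtest j phi) = dtest j (dtest i phi).
Proof.
apply: testfun_eq => x; rewrite !dtestE.
exact/derive_comm/testfun_smooth.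
Qed.

(** Uniqueness is applied in degree l - 1 with remainder order s - 1 to the second derivatives. For
    l = 0 and l = -1 both sides are derivatives of constants. *)
Lemma gradient_compatible o (l : int) (s : R) T a (P : 'I_n -> V -> dual Y) : -1 <= l ->
  (if o then l%:~R <= s else l%:~R < s) -> (forall j, polyZ l (P j)) ->
  (forall j phi, small o (s + n%:R) (defect (dist_derive (mi1 j) T) (P j) a) [set phi]) ->
  forall i j, 'D_(e_ i) (P j) = 'D_(e_ j) (P i).
Proof.
move=> l1 ls HP sP i j; case: l => [[|l]|[|l]] // in l1 ls HP *.
- have [c ->] := polyL0_cst (HP i); have [d ->] := polyL0_cst (HP j).
  by rewrite !derive_cst_fun.
- pose Q k := dist_derive (mi1 k) T.
  have E phi : dist_derive (mi1 i) (Q j) phi = dist_derive (mi1 j) (Q i) phi.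
    rewrite [LHS]dist_derive1E [RHS]dist_derive1E [Q j _]dist_derive1E [Q i _]dist_derive1E.
    by rewrite dtestC.
  have HD k k' : polyZ l%:Z ('D_(e_ k) (P k')).
    by apply: polyZ_derive; rewrite -PoszD addn1; exact: HP.
  have S k k' phi : small o (- 1 + (s + n%:R)) (defect (dist_derive (mi1 k) (Q k')) ('D_(e_ k) (P k')) a) [set phi].
    apply: (@small_transfer _ _ _ _ _ _ 1 _ _ [set phi] [set dtest k phi] (dtest k)) (sP k' (dtest k phi)) => //.
    move=> r _ r0 ->; split=> //; have rn0 : r != 0 by rewrite gt_eqF.
    rewrite (defect_derive _ _ _ _ (HP k') rn0) normrN normrM normfV (gtr0_norm r0).
    by rewrite mul1r powR_inv1 ?(ltW r0).
  apply: (@defect_unique o l%:Z (- 1 + s) (dist_derive (mi1 i) (Q j)) _ _ a) => //.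
  + have E1 : l.+1%:~R = 1 + l%:~R :> R by rewrite -addn1 PoszD intrD mulr1z addrC.
    by case: (o) ls; rewrite E1; lra.
  + by move=> phi; rewrite -addrA; exact: S.
  + move=> phi; rewrite -addrA; apply: small_ext (S j i phi) => r psi r0 _.
    by rewrite /defect E.
- by rewrite (HP i) (HP j) !derive_cst_fun.
Qed.

Lemma nu_rescale_bump K i a r : r != 0 -> exists2 C : R, 0 < C &
  forall y : Y, (nu K i (rescale a r (bump_test y)) <= (C * `|y|)%:E)%E.
Proof.
move=> r0; have [C C0 hC] := @bump_test_bnd R n Y i.
have K0 : 0 < (1 + `|r^-1|) ^+ i * C by rewrite mulr_gt0 ?exprn_gt0// ltr_wpDr.
exists ((1 + `|r^-1|) ^+ i * C) => // y.
apply: ge_ereal_sup => _ [[x m] /= [Kx mi] <-].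
apply: ge_ereal_sup => _ [v /= v1 <-]; rewrite lee_fin /Dn.
rewrite (_ : testfun_val _ = fun x => bump_test y (r^-1 *: (x - a))); last exact: rescaleE.
rewrite iter_derive_rescale iter_derive_mapZ; last exact: testfun_smooth.
rewrite normrZ -mulrA ler_pM//.
  rewrite normrX size_tuple (@le_trans _ _ ((1 + `|r^-1|) ^+ m))//.
    by rewrite lerXn2r ?nnegrE ?addr_ge0// lerDr.
  by rewrite ler_weXn2l// lerDl.
apply: hC; first by rewrite size_tuple.
by move=> w /tnthP[k ->]; exact: v1.
Qed.

(** The rescaled bumps have support in one cube, on which a single seminorm [nu] controls a
    neighbourhood of 0; that seminorm is at most a multiple of the norm of the coefficient. *)
Lemma bump_rescale_continuous T a r : 0 < r ->
  continuous (fun y => T (rescale a r (bump_test y)) : R^o).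
Proof.
move=> r0; have rn0 : r != 0 by rewrite gt_eqF.
pose g y := rescale a r (bump_test y) : testfun n Y.
have gL : linear g.
  by move=> c y z; rewrite /g bump_test_linear (rescale_linear a rn0).
suff cg : continuous g.
  by move=> y; apply: (@continuous_comp _ _ _ g T); [exact: cg|exact: sdistribution_continuous].
move=> y A [B [oB By BA]].
have [U [cU hU] UB] := oB _ By.
(* The unit cube, scaled by [r] and moved to [a], lies in the cube of this radius about 0. *)
pose rho := r * 1 + `|a|.
have gv z : vanishes_beyond rho (g z).
  rewrite /g (_ : testfun_val _ = fun x => bump_test z (r^-1 *: (x - a))); last exact: rescaleE.
  move=> x xr; rewrite /= bump_prod_vanishes ?scale0r// normrZ gtr0_norm ?invr_gt0//.
  rewrite ltr_pdivlMl// -(ltrD2r `|a|) (lt_le_trans xr)//.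
  by rewrite -{1}(subrK a x) ler_normD.
have [i [e [e0 he]]] := hU _ (@compact_cube R n rho).
have [C C0 hC] := nu_rescale_bump [set x | `|x| <= rho] i a rn0.
have eC : 0 < e / C by rewrite divr_gt0.
have /cvgrPdist_lt/(_ _ eC) : z @[z --> y] --> y by exact: cvg_id.
apply: filterS => z yz; apply: BA.
have -> : g z = g y + g (z - y).
  by rewrite -[g y]scale1r -gL scale1r addrC subrK.
apply: UB; apply: he.
  rewrite /testfun_in /spt /=.
  have cl : closed [set x : V | `|x| <= rho].
    by apply: compact_closed; [exact: norm_hausdorff|exact: compact_cube].
  rewrite [X in _ `<=` X](closure_id _).1//; apply: closureS => x /= fx.
  by rewrite leNgt; apply: contra fx => /gv ->.
rewrite (le_lt_trans (hC _))// lte_fin mulrC -ltr_pdivlMr//.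
by rewrite distrC.
Qed.

Lemma poly_dist_bump_continuous P a r : smooth P -> 0 < r ->
  continuous (fun y => poly_dist P (rescale a r (bump_test y)) : R^o).
Proof.
move=> sP r0; have rn0 : r != 0 by rewrite gt_eqF.
pose rho := r * 1 + `|a|.
have rho0 : 0 <= rho by rewrite addr_ge0// mulr_ge0// ltW.
have [B B0 hB] := smooth_bnd_compact 0 (@compact_cube R n rho) sP.
have [A A0 hA] := @bump_test_bnd R n Y 0.
apply: (@unit_bounded_linear_continuous _ _ _ (B * (A * 1) * (2 * rho) ^+ n)).
- move=> c y z; rewrite bump_test_linear (rescale_linear a rn0).
  exact/poly_dist_linear/smooth_continuous.
- by rewrite !mulr_ge0 ?exprn_ge0 ?mulr_ge0 ?(ltW A0) ?(ltW B0).
move=> y y1; rewrite poly_distE.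
have gv : vanishes_beyond rho (rescale a r (bump_test y)).
  rewrite (_ : testfun_val _ = fun x => bump_test y (r^-1 *: (x - a))); last exact: rescaleE.
  move=> x xr; rewrite /= bump_prod_vanishes ?scale0r// normrZ gtr0_norm ?invr_gt0//.
  rewrite ltr_pdivlMl// -(ltrD2r `|a|) (lt_le_trans xr)//.
  by rewrite -{1}(subrK a x) ler_normD.
have bump_le x : `|rescale a r (bump_test y) x| <= A * 1.
  rewrite rescaleEx// (le_trans (bnd0 (hA _ _)))// ler_wpM2l// ltW//.
apply: (@space_int_bound R n rho 0) => //.
- exact: poly_dist_continuous_integrand.
- move=> x; have [xr|xr] := leP `|x| rho.
    by rewrite (le_trans (pairing_le _ _))// ler_pM//; exact: bnd0 (hB x xr).
  by rewrite (vanishes_pairing P gv xr) normr0 !mulr_ge0 ?(ltW A0) ?(ltW B0).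
- by move=> x; rewrite subr0; exact: vanishes_pairing.
Qed.

(** The condition comparing [l] and [s] secures uniqueness of the P_j, and s >= 0 puts the new order
    s + 1 in the range where the constant term converges. *)
Lemma integrate_gradient o pt m (l : int) (s : R) T a (P : 'I_n -> V -> dual Y) : -1 <= l ->
  0 <= s -> (if o then l%:~R <= s else l%:~R < s) -> (forall j, polyZ l (P j)) ->
  (forall j A, admissible pt m A ->
     small o (s + n%:R) (defect (dist_derive (mi1 j) T) (P j) a) A) ->
  exists2 Q, polyZ (l + 1) Q &
    forall A, admissible pt m A -> small o (s + 1 + n%:R) (defect T Q a) A.
Proof.
move=> l1 s0 ls HP sP.
have comp := gradient_compatible l1 ls HP (fun j phi => sP j _ (admissible1 pt m phi)).
have [F HF DF] := polyZ_antiderivative l1 HP comp.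
have sF := polyZ_smooth HF.
pose U phi : R^o := T phi - poly_dist F phi.
have linU : linear U.
  move=> c phi psi; rewrite /U linearP (poly_dist_linear (smooth_continuous sF)).
  by rewrite scalerBr addrACA opprD.
have contU r : 0 < r -> continuous (fun y => U (rescale a r (bump_test y))).
  move=> r0 y; apply: (@continuousB _ _ _ (fun y => T (rescale a r (bump_test y)) : R^o)
    (fun y => poly_dist F (rescale a r (bump_test y)))).
    exact: bump_rescale_continuous.
  exact: poly_dist_bump_continuous.
have s1 : 1 <= s + 1 by rewrite lerDr.
have smallU j A : admissible pt m A ->
    small o (s + 1 + n%:R) (fun r phi => U (rescale a r (dtest j phi))) A.
  move=> admA; rewrite -addrA addrCA.
  apply: (@small_transfer _ _ _ _ _ _ 1 _ _ A A id) (sP j A admA) => // r phi r0 Aphi.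
  split=> //; have rn0 : r != 0 by rewrite gt_eqF.
  rewrite -(DF j) (defect_derive T a j phi HF rn0) normrN normrM normfV (gtr0_norm r0).
  by rewrite mul1r powRr1 ?(ltW r0)// mulrA divff// mul1r.
have [c hc] := constant_term linU contU s1 smallU.
exists (fun x => F x + c).
  (* If l = -1, the degree bound is now 0 and admits the constant. *)
  apply: polyZ_add => //; case: (l) l1 => [d _|[|d]//].
    by rewrite -PoszD; exact: polyL_cst.
  by move=> _; exact: (polyL_cst 0).
move=> A admA; apply: small_ext (hc A admA) => r phi r0 _; rewrite /defect /U.
by rewrite poly_distD ?opprD ?addrA//; exact: smooth_cst.
Qed.

End Defects.

(** * The four notions of pointwise differentiability *)

Section DefectEstimates.
Context {R : realType} {n : nat} {Y : completeNormedModType R}.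
Local Notation V := 'rV[R]_n.
Implicit Types (phi psi : testfun n Y) (P Q : V -> dual Y) (T : sdistribution n Y) (a : V).

Lemma near_right0P (Q : R -> Prop) : (\forall r \near (0 : R)^'+, Q r) <->
  exists2 d, 0 < d & forall r, 0 < r -> r < d -> Q r.
Proof.
split=> [[d /= d0 hd]|[d d0 hd]].
  exists d => // r r0 rd; apply: hd => //=.
  by rewrite sub0r normrN gtr0_norm.
exists d => // r /=; rewrite sub0r normrN => rd r0.
by apply: hd => //; rewrite gtr0_norm in rd.
Qed.

Lemma defectZ T P a (r c : R) phi : smooth P -> r != 0 ->
  defect T P a r (c *: phi) = c * defect T P a r phi.
Proof.
move=> sP r0; rewrite /defect.
have -> : rescale a r (c *: phi) = c *: rescale a r phi.
  by apply: testfun_eq => x; rewrite testfunZE !rescaleEx// testfunZE.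
have TZ u : T (c *: u) = c * T u by rewrite linearZ.
by rewrite TZ poly_distZr// mulrBr.
Qed.

Lemma defect0 T P a (r : R) : smooth P -> r != 0 -> defect T P a r 0 = 0.
Proof. by move=> sP r0; have := defectZ T a 0 0 sP r0; rewrite scale0r mul0r. Qed.

Lemma scaled_defectE s T P a phi (r : R) : 0 < r ->
  scaled_defect s T P a phi r = defect T P a r phi / r `^ (s + n%:R).
Proof. by move=> r0; rewrite /scaled_defect -opprD powRN mulrC. Qed.

Lemma scaled_defect_le s T P a phi (r e : R) : 0 < r ->
  (`|scaled_defect s T P a phi r| <= e) = (`|defect T P a r phi| <= e * r `^ (s + n%:R)).
Proof.
move=> r0; have p0 : 0 < r `^ (s + n%:R) by rewrite powR_gt0.
by rewrite scaled_defectE// normrM normfV (gtr0_norm p0) ler_pdivrMr.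
Qed.

Lemma scaled_defectN s T P a phi (r : R) : smooth P -> 0 < r ->
  scaled_defect s T P a (- phi) r = - scaled_defect s T P a phi r.
Proof.
move=> sP r0; rewrite !scaled_defectE// -scaleN1r defectZ ?gt_eqF//.
by rewrite mulN1r mulNr.
Qed.

Lemma pt_polyP (q : int) T a P : pt_poly q T a P <-> polyZ q P /\
  forall phi, small true (q%:~R + n%:R) (defect T P a) [set phi].
Proof.
split=> -[HP h]; split; try exact/polynomial_leP; move=> phi.
  move=> e e0; have /cvgrPdist_le/(_ _ e0)/near_right0P[d d0 hd] := h phi.
  exists d => // r _ r0 rd ->; rewrite -scaled_defect_le//.
  by have := hd r r0 rd; rewrite sub0r normrN.
apply/cvgrPdist_le => e e0; apply/near_right0P; have [d d0 hd] := h phi e e0.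
by exists d => // r r0 rd; rewrite sub0r normrN scaled_defect_le// hd.
Qed.

Lemma limf_esup_ltyP (f : R -> \bar R) : (limf_esup f (0 : R)^'+ < +oo)%E <->
  exists2 M, 0 < M & exists2 d, 0 < d & forall r, 0 < r -> r < d -> (f r <= M%:E)%E.
Proof.
split=> [|[M M0 [d d0 hd]]].
  move=> /ereal_inf_lt[_ [A /near_right0P[d d0 hd] <-]] Soo.
  have [M M0 SM] : exists2 M : R, 0 < M & (ereal_sup [set f x | x in A] <= M%:E)%E.
    case: (ereal_sup _) Soo => [s _|//|_]; last by exists 1; rewrite ?ltr01// leNye.
    by exists (`|s| + 1); rewrite ?ltr_wpDl// lee_fin (le_trans (ler_norm s))// lerDl.
  exists M => //; exists d => // r r0 rd; apply: le_trans SM.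
  by apply: ereal_sup_ubound; exists r => //; exact: hd.
apply: (@le_lt_trans _ _ M%:E); last exact: ltry.
apply: (@le_trans _ _ (ereal_sup (f @` [set r | 0 < r < d]))).
  apply: ereal_inf_lbound; exists [set r | 0 < r < d] => //.
  by apply/near_right0P; exists d => // r r0 rd /=; rewrite r0.
by apply: ge_ereal_sup => _ [r /= /andP[r0 rd] <-]; exact: hd.
Qed.

(** The upper limits of the statement are one-sided; applying them to phi and to -phi bounds the
    absolute value. *)
Lemma pt_holderP (s : R) T a P : smooth P ->
  (forall phi, (limf_esup (fun r => (scaled_defect s T P a phi r)%:E) (0 : R)^'+ < +oo)%E) <->
  (forall phi, small false (s + n%:R) (defect T P a) [set phi]).
Proof.
move=> sP; split=> h psi.
  have /limf_esup_ltyP[M M0 [d d0 hd]] := h psi.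
  have /limf_esup_ltyP[M' M'0 [d' d'0 hd']] := h (- psi).
  exists (Num.max M M'); first by rewrite lt_max M0.
  exists (Num.min d d'); first by rewrite lt_min d0.
  move=> r _ r0 + ->; rewrite lt_min => /andP[rd rd'].
  rewrite -scaled_defect_le// ler_norml lerNl.
  have := hd r r0 rd; have := hd' r r0 rd'; rewrite scaled_defectN// !lee_fin => h1 h2.
  by rewrite !le_max h1 h2 orbT.
have [M M0 [d d0 hd]] := h psi.
apply/limf_esup_ltyP; exists M => //; exists d => // r r0 rd.
rewrite lee_fin (le_trans (ler_norm _))// scaled_defect_le//.
exact: hd.
Qed.

Lemma nu_unit_ballN i phi : nu_unit_ball i phi -> nu_unit_ball i (- phi).
Proof.
move=> [sphi nphi].
have NE x : testfun_val (- phi) x = - phi x by rewrite -scaleN1r testfunZE scaleN1r.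
have sm := @testfun_smooth _ _ _ phi.
split.
  change (spt (testfun_val (- phi)) `<=` eball 0 1); apply: subset_trans sphi.
  apply: closureS => x; change (testfun_val (- phi) x != 0 -> phi x != 0).
  by rewrite NE oppr_eq0.
have -> : testfun_val (- phi) = (fun x => - 1 *: phi x).
  by apply/funext => x; rewrite NE scaleN1r.
apply: le_trans nphi; apply: ereal_sup_le => _ [[x m] /= xm <-].
exists (x, m) => //; rewrite /mlin_norm; congr ereal_sup; apply: eq_imagel => v _.
by rewrite /Dn /= iter_deriveZ// scaleN1r normrN.
Qed.

Lemma sup_defect_leP i (s : R) T P a (r e : R) : smooth P -> 0 < r ->
  (sup_defect i s T P a r <= e%:E)%E <->
  forall phi, nu_unit_ball i phi -> `|defect T P a r phi| <= e * r `^ (s + n%:R).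
Proof.
move=> sP r0; split=> [h phi Bphi|h].
  rewrite -scaled_defect_le// ler_norml lerNl -scaled_defectN// -!lee_fin.
  apply/andP; split; apply: le_trans h; apply: ereal_sup_ubound.
    by exists (- phi) => //; exact: nu_unit_ballN.
  by exists phi.
apply: ge_ereal_sup => _ [phi Bphi <-].
by rewrite lee_fin (le_trans (ler_norm _))// scaled_defect_le// h.
Qed.

Lemma sup_defect_ge0 i (s : R) T P a (r : R) : smooth P -> 0 < r ->
  (0 <= sup_defect i s T P a r)%E.
Proof.
move=> sP r0; have B0 : nu_unit_ball i (0 : testfun n Y).
  split.
    rewrite /testfun_in /= /spt (_ : [set x | _] = set0) ?closure0//.
    by apply/seteqP; split=> x //=; rewrite eqxx.
  apply: ge_ereal_sup => _ [[x m] /= xm <-]; apply: ge_ereal_sup => _ [v _ <-].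
  have -> : Dn m (0 : testfun n Y) x v = 0.
    rewrite /Dn; elim: (tval v) x {xm} => //= w vs IH x.
    by rewrite (_ : iter_derive vs _ = fun _ => 0) ?derive_cst//; apply/funext => z; exact: IH.
  by rewrite normr0 lee_fin.
apply: ereal_sup_ubound; exists 0 => //.
by rewrite scaled_defectE// defect0 ?mul0r// gt_eqF.
Qed.

Lemma nu_defectP i (s : R) T P a : smooth P ->
  (sup_defect i s T P a r @[r --> 0^'+] --> 0%E) <->
  small true (s + n%:R) (defect T P a) (nu_unit_ball i).
Proof.
move=> sP; split=> [h e e0|h].
  have : \forall r \near (0 : R)^'+, (sup_defect i s T P a r < e%:E)%E.
    by apply: (h [set x | (x < e%:E)%E]); apply: open_ereal_lt'; rewrite lte_fin.
  move=> /near_right0P[d d0 hd]; exists d => // r phi r0 rd Bphi.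
  by have := ltW (hd r r0 rd); rewrite sup_defect_leP//; apply.
move=> A [e /= e0 eA]; apply/near_right0P.
have e2 : 0 < e / 2 by rewrite divr_gt0.
have [d d0 hd] := h _ e2; exists d => // r r0 rd.
have /(sup_defect_leP _ _ _ _ _ sP r0) le : forall phi, nu_unit_ball i phi ->
    `|defect T P a r phi| <= e / 2 * r `^ (s + n%:R) by move=> phi; exact: hd.
suff H : A (sup_defect i s T P a r) by exact: H.
move: le (sup_defect_ge0 i s T a sP r0); case: (sup_defect i s T P a r) => [x| |]//; rewrite !lee_fin => xe x0.
apply: eA; rewrite /= sub0r normrN ger0_norm// (le_lt_trans xe)//.
by rewrite ltr_pdivrMr// ltr_pMr// ltr1n.
Qed.

Lemma nu_holderP i (s : R) T P a : smooth P ->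
  (limf_esup (sup_defect i s T P a) (0 : R)^'+ < +oo)%E <->
  small false (s + n%:R) (defect T P a) (nu_unit_ball i).
Proof.
move=> sP; split=> [/limf_esup_ltyP[M M0 [d d0 hd]]|[M M0 [d d0 hd]]].
  by exists M => //; exists d => // r phi r0 rd; exact: ((sup_defect_leP i s T a M sP r0).1 (hd r r0 rd)).
apply/limf_esup_ltyP; exists M => //; exists d => // r r0 rd.
by apply/(sup_defect_leP i s T a M sP r0) => phi; exact: hd.
Qed.

Lemma small_pointwise m o s (F : R -> testfun n Y -> R) :
  (forall phi, small o s F [set phi]) <-> (forall A, admissible true m A -> small o s F A).
Proof.
split=> [h A [_ hA]|h phi]; last exact/h/admissible1.
have [[phi Aphi]|nA] := pselect (exists phi, A phi).
  by apply: small_subset (h phi) => psi Apsi; exact: hA.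
by apply: small_subset (h 0) => psi Apsi; case: nA; exists psi.
Qed.

Lemma nu_unit_ball_admissible i : admissible false i (nu_unit_ball i : set (testfun n Y)).
Proof.
split=> //; exists 1, 1 => phi [sphi nphi]; split.
  apply: vanishes_spt => x /sphi; rewrite /eball /= subr0.
  exact/le_trans/norm_le_enorm.
move=> x vs sz hvs.
have [xB|xB] := pselect (eball 0 1 x); last first.
  suff -> : iter_derive vs phi x = 0 by rewrite normr0.
  apply/eqP/negPn/negP => nz; apply/xB/sphi/(@spt_iter_derive R n Y vs).
  exact: subset_closure.
rewrite -lee_fin; apply: le_trans nphi.
apply: (@le_trans _ _ (mlin_norm (Dn (size vs) phi x))); last first.
  by apply: ereal_sup_ubound; exists (x, size vs).
apply: ereal_sup_ubound; exists (in_tuple vs) => // j; apply: hvs.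
exact: mem_tnth.
Qed.

(** A bounded family with common bounded support is carried into the unit ball by shrinking the
    supports and dividing by a constant; shrinking only changes the scale [r] by a fixed factor. *)
Lemma small_nu_unit_ball i o s T P a : smooth P ->
  small o s (defect T P a) (nu_unit_ball i) <->
  forall A, admissible false i A -> small o s (defect T P a) A.
Proof.
move=> sP; split=> [h A [[rho [C hA]] _]|]; last by apply; exact: nu_unit_ball_admissible.
(* The Euclidean norm is at most [n] times the sup norm, so dilation by 1/lam maps the cube of
   radius [rho] into the Euclidean unit ball. *)
pose lam : R := n%:R * `|rho| + 1.
have lam0 : 0 < lam by rewrite ltr_wpDl// mulr_ge0.
have ln0 : lam != 0 by rewrite gt_eqF.
have li0 : 0 < lam^-1 by rewrite invr_gt0.
have lin0 : lam^-1 != 0 by rewrite gt_eqF.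
(* The bound of [rescale0_bnd] for derivatives after shrinking, with 1 added for positivity. *)
pose K : R := (1 + lam) ^+ i * `|C| + 1.
have K0 : 0 < K by rewrite ltr_wpDl// mulr_ge0// exprn_ge0// addr_ge0// ltW.
have Kn0 : K != 0 by rewrite gt_eqF.
pose g phi : testfun n Y := K^-1 *: rescale 0 lam^-1 phi.
have gB phi : A phi -> nu_unit_ball i (g phi).
  move=> Aphi; have [v b] := hA phi Aphi.
  have gE x : g phi x = K^-1 *: phi (lam *: x).
    by rewrite /g testfunZE rescaleEx// invrK subr0.
  split.
    have cl : closed (eball 0 1 : set V).
      have -> : eball 0 1 = (fun x : V => \sum_(j < n) x ord0 j ^+ 2) @^-1` [set z : R | z <= 1].
        apply/seteqP; split=> x; rewrite /eball /= subr0 /enorm.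
          by rewrite -{1}sqrtr1 ler_psqrt ?nnegrE ?sumr_ge0// => j _; rewrite sqr_ge0.
        by rewrite -{2}sqrtr1 ler_psqrt ?nnegrE ?sumr_ge0// => j _; rewrite sqr_ge0.
      apply: closed_comp; last exact: closed_le.
      move=> x _; apply: smooth_continuous; apply: smooth_sum => j.
      rewrite (_ : (fun _ => _) = fun y : V => y ord0 j *: (y ord0 j : R^o)).
        by apply: smoothM; exact: smooth_coord.
      by apply/funext => y; rewrite expr2.
    rewrite /testfun_in /= /spt [X in _ `<=` X](closure_id _).1//; apply: closureS => x /=.
    change (g phi x != 0 -> eball 0 1 x); rewrite gE => gx; have : `|lam *: x| <= rho.
      by rewrite leNgt; apply: contra gx => /v ->; rewrite scaler0.
    rewrite normrZ (gtr0_norm lam0) => xr; rewrite /eball /= subr0.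
    rewrite (le_trans (enorm_le_norm _))// -(ler_pM2l lam0) mulr1 mulrCA.
    rewrite (@le_trans _ _ (n%:R * `|rho|))//; last by rewrite lerDl.
    by rewrite ler_wpM2l// (le_trans xr)// ler_norm.
  apply: ge_ereal_sup => _ [[x m] /= [_ mi] <-]; apply: ge_ereal_sup => _ [w /= w1 <-].
  change (`|Dn m (testfun_val (g phi)) x w|%:E <= 1)%E.
  rewrite lee_fin /Dn (_ : testfun_val (g phi) = fun x => K^-1 *: rescale 0 lam^-1 phi x)//.
  rewrite iter_deriveZ; last exact: testfun_smooth.
  rewrite normrZ normfV (gtr0_norm K0) ler_pdivrMl// mulr1.
  have := rescale0_bnd li0 b; rewrite invrK => /(_ x w).
  rewrite size_tuple mi => /(_ isT) H; rewrite (le_trans (H _))//.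
    by move=> z /tnthP[j ->]; exact: w1.
  rewrite /K (@le_trans _ _ ((1 + lam) ^+ i * `|C|)) ?lerDl//.
  by rewrite ler_wpM2l ?ler_norm// exprn_ge0// addr_ge0// ltW.
move: h; apply: (@for_constants_scale _ _ _ _ (K * lam `^ s)).
  by rewrite mulr_gt0// powR_gt0.
move=> e e0 [d d0 hd]; exists (d / lam); first by rewrite divr_gt0.
move=> r phi r0; rewrite ltr_pdivlMr// => rd Aphi; have rn0 : r != 0 by rewrite gt_eqF.
have := hd _ _ (mulr_gt0 r0 lam0) rd (gB _ Aphi).
rewrite /g defectZ ?mulf_neq0// normrM normfV (gtr0_norm K0) ler_pdivrMl//.
rewrite {1}/defect rescale_comp ?mulf_neq0// mulfK// -/(defect T P a r phi).
move=> /le_trans; apply; rewrite powRM ?(ltW r0) ?(ltW lam0)//.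
by rewrite le_eqVlt; apply/orP; left; apply/eqP; ring.
Qed.

(* The four notions of pointwise differentiability in one: [s] is the order of
   the remainder and [q] bounds the degree of the polynomial. *)
Definition expands o pt m (q : int) (s : R) T a P := polyZ q P /\
  forall A, admissible pt m A -> small o (s + n%:R) (defect T P a) A.

Lemma nu_pt_diffP i q T a : nu_pt_diff i q T a <->
  exists P, expands true false i q q%:~R T a P.
Proof.
split=> [[P HP h]|[P [HP h]]]; exists P.
- have HP' := (polynomial_leP _ _).1 HP; split=> //.
  by apply/small_nu_unit_ball; [exact: polyZ_smooth HP'|apply/nu_defectP => //; exact: polyZ_smooth HP'].
- exact/polynomial_leP.
- apply/nu_defectP; first exact: polyZ_smooth HP.
  by apply/small_nu_unit_ball => //; exact: polyZ_smooth HP.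
Qed.

Lemma nu_pt_diff_holderP i q alpha T a : nu_pt_diff_holder i q alpha T a <->
  exists P, expands false false i q (q%:~R + alpha) T a P.
Proof.
split=> [[P HP h]|[P [HP h]]]; exists P.
- have HP' := (polynomial_leP _ _).1 HP; split=> //.
  by apply/small_nu_unit_ball; [exact: polyZ_smooth HP'|apply/nu_holderP => //; exact: polyZ_smooth HP'].
- exact/polynomial_leP.
- apply/nu_holderP; first exact: polyZ_smooth HP.
  by apply/small_nu_unit_ball => //; exact: polyZ_smooth HP.
Qed.

Lemma pt_diffP q T a : pt_diff q T a <-> exists P, expands true true 0 q q%:~R T a P.
Proof.
split=> -[P]; first by move=> /pt_polyP[HP h]; exists P; split=> //; apply/small_pointwise.
by move=> [HP h]; exists P; apply/pt_polyP; split=> //; apply/(small_pointwise 0).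
Qed.

Lemma pt_diff_holderP q alpha T a : pt_diff_holder q alpha T a <->
  exists P, expands false true 0 q (q%:~R + alpha) T a P.
Proof.
split=> [[P HP h]|[P [HP h]]]; exists P.
- have HP' := (polynomial_leP _ _).1 HP; split=> //.
  exact/small_pointwise/(pt_holderP _ _ _ (polyZ_smooth HP')).
- exact/polynomial_leP.
- exact/(pt_holderP _ _ _ (polyZ_smooth HP))/(small_pointwise 0).
Qed.

End DefectEstimates.

(** * Iterated derivatives *)

Section MultiIndexDerivatives.
Context {R : realType} {n : nat} {Y : completeNormedModType R}.
Local Notation V := 'rV[R]_n.
Local Notation e_ j := (delta_mx ord0 j : V).
Implicit Types (xi o : multiindex n) (P Q : V -> dual Y) (T : sdistribution n Y) (a : V).

Definition addmi xi (j : 'I_n) : multiindex n := [ffun k => (xi k + (k == j))%N].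

Lemma count_basis_dirs xi (p : pred V) :
  count p (basis_dirs xi) = (\sum_j p (e_ j) * xi j)%N.
Proof.
rewrite count_flatten -map_comp sumnE big_map big_enum; apply: eq_bigr => j _ /=.
by rewrite count_nseq.
Qed.

Lemma basis_dirs_addmi xi j : perm_eq (basis_dirs (addmi xi j)) (e_ j :: basis_dirs xi).
Proof.
apply/permP => p; rewrite /= !count_basis_dirs.
under eq_bigr do rewrite ffunE mulnDr.
rewrite big_split /= addnC; congr (_ + _)%N.
by rewrite (bigD1 j)//= eqxx muln1 big1 ?addn0// => k /negbTE ->; rewrite muln0.
Qed.

Lemma mdeg_addmi xi j : mdeg (addmi xi j) = (mdeg xi).+1.
Proof.
by rewrite -!(@size_basis_dirs R) (perm_size (basis_dirs_addmi xi j)).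
Qed.

Lemma dist_derive_addmi xi j T phi :
  dist_derive (addmi xi j) T phi = dist_derive (mi1 j) (dist_derive xi T) phi.
Proof.
rewrite dist_derive1E.
have E u z : dist_derive z T u = (- 1) ^+ mdeg z * T (partial_testfun z u) by [].
rewrite !E mdeg_addmi exprS -mulrA mulN1r; congr (- (_ * T _)).
apply: testfun_eq => x.
change (partial (addmi xi j) phi x = partial xi (partial (mi1 j) phi) x).
rewrite partial_mi1 /partial -iter_derive_rcons.
have -> := iter_derive_perm (@testfun_smooth _ _ _ phi)
  (_ : perm_eq (basis_dirs (addmi xi j)) (rcons (basis_dirs xi) (e_ j))) => //.
by rewrite perm_sym perm_rcons perm_sym basis_dirs_addmi.
Qed.

Lemma defect_ext T T' P a r phi : (forall psi, T psi = T' psi) ->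
  defect T P a r phi = defect T' P a r phi.
Proof. by move=> TT'; rewrite /defect TT'. Qed.

(** Descending induction on the degree of [xi]: the first derivatives of D^xi T are the D^(xi + e_j)
    T, whose expansions are known one stage earlier. *)
Lemma expands_integrate (b pt : bool) (m : nat) (l : int) (s : R) T a (k : nat) :
  -1 <= l -> 0 <= s -> (if b then l%:~R <= s else l%:~R < s) ->
  (forall o, Xi n k o -> exists P, expands b pt m l s (dist_derive o T) a P) ->
  forall p xi, (mdeg xi + p)%N = k ->
    exists P, expands b pt m (l + p%:Z) (s + p%:R) (dist_derive xi T) a P.
Proof.
move=> l1 s0 ls h; elim=> [|p IH] xi xik.
  have [|P HP] := h xi; first by rewrite /Xi /= -xik addn0.
  by exists P; rewrite !addr0.
have /choice[P HP] : forall j, exists P, expands b pt m (l + p%:Z) (s + p%:R)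
    (dist_derive (addmi xi j) T) a P.
  by move=> j; apply: IH; rewrite mdeg_addmi addSnnS.
have sp0 : 0 <= s + p%:R by rewrite addr_ge0.
have lp1 : -1 <= l + p%:Z by rewrite (le_trans l1)// lerDl.
have lsp : if b then (l + p%:Z)%:~R <= s + p%:R else (l + p%:Z)%:~R < s + p%:R.
  by case: (b) ls; rewrite intrD -pmulrn; rewrite ?lerD2r ?ltrD2r.
have [|j A admA|Q HQ sQ] := @integrate_gradient _ _ _ b pt m _ _ (dist_derive xi T) a P lp1 sp0 lsp.
- by move=> j; case: (HP j).
- have [_ /(_ A admA)] := HP j; apply: small_ext => r phi r0 _.
  by congr (`|_|); apply: defect_ext => psi; rewrite dist_derive_addmi.
exists Q; rewrite -addn1 PoszD natrD !addrA; split=> //.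
Qed.

Lemma expands_pt_poly (b pt : bool) (m : nat) (q : int) (s : R) T a P :
  (if b then q%:~R <= s else q%:~R < s) -> expands b pt m q s T a P -> pt_poly q T a P.
Proof.
move=> qs [HP h]; apply/pt_polyP; split=> // phi.
apply: small_weaken (h _ (admissible1 pt m phi)).
by case: (b) qs; rewrite ?lerD2r ?ltrD2r.
Qed.

Lemma pt_poly_unique (q : int) T a P Q : pt_poly q T a P -> pt_poly q T a Q -> P = Q.
Proof.
move=> /pt_polyP[HP sP] /pt_polyP[HQ sQ].
exact: (@defect_unique _ _ _ true q q%:~R T P Q a).
Qed.

Lemma pt_poly_ext (q : int) T T' a P : (forall phi, T phi = T' phi) ->
  pt_poly q T a P -> pt_poly q T' a P.
Proof.
move=> TT' /pt_polyP[HP sP]; apply/pt_polyP; split=> // phi.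
by apply: small_ext (sP phi) => r psi _ _; congr (`|_|); exact: defect_ext.
Qed.

Lemma pt_poly_derive (q : int) T a P j : pt_poly (q + 1) T a P ->
  pt_poly q (dist_derive (mi1 j) T) a ('D_(e_ j) P).
Proof.
move=> /pt_polyP[HP sP]; apply/pt_polyP; split; first exact: polyZ_derive.
move=> phi; rewrite (_ : q%:~R + n%:R = - 1 + ((q + 1)%:~R + n%:R)); last first.
  by rewrite intrD mulr1z; ring.
apply: (@small_transfer _ _ _ _ _ _ 1 _ _ [set phi] [set dtest j phi] (dtest j)) (sP (dtest j phi)) => //.
move=> r _ r0 ->; split=> //; have rn0 : r != 0 by rewrite gt_eqF.
rewrite (defect_derive _ _ _ _ HP rn0) normrN normrM normfV (gtr0_norm r0).
by rewrite mul1r powR_inv1 ?(ltW r0).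
Qed.

(** Lower orders occur because [ptD] refers to the polynomial of exactly the order named. The
    discarded terms are bounded by r^(q + 1 + n) on rescaled test functions. *)
Lemma pt_poly_truncate (d q : nat) T a P : (q <= d)%N -> pt_poly d T a P ->
  exists Q, pt_poly q T a Q.
Proof.
move=> qd /pt_polyP[HP sP]; have [Q HQ [C C0 hC]] := polyL_truncate a HP qd.
exists Q; apply/pt_polyP; split=> // phi.
have sm := polyL_smooth HP; have sQ := polyL_smooth HQ.
have sN : smooth (fun x => - 1 *: Q x) by exact: smoothZ.
have [rho rho0 v] := testfun_vanishes phi.
have [B B0 hB] := smooth_vanishes_bnd 0 (@testfun_smooth _ _ _ phi) v.
(* The bound of phi, the Taylor remainder on its support, and the volume of the cube containing it,
   at scale r = 1. *)
pose K := B * (C * rho ^+ q.+1) * (2 * rho) ^+ n.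
have K0 : 0 <= K by rewrite !mulr_ge0 ?exprn_ge0 ?mulr_ge0 ?(ltW rho0) ?(ltW B0).
have E r psi : defect T Q a r psi =
    defect T P a r psi - poly_dist (fun x => - 1 *: P x + Q x) (rescale a r psi).
  rewrite /defect poly_distD//; last exact: smoothZ.
  by rewrite poly_distZ// mulN1r; ring.
have sd : small false (q.+1%:R + n%:R) (fun r psi =>
    poly_dist (fun x => - 1 *: P x + Q x) (rescale a r psi)) [set phi].
  exists (K + 1); first by rewrite ltr_wpDl.
  exists rho^-1; first by rewrite invr_gt0.
  move=> r _ r0 rrho ->; have rn0 : r != 0 by rewrite gt_eqF.
  have rr1 : r * rho <= 1 by rewrite -ler_pdivlMr// mul1r ltW.
  have rr0 : 0 <= r * rho by rewrite mulr_ge0// ltW.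
  have sD : smooth (fun x => - 1 *: P x + Q x) by apply: smoothD => //; exact: smoothZ.
  have vr x : r * rho < `|x - a| -> rescale a r phi x = 0.
    move=> xr; rewrite rescaleEx// v// normrZ gtr0_norm ?invr_gt0//.
    by rewrite ltr_pdivlMl.
  rewrite (@le_trans _ _ (B * (C * (r * rho) ^+ q.+1) * (2 * (r * rho)) ^+ n))//.
    rewrite poly_distE; apply: (@space_int_bound R n _ a) => //.
    - exact: poly_dist_continuous_integrand.
    - move=> x; have [xr|xr] := leP `|x - a| (r * rho); last first.
        by rewrite vr// pairing0r normr0 !mulr_ge0 ?exprn_ge0 ?(ltW B0).
      rewrite (le_trans (pairing_le _ _))// mulrC ler_pM//.
        by rewrite rescaleEx//; exact: bnd0 (hB _).
      rewrite scaleN1r addrC distrC (le_trans (hC _ (le_trans xr rr1)))//.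
      by rewrite ler_wpM2l// lerXn2r ?nnegrE.
    - by move=> x xr; rewrite vr// pairing0r.
  rewrite powRD ?rn0 ?implybT// !powR_mulrn ?(ltW r0)//.
  rewrite (@le_trans _ _ (K * (r ^+ q.+1 * r ^+ n)))//.
    by rewrite le_eqVlt; apply/orP; left; apply/eqP; rewrite /K !exprMn; ring.
  by rewrite ler_wpM2r ?mulr_ge0 ?exprn_ge0 ?(ltW r0)// lerDl.
have qn : q%:~R + n%:R < q.+1%:R + n%:R :> R by rewrite ltrD2r -pmulrn ltr_nat.
have dq : q%:~R + n%:R <= d%:~R + n%:R :> R by rewrite lerD2r ler_int.
apply: small_ext (smallB (small_weaken (o := true) dq (sP phi)) (small_weaken (o := false) qn sd)).
by move=> r psi _ _; rewrite E.
Qed.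

(** One step from [xi] towards [o]: some coordinate is strictly smaller, and raising it removes one
    direction from the difference. *)
Lemma mle_addmi xi o p : mle xi o -> mdeg o = (mdeg xi + p.+1)%N ->
  exists2 j, mle (addmi xi j) o & perm_eq (basis_dirs (msub o xi) : seq V)
    (rcons (basis_dirs (msub o (addmi xi j))) (e_ j)).
Proof.
move=> xo dxo; have [j xj] : exists j, (xi j < o j)%N.
  apply/not_existsP => h; have : (mdeg o <= mdeg xi)%N.
    by apply: leq_sum => j _; rewrite leqNgt; apply/negP/h.
  by rewrite dxo addnS ltnNge leq_addr.
exists j.
  move=> k; rewrite ffunE; case: eqP => [->|_]; first by rewrite addn1.
  by rewrite addn0; exact: xo.
have -> : msub o xi = addmi (msub o (addmi xi j)) j.
  apply/ffunP => k; rewrite !ffunE; case: eqP => [->|_]; last by rewrite !addn0.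
  by rewrite !addn1 subnSK.
by rewrite perm_sym perm_rcons perm_sym basis_dirs_addmi.
Qed.

Lemma pt_poly_partial T a (mu : nat) p xi o Q : mle xi o -> mdeg o = (mdeg xi + p)%N ->
  pt_poly (p + mu)%N (dist_derive xi T) a Q ->
  pt_poly mu (dist_derive o T) a (partial (msub o xi) Q).
Proof.
elim: p xi Q => [|p IH] xi Q xo dxo HQ.
  have ox : o = xi.
    apply/ffunP => j; apply/eqP; rewrite eqn_leq xo andbT leqNgt; apply/negP => xj.
    have : (mdeg xi < mdeg o)%N.
      rewrite /mdeg (bigD1 j)//= [X in (_ < X)%N](bigD1 j)//= -addSn leq_add//.
      by apply: leq_sum => k _; exact: xo.
    by rewrite dxo addn0 ltnn.
  rewrite /partial (_ : basis_dirs _ = [::]) ?ox//=.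
  apply/size0nil; rewrite size_basis_dirs /mdeg big1// => j _.
  by rewrite ffunE subnn.
have [j xjo pj] := mle_addmi xo dxo.
have sQ : smooth Q by case: HQ => /polynomial_leP/polyZ_smooth.
rewrite /partial (iter_derive_perm sQ pj) iter_derive_rcons.
apply: (IH (addmi xi j)) => //; first by rewrite mdeg_addmi addSnnS.
apply: (@pt_poly_ext _ (dist_derive (mi1 j) (dist_derive xi T))).
  by move=> phi; rewrite dist_derive_addmi.
apply: pt_poly_derive; rewrite addSn -addn1 PoszD in HQ.
exact: HQ.
Qed.

Lemma mdeg_msub xi o : mle xi o -> mdeg (msub o xi) = (mdeg o - mdeg xi)%N.
Proof.
move=> xo; have -> : mdeg o = (mdeg (msub o xi) + mdeg xi)%N.
  by rewrite /mdeg -big_split; apply: eq_bigr => j _; rewrite /= ffunE subnK.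
by rewrite addnK.
Qed.

(** By uniqueness [xget] returns the given polynomials. Both sides are then the same iterated
    derivative at [a], the contraction appending the directions of o - xi. *)
Lemma contract_partial T a (p mu : nat) xi o P : mdeg (msub o xi) = p ->
  pt_poly (p + mu)%N (dist_derive xi T) a P ->
  pt_poly mu (dist_derive o T) a (partial (msub o xi) P) ->
  contract_basis (msub o xi) (ptD (p + mu)%N (dist_derive xi T) a) =
  ptD mu (dist_derive o T) a.
Proof.
move=> dp HP HQ.
have XP : xget (0 : V -> dual Y) [set P | pt_poly (p + mu)%N (dist_derive xi T) a P] = P.
  by apply: xget_unique => // P' HP'; exact: pt_poly_unique HP' HP.
have XQ : xget (0 : V -> dual Y) [set P | pt_poly mu (dist_derive o T) a P] = partial (msub o xi) P.
  by apply: xget_unique => // P' HP'; exact: pt_poly_unique HP' HQ.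
apply/funext => v; rewrite /contract_basis /ptD XP XQ /Dn /partial -iter_derive_cat.
have sz : size (v ++ basis_dirs (msub o xi)) = (p + mu)%N.
  by rewrite size_cat size_tuple size_basis_dirs dp addnC.
congr (iter_derive _ _ _); apply: (@eq_from_nth _ 0); rewrite size_tuple ?sz// => i ip.
by rewrite (nth_mktuple _ _ (Ordinal ip)).
Qed.

(** The expansion of D^xi T has order l + k - m; it is truncated to order k - m + mu before
    differentiation, so that the result has order exactly mu. *)
Lemma contract_ptD T a (l k m mu : nat) xi o :
  (mu <= l)%N -> (m <= k)%N -> (forall o, Xi n k o -> exists P, pt_poly l (dist_derive o T) a P) ->
  Xi n m xi -> Xi n k o -> mle xi o ->
  contract_basis (msub o xi) (ptD (k - m + mu)%N (dist_derive xi T) a) =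
  ptD mu (dist_derive o T) a.
Proof.
move=> mul mk h xm ok xo.
have dox : mdeg o = (mdeg xi + (k - m))%N by rewrite ok xm subnKC.
have h' o' : Xi n k o' -> exists P, expands true true 0 l l%:~R (dist_derive o' T) a P.
  move=> /h[P /pt_polyP[HP sP]]; exists P; split=> //.
  exact/small_pointwise.
have [P HP] : exists P, expands true true 0 (l%:Z + (k - m)%:Z) (l%:~R + (k - m)%:R)
    (dist_derive xi T) a P.
  by apply: (expands_integrate _ _ _ h'); rewrite ?ler0z// xm subnKC.
have HP' : pt_poly (l + (k - m))%N (dist_derive xi T) a P.
  have lk : (l%:Z + (k - m)%:Z)%:~R <= l%:~R + (k - m)%:R :> R by rewrite intrD.
  exact: (expands_pt_poly (b := true) lk HP).
have [|Q HQ] := pt_poly_truncate (q := (k - m + mu)%N) _ HP'; first by rewrite addnC leq_add2r.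
apply: (contract_partial _ HQ); first by rewrite mdeg_msub// ok xm.
exact: pt_poly_partial dox HQ.
Qed.

End MultiIndexDerivatives.

Theorem mainTheorem11 (R : realType) (n i k : nat) (l : int) (alpha : R)
    (Y : completeNormedModType R) (T : sdistribution n Y) (a : 'rV[R]_n) :
  (1 <= n)%N -> (1 <= k)%N -> 0 < alpha -> alpha <= 1 -> 0 <= l%:~R + alpha ->
  [/\ (0 <= l ->
       (forall o, Xi n k o -> nu_pt_diff i l (dist_derive o T) a) ->
       forall (m : nat) xi, (m < k)%N -> Xi n m xi ->
         nu_pt_diff i (k%:Z + l - m%:Z) (dist_derive xi T) a),
      ((forall o, Xi n k o -> nu_pt_diff_holder i l alpha (dist_derive o T) a) ->
       forall (m : nat) xi, (m < k)%N -> Xi n m xi ->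
         nu_pt_diff_holder i (k%:Z + l - m%:Z) alpha (dist_derive xi T) a),
      (0 <= l ->
       (forall o, Xi n k o -> pt_diff l (dist_derive o T) a) ->
       forall (m : nat) xi, (m < k)%N -> Xi n m xi ->
         pt_diff (k%:Z + l - m%:Z) (dist_derive xi T) a),
      ((forall o, Xi n k o -> pt_diff_holder l alpha (dist_derive o T) a) ->
       forall (m : nat) xi, (m < k)%N -> Xi n m xi ->
         pt_diff_holder (k%:Z + l - m%:Z) alpha (dist_derive xi T) a) &
      ((0 <= l /\ forall o, Xi n k o -> nu_pt_diff i l (dist_derive o T) a) \/
       (forall o, Xi n k o -> nu_pt_diff_holder i l alpha (dist_derive o T) a) \/
       (0 <= l /\ forall o, Xi n k o -> pt_diff l (dist_derive o T) a) \/
       (forall o, Xi n k o -> pt_diff_holder l alpha (dist_derive o T) a) ->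
       forall (m mu : nat) (xi o : multiindex n),
         (m < k)%N -> Xi n m xi -> mu%:Z <= l -> Xi n k o -> mle xi o ->
         contract_basis (msub o xi) (ptD (k - m + mu)%N (dist_derive xi T) a) =
         ptD mu (dist_derive o T) a)].

Proof.
move=> n1 k1 a0 a1 la0.
(* As alpha <= 1, the integer l exceeds -2; the value -1 remains possible when alpha = 1. *)
have l1 : -1 <= l.
  have : (-2 : R) < l%:~R by lra.
  by rewrite -[-2]/((-2)%:~R) ltr_int; case: (l) => [d|[|[|d]]].
have xk m xi : (m < k)%N -> Xi n m xi -> (mdeg xi + (k - m))%N = k.
  by move=> mk xm; rewrite xm subnKC// ltnW.
have qE m : (m < k)%N -> k%:Z + l - m%:Z = l + (k - m)%:Z.
  move=> mk; have E : (k - m + m)%N = k by rewrite subnK// ltnW.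
  have -> : k%:Z = (k - m)%:Z + m%:Z by rewrite -[in LHS]E; exact: PoszD.
  by rewrite addrAC addrK addrC.
have sE m : (m < k)%N -> (k%:Z + l - m%:Z)%:~R = l%:~R + (k - m)%:R :> R.
  by move=> mk; rewrite (qE m mk) intrD.
have lal : l%:~R < l%:~R + alpha by rewrite ltrDl.
split=> [l0 h|h|l0 h|h|].
- move=> m xi mk xm; apply/nu_pt_diffP; rewrite (sE m mk) (qE m mk).
  have lR : 0 <= l%:~R :> R by rewrite ler0z.
  apply: (expands_integrate (b := true) l1 lR (lexx _) _ (xk m xi mk xm)) => o ok.
  exact/nu_pt_diffP/h.
- move=> m xi mk xm; apply/nu_pt_diff_holderP; rewrite (sE m mk) (qE m mk) addrAC.
  apply: (expands_integrate (b := false) l1 la0 lal _ (xk m xi mk xm)) => o ok.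
  exact/nu_pt_diff_holderP/h.
- move=> m xi mk xm; apply/pt_diffP; rewrite (sE m mk) (qE m mk).
  have lR : 0 <= l%:~R :> R by rewrite ler0z.
  apply: (expands_integrate (b := true) l1 lR (lexx _) _ (xk m xi mk xm)) => o ok.
  exact/pt_diffP/h.
- move=> m xi mk xm; apply/pt_diff_holderP; rewrite (sE m mk) (qE m mk) addrAC.
  apply: (expands_integrate (b := false) l1 la0 lal _ (xk m xi mk xm)) => o ok.
  exact/pt_diff_holderP/h.
- move=> H m mu xi o mk xm mul ok xo.
  (* Each of the four hypotheses implies little-o estimates of order l for single test functions,
     since alpha > 0. *)
  have E : forall o, Xi n k o -> exists P, pt_poly l (dist_derive o T) a P.
    move=> o' /[dup] ok' {}ok'; case: H => [[_ /(_ _ ok')]|[/(_ _ ok')|[[_ /(_ _ ok')]|/(_ _ ok')]]].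
    + by move=> /nu_pt_diffP[P HP]; exists P; apply: expands_pt_poly HP => /=.
    + by move=> /nu_pt_diff_holderP[P HP]; exists P; apply: expands_pt_poly HP => /=.
    + by [].
    + by move=> /pt_diff_holderP[P HP]; exists P; apply: expands_pt_poly HP => /=.
  (* A natural number mu <= l excludes negative l. *)
  case: l mul E {H l1 la0 qE sE lal} => [d|//] mul E.
  exact: (contract_ptD mul (ltnW mk) E xm ok xo).
Qed.
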